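(* Let $\Theta\subset\mathbb{R}^p$ be a nonempty connected open set and $0<\alpha\le\beta$, $0<\underline{\lambda}\le\bar\lambda$. For each $\theta\in\Theta$ let $f_\theta:\mathbb{R}^n\to\mathbb{R}$ be $C^1$, $\alpha$-strongly convex with $\beta$-Lipschitz gradient, $g_\theta:\mathbb{R}^m\to\mathbb{R}\cup\{+\infty\}$ closed convex proper, and $K_\theta\in\mathbb{R}^{m\times n}$ surjective with all singular values in $[\underline{\lambda},\bar\lambda]$. Then: (i) for each $\theta$, the function $\varphi_\theta(y):=f_\theta^*(-K_\theta^* y)$ is $\underline{\lambda}^2/\beta$-strongly convex on $\mathbb{R}^m$ and differentiable with $\bar\lambda^2/\alpha$-Lipschitz gradient $\nabla\varphi_\theta(y)=-K_\theta\nabla f_\theta^*(-K_\theta^*y)$. (ii) Let $a=\underline{\lambda}^2/\beta$, $b=\bar\lambda^2/\alpha$, $\gamma\in\big(0,\frac{2a}{(a+b)^2}\big)$, and assume that $T(\theta,y):=\mathrm{prox}_{\gamma g_\theta^*}(y)$ and $(\theta,y)\mapsto\nabla\varphi_\theta(y)$ are path differentiable jointly in $(\theta,y)\in\Theta\times\mathbb{R}^m$. Then the dual problem $\min_{y\in\mathbb{R}^m} f_\theta^*(-K_\theta^*y)+g_\theta^*(y)$ has a unique solution $y^\star(\theta)$ for each $\theta$, and $\theta\mapsto y^\star(\theta)$ is path differentiable on $\Theta$ with conservative Jacobian $$\mathcal{J}_{y^\star}(\theta)=\Big\{\big(\mathrm{Id}_m-V(\mathrm{Id}_m-\gamma Z)\big)^{-1}\big(U-\gamma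 VW\big):[U\ V]\in\mathrm{Jac}^c_T\big(\theta,\,y^\star(\theta)+\gamma K_\theta\nabla f_\theta^*(-K_\theta^*y^\star(\theta))\big),\ [W\ Z]\in\mathrm{Jac}^c_{\nabla\varphi}(\theta,y^\star(\theta))\Big\},$$ where $\mathrm{Jac}^c_{\nabla\varphi}$ is the joint Clarke Jacobian of $(\theta,y)\mapsto\nabla\varphi_\theta(y)$.
   Context: $h^*(y)=\sup_u\langle y,u\rangle-h(u)$ is the convex conjugate; $\mathrm{prox}_g(x)=\mathrm{argmin}_u\, g(u)+\frac12\|x-u\|^2$. Clarke Jacobian: for a locally Lipschitz $F:\mathbb{R}^N\to\mathbb{R}^k$, $\mathrm{Jac}^c_F(z)=\mathrm{conv}\{\lim_j \mathrm{Jac}_F(z_j): z_j\to z,\ F \text{ differentiable at } z_j\}$. A conservative Jacobian for a locally Lipschitz $F$ is a set-valued map $\mathcal{J}_F$ with nonempty values, locally bounded, with closed graph, such that for every absolutely continuous curve $c:[0,1]\to\mathbb{R}^N$, for almost every $t$, $\frac{d}{dt}F(c(t))=M\dot c(t)$ for all $M\in\mathcal{J}_F(c(t))$. $F$ is path differentiable if it is locally Lipschitz and admits a conservative Jacobian. Jacobians of maps of $(\theta,y)$ are written in block form $[U\ V]$ with $U$ the $\theta$-block and $V$ the $y$-block of the joint Jacobian. *)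

(* Defs.v *)
From HB Require Import structures.
From mathcomp Require Import all_boot all_order all_algebra.
From mathcomp Require Import all_classical all_reals all_analysis.
Set Implicit Arguments. Unset Strict Implicit. Unset Printing Implicit Defensive.
Import Order.TTheory GRing.Theory Num.Theory.
Import numFieldNormedType.Exports.
Local Open Scope classical_set_scope.
Local Open Scope ring_scope.

Section Defs.
Variable R : realType.

Definition dotv n (u v : 'cV[R]_n) : R := \sum_(i < n) u i ord0 * v i ord0.
Definition enorm n (u : 'cV[R]_n) : R := Num.sqrt (dotv u u).

(* gradient of a real function on R^n (meaningful where differentiable) *)
Definition grad n (f : 'cV[R]_n -> R) (x : 'cV[R]_n) : 'cV[R]_n :=
  \col_(i < n) ('d f x (delta_mx i ord0)).

(* Jacobian matrix of F : R^N -> R^k (meaningful where differentiable) *)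
Definition jac N k (F : 'cV[R]_N -> 'cV[R]_k) (z : 'cV[R]_N) : 'M[R]_(k, N) :=
  \matrix_(i < k, j < N) (('d F z (delta_mx j ord0)) i ord0).

Definition strongly_convex n (mu : R) (f : 'cV[R]_n -> R) :=
  forall (x y : 'cV[R]_n) (t : R), 0 <= t <= 1 ->
    f (t *: x + (1 - t) *: y) <=
    t * f x + (1 - t) * f y - mu / 2 * t * (1 - t) * enorm (x - y) ^+ 2.

Definition lipschitz_with n k (L : R) (F : 'cV[R]_n -> 'cV[R]_k) :=
  forall x y, enorm (F x - F y) <= L * enorm (x - y).

Definition econvex n (g : 'cV[R]_n -> \bar R) :=
  forall (x y : 'cV[R]_n) (t : R), 0 < t < 1 ->
    (g (t *: x + (1 - t) *: y)%R <= t%:E * g x + (1 - t)%R%:E * g y)%E.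
Definition eproper n (g : 'cV[R]_n -> \bar R) :=
  (forall x, g x != -oo%E) /\ exists x, g x \is a fin_num.
Definition eclosed n (g : 'cV[R]_n -> \bar R) :=
  forall c : R, closed [set x | (g x <= c%:E)%E].
Definition closed_convex_proper n (g : 'cV[R]_n -> \bar R) :=
  eclosed g /\ econvex g /\ eproper g.

Definition fconj n (f : 'cV[R]_n -> R) (y : 'cV[R]_n) : \bar R :=
  ereal_sup [set (dotv y u - f u)%:E | u in [set: 'cV[R]_n]].
Definition econj n (g : 'cV[R]_n -> \bar R) (y : 'cV[R]_n) : \bar R :=
  ereal_sup [set ((dotv y u)%:E - g u)%E | u in [set: 'cV[R]_n]].

Definition is_prox n (h : 'cV[R]_n -> \bar R) (x u : 'cV[R]_n) :=
  forall v, (h u + (enorm (x - u) ^+ 2 / 2)%:E <= h v + (enorm (x - v) ^+ 2 / 2)%:E)%E.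
Definition prox n (h : 'cV[R]_n -> \bar R) (x : 'cV[R]_n) : 'cV[R]_n :=
  xget 0 [set u | is_prox h x u].

(* singular values of K : 'M_(m,n) (min(m,n) of them, counted as sqrt of
   eigenvalues of K K^T if m <= n, of K^T K otherwise) *)
Definition singular_value m n (K : 'M[R]_(m, n)) (s : R) :=
  0 <= s /\ (if (m <= n)%N then eigenvalue (K *m K^T) (s ^+ 2)
             else eigenvalue (K^T *m K) (s ^+ 2)).

Definition conv_hull k N (S : set 'M[R]_(k, N)) (M : 'M[R]_(k, N)) :=
  exists (q : nat) (l : 'I_q -> R) (Ms : 'I_q -> 'M[R]_(k, N)),
    (forall i, 0 <= l i) /\ \sum_(i < q) l i = 1 /\ (forall i, S (Ms i)) /\
    M = \sum_(i < q) l i *: Ms i.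
Definition clarke_lim N k (F : 'cV[R]_N -> 'cV[R]_k) (z : 'cV[R]_N) (M : 'M[R]_(k, N)) :=
  exists zs : nat -> 'cV[R]_N,
    zs @ \oo --> z /\ (forall j, differentiable F (zs j)) /\
    (fun j => jac F (zs j)) @ \oo --> M.
Definition clarke_jac N k (F : 'cV[R]_N -> 'cV[R]_k) (z : 'cV[R]_N) : set 'M[R]_(k, N) :=
  conv_hull (clarke_lim F z).

Definition abs_cont01 N (c : R -> 'cV[R]_N) :=
  forall eps : R, 0 < eps -> exists2 delta : R, 0 < delta &
    forall (q : nat) (a b : 'I_q -> R),
      (forall i, 0 <= a i <= b i /\ b i <= 1) ->
      (forall i j, i != j -> b i <= a j \/ b j <= a i) ->
      \sum_(i < q) (b i - a i) < delta ->
      \sum_(i < q) enorm (c (b i) - c (a i)) < eps.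

Definition loc_lipschitz_on N k (D : set 'cV[R]_N) (F : 'cV[R]_N -> 'cV[R]_k) :=
  forall z, D z -> exists2 r : R, 0 < r & exists L : R,
    forall x y, enorm (x - z) < r -> enorm (y - z) < r ->
      enorm (F x - F y) <= L * enorm (x - y).

Definition conservative_on N k (D : set 'cV[R]_N) (F : 'cV[R]_N -> 'cV[R]_k)
    (J : 'cV[R]_N -> set 'M[R]_(k, N)) :=
  (forall z, D z -> exists M, J z M) /\
  (forall z, D z -> exists2 r : R, 0 < r & exists C : R,
      forall z' M, D z' -> enorm (z' - z) < r -> J z' M ->
        forall i j, `|M i j| <= C) /\
  (forall (zs : nat -> 'cV[R]_N) (Ms : nat -> 'M[R]_(k, N)) z M,
      (forall j, D (zs j)) -> D z -> zs @ \oo --> z -> Ms @ \oo --> M ->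
      (forall j, J (zs j) (Ms j)) -> J z M) /\
  (forall c : R -> 'cV[R]_N, abs_cont01 c -> (forall t, 0 <= t <= 1 -> D (c t)) ->
      {ae (@lebesgue_measure R), forall t : R, 0 < t < 1 ->
        derivable c t 1 /\ derivable (F \o c) t 1 /\
        forall M, J (c t) M -> 'D_1 (F \o c) t = M *m 'D_1 c t}).

Definition path_differentiable_on N k (D : set 'cV[R]_N) (F : 'cV[R]_N -> 'cV[R]_k) :=
  loc_lipschitz_on D F /\ exists J, conservative_on D F J.

End Defs.

(* Main.v *)
(** Minimizers of the dual problem are the fixed points of the forward-backward map
    [S(th, y) = prox_(gamma g_th^* )(y - gamma grad phi_th y)], a contraction in [y] because the
    proximal map is nonexpansive and [y - gamma grad phi_th y] is a strict contraction.  The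
    conjugate [f_th^*] is squeezed between two quadratic models with common gradient
    [(grad f_th)^-1], which gives the convexity and smoothness constants of [phi_th].

    For the conservative Jacobian, the point is that the Clarke Jacobian of a path differentiable
    [F] is itself conservative.  If [M v = w] for all [M] in [J z], integrating along segments
    parallel to [v] and upper semicontinuity of [J] give [M v = w] for all [M] in the Clarke
    Jacobian, which is the chain rule with [v] the velocity of the curve.  Nonemptiness
    needs a dense set of differentiability points: on lines parallel to the axes, [J] is
    almost everywhere single-valued in the corresponding column, so the points where [J] has
    oscillation less than [1/k] form a dense open set; by Baire, [J] is a singleton on a dense
    set, and there [F] is differentiable.  This avoids Rademacher's theorem and Fubini.

    Finally, along a curve [d], differentiating [y* (d t) = T(d t, y* (d t) - gamma grad phi)] with
    the two Clarke Jacobians gives a linear system for the derivative of [y* (d t)], whose matrix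
    [Id - V (Id - gamma Z)] is invertible as [V (Id - gamma Z)] is a strict contraction. *)
Require Import Defs.
From HB Require Import structures.
From mathcomp Require Import all_boot all_order all_algebra.
From mathcomp Require Import all_classical all_reals all_analysis.
From mathcomp Require Import ring lra.
Import Order.TTheory GRing.Theory Num.Theory.
Import numFieldNormedType.Exports.
Local Open Scope classical_set_scope.
Local Open Scope ring_scope.
Set Implicit Arguments. Unset Strict Implicit. Unset Printing Implicit Defensive.

(** Limits and differentials of matrices are taken in the max norm, whereas the hypotheses and the
    contraction argument live in the Euclidean norm [enorm]; passing between them costs dimension
    factors only. A conservative field speaks almost everywhere along curves, so integration along
    segments is replaced by a mean value inequality for Lipschitz functions whose derivative is
    bounded almost everywhere. Bounds on Clarke matrices come from one principle: a bound on
    difference quotients at all points near [z] survives limits and convex combinations. Existence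
    of proximal points, of fixed points of contractions and of extreme eigenvalues comes from
    minimizing a function with closed sublevel sets, one of them bounded. The closed graph of the
    Clarke Jacobian needs Caratheodory's theorem, since convex combinations of unbounded length do
    not pass to the limit. The contraction factor is the square root of 1 - 2 gamma a + gamma^2 b^2;
    it is below 1 once gamma < 2 a / b^2, which the bound 2 a / (a + b)^2 ensures. *)

Section Euclid.
Context {R : realType}.

(** * The Euclidean inner product and norm *)

Section dot.
Context {n : nat}.
Implicit Types (u v w : 'cV[R]_n) (a : R).

Lemma dotvC u v : dotv u v = dotv v u.
Proof. by apply: eq_bigr => i _; rewrite mulrC. Qed.

Lemma dotvDl u v w : dotv (u + v) w = dotv u w + dotv v w.
Proof. by rewrite -big_split/=; apply: eq_bigr => i _; rewrite mxE mulrDl. Qed.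

Lemma dotvZl a u v : dotv (a *: u) v = a * dotv u v.
Proof. by rewrite /dotv mulr_sumr; apply: eq_bigr => i _; rewrite mxE mulrA. Qed.

Lemma dotvNl u v : dotv (- u) v = - dotv u v.
Proof. by rewrite -scaleN1r dotvZl mulN1r. Qed.

Lemma dotvDr u v w : dotv w (u + v) = dotv w u + dotv w v.
Proof. by rewrite dotvC dotvDl !(dotvC w). Qed.

Lemma dotvZr a u v : dotv v (a *: u) = a * dotv v u.
Proof. by rewrite dotvC dotvZl (dotvC v). Qed.

Lemma dotvNr u v : dotv v (- u) = - dotv v u.
Proof. by rewrite dotvC dotvNl (dotvC v). Qed.

Lemma dotv0l u : dotv 0 u = 0.
Proof. by rewrite -(scale0r 0) dotvZl mul0r. Qed.

Lemma dotv0r u : dotv u 0 = 0.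
Proof. by rewrite dotvC dotv0l. Qed.

Lemma dotv_ge0 u : 0 <= dotv u u.
Proof. by apply: sumr_ge0 => i _; rewrite -expr2 sqr_ge0. Qed.

Lemma dotv_eq0 u : dotv u u = 0 -> u = 0.
Proof.
move=> /eqP; rewrite psumr_eq0; last by move=> i _; rewrite -expr2 sqr_ge0.
move=> /allP u0; apply/matrixP => i j; rewrite ord1 mxE.
have := u0 i (mem_index_enum _); rewrite /= mulf_eq0 orbb => /eqP//.
Qed.

Lemma enorm_ge0 u : 0 <= enorm u.
Proof. exact: sqrtr_ge0. Qed.

Lemma sqr_enorm u : enorm u ^+ 2 = dotv u u.
Proof. by rewrite sqr_sqrtr// dotv_ge0. Qed.

Lemma enorm0 : enorm (0 : 'cV[R]_n) = 0.
Proof. by rewrite /enorm dotv0l sqrtr0. Qed.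

Lemma enorm_eq0 u : enorm u = 0 -> u = 0.
Proof. by move=> u0; apply: dotv_eq0; rewrite -sqr_enorm u0 expr0n. Qed.

Lemma enorm_le_sqr u a : 0 <= a -> dotv u u <= a ^+ 2 -> enorm u <= a.
Proof. by move=> a0 ua; rewrite -(ler_pXn2r (n := 2))// ?nnegrE ?enorm_ge0// sqr_enorm. Qed.

Lemma enormZ a u : enorm (a *: u) = `|a| * enorm u.
Proof.
by rewrite /enorm dotvZl dotvZr mulrA -expr2 sqrtrM ?sqr_ge0// sqrtr_sqr.
Qed.

Lemma enormN u : enorm (- u) = enorm u.
Proof. by rewrite -scaleN1r enormZ normrN1 mul1r. Qed.

Lemma enormB_sym u v : enorm (u - v) = enorm (v - u).
Proof. by rewrite -enormN opprB. Qed.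

Lemma dotv_enorm_le u v : dotv u v <= enorm u * enorm v.
Proof.
have [v0|v0] := eqVneq v 0; first by rewrite v0 dotv0r enorm0 mulr0.
have nv : 0 < enorm v.
  by rewrite lt0r enorm_ge0 andbT; apply: contra v0 => /eqP/enorm_eq0 ->.
have [->|u0] := eqVneq u 0; first by rewrite dotv0l enorm0 mul0r.
have nu : 0 < enorm u.
  by rewrite lt0r enorm_ge0 andbT; apply: contra u0 => /eqP/enorm_eq0 ->.
(* The expanded square is 2|u||v| (|u||v| - <u, v>), and the positive norms can be divided out. *)
have := dotv_ge0 (enorm v *: u - enorm u *: v).
rewrite !(dotvDl, dotvDr, dotvNl, dotvNr, dotvZl, dotvZr) -!sqr_enorm (dotvC v u).
move=> h.
have : 0 <= (2 * enorm u * enorm v) * (enorm u * enorm v - dotv u v).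
  by apply: le_trans h _; rewrite le_eqVlt; apply/orP; left; apply/eqP; ring.
by rewrite pmulr_rge0 ?subr_ge0// !mulr_gt0.
Qed.

Lemma enormD u v : enorm (u + v) <= enorm u + enorm v.
Proof.
apply: enorm_le_sqr; first by rewrite addr_ge0 ?enorm_ge0.
rewrite !(dotvDl, dotvDr) -!sqr_enorm (dotvC v u).
have := dotv_enorm_le u v; set d := dotv u v; set a := enorm u; set b := enorm v.
by move=> h; rewrite sqrrD mulr2n; lra.
Qed.

Lemma enormB u v : enorm (u - v) <= enorm u + enorm v.
Proof. by rewrite -(enormN v) enormD. Qed.

Lemma enorm_triangle w u v : enorm (u - v) <= enorm (u - w) + enorm (w - v).
Proof. by rewrite -{1}(subrKA w) enormD. Qed.

Lemma entry_le_enorm u i j : `|u i j| <= enorm u.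
Proof.
rewrite ord1 -sqrtr_sqr ler_wsqrtr// /dotv (bigD1 i)//= -expr2 lerDl sumr_ge0//.
by move=> k _; rewrite -expr2 sqr_ge0.
Qed.

Lemma enorm_sum (I : Type) (r : seq I) (P : pred I) (F : I -> 'cV[R]_n) :
  enorm (\sum_(i <- r | P i) F i) <= \sum_(i <- r | P i) enorm (F i).
Proof.
elim/big_ind2 : _ => [|a b c d h1 h2|//]; first by rewrite enorm0.
by rewrite (le_trans (enormD _ _))// lerD.
Qed.

Lemma enorm_delta (i : 'I_n) : enorm (delta_mx i ord0) = 1 :> R.
Proof.
rewrite /enorm /dotv (bigD1 i)//= big1 ?mxE ?eqxx; last first.
  by move=> k ki; rewrite mxE (negPf ki)/= mul0r.
by rewrite addr0 mul1r sqrtr1.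
Qed.

Lemma dotv_delta u (i : 'I_n) : dotv u (delta_mx i ord0) = u i ord0.
Proof.
rewrite /dotv (bigD1 i)//= big1 ?mxE ?eqxx; last first.
  by move=> k ki; rewrite mxE (negPf ki)/= mulr0.
by rewrite addr0 mulr1.
Qed.

Lemma cV_sum_delta u : u = \sum_i u i ord0 *: delta_mx i ord0.
Proof. by rewrite {1}(matrix_sum_delta u); apply: eq_bigr => i _; rewrite big_ord1. Qed.

Lemma enorm_entry_le u e : 0 <= e -> (forall i, `|u i ord0| <= e) -> enorm u <= n%:R * e.
Proof.
move=> e0 ue; rewrite {1}(cV_sum_delta u) (le_trans (enorm_sum _ _ _))//.
under eq_bigr do rewrite enormZ enorm_delta mulr1.
by rewrite (le_trans (ler_sum _ (fun i _ => ue i)))// sumr_const card_ord mulr_natl.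
Qed.

Lemma dotv_inj u v : (forall w, dotv w u = dotv w v) -> u = v.
Proof.
move=> h; apply/eqP; rewrite -subr_eq0; apply/eqP/dotv_eq0.
by rewrite dotvDr dotvNr h subrr.
Qed.

End dot.

Lemma dotvE n (u v : 'cV[R]_n) : dotv u v = (u^T *m v) ord0 ord0.
Proof. by rewrite mxE; apply: eq_bigr => i _; rewrite mxE. Qed.

Lemma dotv_trmx n m (K : 'M[R]_(m, n)) u v : dotv (K *m u) v = dotv u (K^T *m v).
Proof. by rewrite !dotvE trmx_mul mulmxA. Qed.

Lemma dotv_col_mx n m (a c : 'cV[R]_n) (b d : 'cV[R]_m) :
  dotv (col_mx a b) (col_mx c d) = dotv a c + dotv b d.
Proof.
rewrite /dotv big_split_ord/=; congr (_ + _); apply: eq_bigr => i _;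
by rewrite ?col_mxEu ?col_mxEd.
Qed.

Lemma enorm_usub_le n m (z : 'cV[R]_(n + m)) : enorm (usubmx z) <= enorm z.
Proof.
apply: enorm_le_sqr (enorm_ge0 _) _; rewrite sqr_enorm -[X in _ <= dotv X X]vsubmxK.
by rewrite dotv_col_mx lerDl dotv_ge0.
Qed.

Lemma enorm_dsub_le n m (z : 'cV[R]_(n + m)) : enorm (dsubmx z) <= enorm z.
Proof.
apply: enorm_le_sqr (enorm_ge0 _) _; rewrite sqr_enorm -[X in _ <= dotv X X]vsubmxK.
by rewrite dotv_col_mx lerDr dotv_ge0.
Qed.

Lemma enorm_col_mx n m (a : 'cV[R]_n) (b : 'cV[R]_m) :
  enorm (col_mx a b) <= enorm a + enorm b.
Proof.
apply: enorm_le_sqr; first by rewrite addr_ge0 ?enorm_ge0.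
rewrite dotv_col_mx -!sqr_enorm sqrrD -mulr_natr.
have := enorm_ge0 a; have := enorm_ge0 b; nra.
Qed.

Lemma enorm_mulmx_entry_le k n (M : 'M[R]_(k, n)) (C : R) v :
  (forall i j, `|M i j| <= C) -> forall i, `|(M *m v) i ord0| <= n%:R * C * enorm v.
Proof.
move=> MC i; rewrite mxE (le_trans (ler_norm_sum _ _ _))//.
rewrite -mulrA mulr_natl -[X in _ *+ X]card_ord -sumr_const ler_sum// => j _.
by rewrite normrM ler_pM// entry_le_enorm.
Qed.

Lemma enorm_mulmx_le k n (M : 'M[R]_(k, n)) (C : R) v :
  0 <= C -> (forall i j, `|M i j| <= C) -> enorm (M *m v) <= (k%:R * (n%:R * C)) * enorm v.
Proof.
move=> C0 MC; rewrite -mulrA; apply: enorm_entry_le.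
  by rewrite !mulr_ge0// enorm_ge0.
exact: enorm_mulmx_entry_le.
Qed.

Lemma mulmx_delta_entry k n (M : 'M[R]_(k, n)) i j : (M *m (delta_mx j ord0 : 'cV_n)) i ord0 = M i j.
Proof. by rewrite -colE mxE. Qed.

End Euclid.

(** * Sequential compactness and differentials in the Euclidean norm *)

Section Topology.
Context {R : realType}.

Lemma mx_norm_leP m n (M : 'M[R]_(m, n)) (e : R) : 0 <= e ->
  `|M| <= e <-> forall i j, `|M i j| <= e.
Proof.
move=> e0; rewrite {1}/Num.Def.normr/= mx_normrE; split.
  by move=> /bigmax_leP[_ h] i j; exact: (h (i, j)).
by move=> h; apply/bigmax_leP; split => // -[i j] _; exact: h.
Qed.

Lemma norm_le_enorm n (u : 'cV[R]_n) : `|u| <= enorm u.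
Proof. by apply/mx_norm_leP; [exact: enorm_ge0|move=> i j; exact: entry_le_enorm]. Qed.

Lemma entry_le_norm m n (M : 'M[R]_(m, n)) i j : `|M i j| <= `|M|.
Proof. exact: (mx_norm_leP M (normr_ge0 M)).1. Qed.

(** The added 1 keeps the factor positive in dimension 0, so that one may divide by it. *)
Lemma enorm_le_norm n (u : 'cV[R]_n) : enorm u <= (n%:R + 1) * `|u|.
Proof.
rewrite (le_trans (enorm_entry_le (normr_ge0 u) _))//.
  by move=> i; exact: entry_le_norm.
by rewrite ler_wpM2r// lerDl.
Qed.

Lemma mx_cvgP m n (Ms : nat -> 'M[R]_(m, n)) (M : 'M[R]_(m, n)) :
  Ms @ \oo --> M <-> forall i j, (fun k => Ms k i j) @ \oo --> M i j.
Proof.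
split=> [/cvgrPdist_le h i j|h].
  apply/cvgrPdist_le => e e0; apply: filterS (h e e0) => k.
  by move=> /(mx_norm_leP _ (ltW e0))/(_ i j); rewrite !mxE.
apply/cvgrPdist_le => e e0.
have h' (ij : 'I_m * 'I_n) :
    \forall k \near \oo, `|M ij.1 ij.2 - Ms k ij.1 ij.2| <= e.
  by have /cvgrPdist_le/(_ _ e0) := h ij.1 ij.2.
apply: filterS (filter_forall _ h') => k hk.
by apply/(mx_norm_leP _ (ltW e0)) => i j; rewrite !mxE; exact: (hk (i, j)).
Qed.

Lemma cV_cvgP n (zs : nat -> 'cV[R]_n) (z : 'cV[R]_n) : zs @ \oo --> z <->
  forall e, 0 < e -> exists N, forall k, (N <= k)%N -> enorm (zs k - z) < e.
Proof.
split=> [/cvgrPdist_lt h e e0|h].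
  have n0 : 0 < n%:R + 1 :> R by rewrite ltr_wpDl.
  have [N _ hN] := h (e / (n%:R + 1)) (divr_gt0 e0 n0).
  exists N => k Nk; rewrite enormB_sym (le_lt_trans (enorm_le_norm _))//.
  by rewrite mulrC -ltr_pdivlMr//; exact: hN.
apply/cvgrPdist_lt => e e0; have [N hN] := h e e0; exists N => // k Nk.
by rewrite (le_lt_trans (norm_le_enorm _))// enormB_sym; exact: hN.
Qed.

(** A selection is any [s] above the identity: this is stable under composition and preserves
    limits. *)
Lemma cvg_subseq {T : topologicalType} (u : nat -> T) (s : nat -> nat) (l : T) :
  (forall k, (k <= s k)%N) -> u @ \oo --> l -> (u \o s) @ \oo --> l.
Proof.
move=> sk ul A /ul[N _ hN]; exists N => // k /= Nk; apply: hN => /=.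
exact: leq_trans (sk k).
Qed.

(** The scalar theorem is applied to one coordinate after another, each time along the selection
    found so far. A general finite index type covers vectors, matrices, weights and finite families
    of matrices. *)
Lemma bolzano_weierstrass_fin (I : finType) (u : nat -> I -> R) (C : R) :
  (forall k i, `|u k i| <= C) ->
  exists s : nat -> nat, (forall k, (k <= s k)%N) /\
    forall i, cvgn (fun k => u (s k) i).
Proof.
move=> uC.
suff [s [sk hs]] : exists s : nat -> nat, (forall k, (k <= s k)%N) /\
    forall i, i \in enum I -> cvgn (fun k => u (s k) i).
  by exists s; split => // i; apply: hs; rewrite mem_enum.
elim: (enum I) => [|i r [s [sk hs]]]; first by exists id.
have [|t tk ht] := @bolzano_weierstrass R (fun k => u (s k) i).
  exists C; split; first exact: num_real.
  by move=> x Cx y _ /=; rewrite (le_trans (uC _ _))// ltW.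
have tk' k : (k <= t k)%N.
  elim: k => // k ih; rewrite (leq_ltn_trans ih)// ltnNge.
  by have := tk k.+1 k; rewrite !leEnat ltnn => ->.
exists (s \o t); split; first by move=> k; exact: leq_trans (tk' k) (sk _).
move=> l; rewrite inE => /orP[/eqP->|lr]; first exact: ht.
have /cvg_ex[x hx] := hs _ lr.
by apply/cvg_ex; exists x; exact: (cvg_subseq tk' hx).
Qed.

Lemma bolzano_weierstrass_mx m n (Ms : nat -> 'M[R]_(m, n)) (C : R) :
  (forall k i j, `|Ms k i j| <= C) ->
  exists s : nat -> nat, (forall k, (k <= s k)%N) /\
    exists M : 'M[R]_(m, n), (Ms \o s) @ \oo --> M.
Proof.
move=> MC.
have [|s [sk hs]] := @bolzano_weierstrass_fin _ (fun k (ij : 'I_m * 'I_n) => Ms k ij.1 ij.2) C.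
  by move=> k ij; exact: MC.
exists s; split => //; exists (\matrix_(i, j) limn (fun k => Ms (s k) i j)).
by apply/mx_cvgP => i j; rewrite mxE; exact: (hs (i, j)).
Qed.

Lemma bolzano_weierstrass_cV n (zs : nat -> 'cV[R]_n) (C : R) :
  (forall k, enorm (zs k) <= C) ->
  exists s : nat -> nat, (forall k, (k <= s k)%N) /\
    exists z : 'cV[R]_n, (zs \o s) @ \oo --> z.
Proof.
move=> zC; apply: (@bolzano_weierstrass_mx _ _ _ C) => k i j.
exact: le_trans (entry_le_enorm _ _ _) (zC k).
Qed.

Lemma cvg_sumr (V : normedModType R) (I : Type) (r : seq I) (f : I -> nat -> V) (l : I -> V) :
  (forall i, f i @ \oo --> l i) ->
  (fun k => \sum_(i <- r) f i k) @ \oo --> \sum_(i <- r) l i.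
Proof.
move=> fl; elim: r => [|i r ih].
  by rewrite big_nil; under eq_fun do rewrite big_nil; exact: cvg_cst.
by rewrite big_cons; under eq_fun do rewrite big_cons; exact: cvgD.
Qed.

Lemma cvg_mulmx m n p (As : nat -> 'M[R]_(m, n)) (Bs : nat -> 'M[R]_(n, p))
  (A : 'M[R]_(m, n)) (B : 'M[R]_(n, p)) :
  As @ \oo --> A -> Bs @ \oo --> B -> (fun k => As k *m Bs k) @ \oo --> A *m B.
Proof.
move=> /mx_cvgP hA /mx_cvgP hB; apply/mx_cvgP => i j.
rewrite mxE; under eq_fun do rewrite mxE.
by apply: (@cvg_sumr R) => l; exact: cvgM.
Qed.

Lemma cvg_enorm_le n (zs : nat -> 'cV[R]_n) (z : 'cV[R]_n) (C : R) : zs @ \oo --> z ->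
  (forall k, enorm (zs k) <= C) -> enorm z <= C.
Proof.
move=> /cV_cvgP h zC; apply/ler_addgt0Pr => e e0; have [N hN] := h e e0.
rewrite -[z](subKr (zs N)) (le_trans (enormB _ _))// lerD//.
exact: ltW (hN _ _).
Qed.

Lemma inv_succ_lt (e : R) : 0 < e -> exists N, forall k, (N <= k)%N -> k.+1%:R^-1 < e.
Proof.
move=> e0; have [N _ hN] := near_infty_natSinv_lt (PosNum e0).
by exists N => k; exact: hN.
Qed.

(** Meant for sequences obtained by choice, whose k-th point is found within 1/(k+1) of a prescribed
    one. *)
Lemma cV_cvg_inv_succ n (xs zs : nat -> 'cV[R]_n) (z : 'cV[R]_n) : zs @ \oo --> z ->
  (forall k, enorm (xs k - zs k) < k.+1%:R^-1) -> xs @ \oo --> z.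
Proof.
move=> /cV_cvgP hz hx; apply/cV_cvgP => e e0.
have e20 : 0 < e / 2 by rewrite divr_gt0.
have [N hN] := hz _ e20; have [N' hN'] := inv_succ_lt e20.
exists (maxn N N') => k; rewrite geq_max => /andP[Nk N'k].
rewrite (le_lt_trans (enorm_triangle (zs k) _ _))// (splitr e) ltrD ?hN//.
exact: lt_trans (hx k) (hN' _ _).
Qed.

Lemma open_enorm_ball n (D : set 'cV[R]_n) z : open D -> D z ->
  exists2 r : R, 0 < r & forall x, enorm (x - z) < r -> D x.
Proof.
move=> oD Dz; have /nbhs_ballP[r /= r0 hr] : nbhs z D by exact: open_nbhs_nbhs.
exists r => // x xz; apply: hr; rewrite mx_norm_ball /ball_/=.
by rewrite (le_lt_trans (norm_le_enorm _))// enormB_sym.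
Qed.

Lemma enorm_ball_open n (D : set 'cV[R]_n) :
  (forall z, D z -> exists2 r : R, 0 < r & forall x, enorm (x - z) < r -> D x) ->
  open D.
Proof.
move=> h; rewrite openE => z /h[r r0 hr].
have n1 : 0 < n%:R + 1 :> R by rewrite ltr_wpDl.
apply/nbhs_ballP; exists (r / (n%:R + 1)); first exact: divr_gt0.
move=> x; rewrite mx_norm_ball /ball_/= => zx; apply: hr; rewrite enormB_sym.
by rewrite (le_lt_trans (enorm_le_norm _))// mulrC -ltr_pdivlMr.
Qed.

Section diff.
Context {V W : normedModType R}.

Lemma differentiable_eps (f : V -> W) x : differentiable f x ->
  forall e, 0 < e -> exists2 r, 0 < r & forall h, `|h| < r ->
    `|f (x + h) - f x - 'd f x h| <= e * `|h|.
Proof.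
move=> /diff_locallyP[_ /eqaddoP h] e e0.
have /nbhs_norm0P[r /= r0 hr] := h e e0; exists r => // k kr.
by have := hr k kr; rewrite /= !fctE/= (addrC k) opprD addrA.
Qed.

Lemma eps_differentiable (f : V -> W) x (A : {linear V -> W}) :
  continuous A ->
  (forall e, 0 < e -> exists2 r, 0 < r & forall h, `|h| < r ->
    `|f (x + h) - f x - A h| <= e * `|h|) ->
  differentiable f x /\ 'd f x = A :> (V -> W).
Proof.
move=> cA h.
have fA : f \o shift x = cst (f x) + A +o_ 0 id.
  apply/eqaddoP => e e0; have [r r0 hr] := h e e0; apply/nbhs_norm0P; exists r => // k /= kr.
  by have := hr k kr; rewrite !fctE/= (addrC k) opprD addrA.
have dA := diff_unique cA fA; split => //.
by apply/diff_locallyP; rewrite dA.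
Qed.

End diff.

Lemma linear_eps_continuous n (W : normedModType R) (A : {linear 'cV[R]_n -> W}) (C : R) :
  (forall h, `|A h| <= C * `|h|) -> continuous A.
Proof.
move=> AC; apply/linear_bounded_continuous/linear_boundedP.
near=> r => x; rewrite (le_trans (AC x))// ler_wpM2r//.
Unshelve. all: by end_near. Qed.

Lemma mulmx_continuous n k (M : 'M[R]_(k, n)) : continuous (mulmx M : 'cV[R]_n -> 'cV[R]_k).
Proof.
have [C C0 MC] : exists2 C, 0 <= C & forall i j, `|M i j| <= C.
  by exists `|M| => // i j; exact: entry_le_norm.
apply: (@linear_eps_continuous _ _ (mulmx M) ((k%:R * (n%:R * C)) * (n%:R + 1))) => h.
rewrite (le_trans (norm_le_enorm _))// (le_trans (enorm_mulmx_le _ C0 MC))//.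
by rewrite -[leRHS]mulrA ler_wpM2l ?enorm_le_norm// !mulr_ge0.
Qed.

Let dotv_linear n (u : 'cV[R]_n) : linear_for *%R (dotv u).
Proof. by move=> a x y; rewrite dotvDr dotvZr. Qed.
HB.instance Definition _ n (u : 'cV[R]_n) :=
  GRing.isLinear.Build R 'cV[R]_n R *%R (dotv u) (dotv_linear u).

Lemma dotv_continuous n (u : 'cV[R]_n) : continuous (dotv u : 'cV[R]_n -> R).
Proof.
have hu w : dotv u w <= enorm u * (n%:R + 1) * `|w|.
  rewrite (le_trans (dotv_enorm_le _ _))// -mulrA.
  by rewrite ler_wpM2l ?enorm_ge0 ?enorm_le_norm.
apply: (@linear_eps_continuous _ _ (dotv u) (enorm u * (n%:R + 1))) => h.
by rewrite ler_norml hu andbT lerNl -dotvNr -(normrN h) hu.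
Qed.

(** Carries first-order estimates from the max norm to the Euclidean one; [N] is the Euclidean norm
    for vector-valued maps and the absolute value for scalar ones. *)
Lemma eps_norm_enorm n (W : normedModType R) (g : 'cV[R]_n -> W) (N : W -> R) (C : R) :
  0 <= C -> (forall w, N w <= C * `|w|) ->
  (forall e, 0 < e -> exists2 r, 0 < r & forall h, `|h| < r -> `|g h| <= e * `|h|) ->
  forall e, 0 < e -> exists2 r, 0 < r & forall h, enorm h < r -> N (g h) <= e * enorm h.
Proof.
move=> C0 NC hg e e0; have C1 : 0 < C + 1 by rewrite ltr_wpDl.
have [r r0 hr] := hg (e / (C + 1)) (divr_gt0 e0 C1); exists r => // h hlt.
have hl := norm_le_enorm h.
rewrite (le_trans (NC _))// (@le_trans _ _ ((C + 1) * `|g h|))//.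
  by rewrite ler_wpM2r// lerDl.
rewrite mulrC -ler_pdivlMr// (le_trans (hr h _))//; first exact: le_lt_trans hlt.
by rewrite mulrAC ler_wpM2r ?invr_ge0 ?(ltW C1)// ler_wpM2l// ltW.
Qed.

Lemma eps_enorm_norm n (W : normedModType R) (g : 'cV[R]_n -> W) (N : W -> R) :
  (forall w, `|w| <= N w) ->
  (forall e, 0 < e -> exists2 r, 0 < r & forall h, enorm h < r -> N (g h) <= e * enorm h) ->
  forall e, 0 < e -> exists2 r, 0 < r & forall h, `|h| < r -> `|g h| <= e * `|h|.
Proof.
move=> NC hg e e0; have n1 : 0 < n%:R + 1 :> R by rewrite ltr_wpDl.
have [r r0 hr] := hg (e / (n%:R + 1)) (divr_gt0 e0 n1).
exists (r / (n%:R + 1)); first exact: divr_gt0.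
move=> h; rewrite ltr_pdivlMr// mulrC => hlt.
have hl := enorm_le_norm h.
rewrite (le_trans (NC _))// (le_trans (hr _ (le_lt_trans hl hlt)))//.
by rewrite -mulrA ler_wpM2l ?(ltW e0)// ler_pdivrMl.
Qed.

Lemma jacE n k (F : 'cV[R]_n -> 'cV[R]_k) z v : 'd F z v = jac F z *m v.
Proof.
rewrite {1}(cV_sum_delta v) linear_sum/=; apply/matrixP => i j.
rewrite (ord1 j) summxE mxE; apply: eq_bigr => l _.
by rewrite linearZ/= !mxE mulrC.
Qed.

Lemma gradE n (f : 'cV[R]_n -> R) z v : 'd f z v = dotv (grad f z) v.
Proof.
rewrite {1}(cV_sum_delta v) linear_sum/=; apply: eq_bigr => l _.
by rewrite linearZ/= !mxE mulrC.
Qed.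

Lemma differentiable_jac_eps n k (F : 'cV[R]_n -> 'cV[R]_k) z :
  differentiable F z ->
  forall e, 0 < e -> exists2 r, 0 < r & forall h, enorm h < r ->
    enorm (F (z + h) - F z - jac F z *m h) <= e * enorm h.
Proof.
move=> /differentiable_eps dF.
apply: (@eps_norm_enorm _ _ (fun h => F (z + h) - F z - jac F z *m h) (@enorm R k) (k%:R + 1)).
- by rewrite addr_ge0.
- exact: enorm_le_norm.
- move=> e e0; have [r r0 hr] := dF e e0; exists r => // h hlt.
  by rewrite -jacE; exact: hr.
Qed.

Lemma jac_eps_differentiable n k (F : 'cV[R]_n -> 'cV[R]_k) z (M : 'M[R]_(k, n)) :
  (forall e, 0 < e -> exists2 r, 0 < r & forall h, enorm h < r ->
    enorm (F (z + h) - F z - M *m h) <= e * enorm h) ->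
  differentiable F z /\ jac F z = M.
Proof.
move=> /(@eps_enorm_norm _ _ _ (@enorm R k) (@norm_le_enorm k)) h.
have [dF dE] := eps_differentiable (@mulmx_continuous _ _ M) h; split => //.
by apply/matrixP => i j; rewrite mxE dE mulmx_delta_entry.
Qed.

Lemma differentiable_grad_eps n (f : 'cV[R]_n -> R) z :
  differentiable f z ->
  forall e, 0 < e -> exists2 r, 0 < r & forall h, enorm h < r ->
    `|f (z + h) - f z - dotv (grad f z) h| <= e * enorm h.
Proof.
move=> /differentiable_eps df.
apply: (@eps_norm_enorm _ _ (fun h => f (z + h) - f z - dotv (grad f z) h) (@Num.norm _ R) 1).
- by [].
- by move=> w; rewrite mul1r.
- move=> e e0; have [r r0 hr] := df e e0; exists r => // h hlt.
  by rewrite -gradE; exact: hr.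
Qed.

Lemma grad_eps_differentiable n (f : 'cV[R]_n -> R) z x :
  (forall e, 0 < e -> exists2 r, 0 < r & forall h, enorm h < r ->
    `|f (z + h) - f z - dotv x h| <= e * enorm h) ->
  differentiable f z /\ grad f z = x.
Proof.
move=> /(@eps_enorm_norm _ _ _ (@Num.norm _ R) (fun=> lexx _)) h.
have [dF dE] := @eps_differentiable _ _ f z (dotv x) (@dotv_continuous _ x) h.
split => //.
by apply/matrixP => i j; rewrite mxE dE (ord1 j) [LHS]dotv_delta.
Qed.

End Topology.

(** * A mean value inequality from an almost everywhere derivative bound *)

Section AeMeanValue.
Context {R : realType}.

Lemma derivable_eps (V : normedModType R) (f : R -> V) t : derivable f t 1 ->
  forall e, 0 < e -> exists2 r, 0 < r & forall k, `|k| < r ->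
    `|f (t + k) - f t - k *: 'D_1 f t| <= e * `|k|.
Proof.
move=> /cvgrPdist_le df e e0.
have [r /= r0 hr] := df e e0; exists r => // k kr.
have [->|k0] := eqVneq k 0.
  by rewrite addr0 subrr scale0r subrr !normr0 mulr0.
have := hr k; rewrite /ball_/= sub0r normrN => /(_ kr k0).
have -> : f (t + k) - f t - k *: 'D_1 f t =
    - (k *: ('D_1 f t - k^-1 *: (f (k *: (1 : R) + t) - f t))).
  rewrite (scalerBr k ('D_1 f t)) opprB scalerA mulfV// scale1r.
  by rewrite [k *: (1 : R)]mulr1 (addrC k).
by move=> hk; rewrite normrN normrZ mulrC ler_wpM2r.
Qed.

Lemma sup_adherent_mem (S : set R) : S !=set0 -> has_ubound S ->
  forall e, 0 < e -> exists2 t, S t & sup S - e < t <= sup S.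
Proof.
move=> S0 Sub e e0; have [t St tS] := sup_adherent e0 (conj S0 Sub).
by exists t => //; rewrite tS/=; exact: ub_le_sup.
Qed.

(* The exceptional null set is enclosed in an open set O of small measure, and
   h t - h 0 <= (c + e) t + M |O `&` [0, t]| propagates from left to right. *)
Lemma ae_derive_le (h : R -> R) (L c : R) :
  (forall s t, 0 <= s <= 1 -> 0 <= t <= 1 -> `|h s - h t| <= L * `|s - t|) ->
  {ae (@lebesgue_measure R), forall t : R, 0 < t < 1 ->
     derivable h t 1 /\ 'D_1 h t <= c} ->
  h 1 - h 0 <= c.
Proof.
move=> hL [N [mN N0 hN]].
have L0 : 0 <= L.
  have := hL 0 1; rewrite !lexx ler01 sub0r normrN1 mulr1 => /(_ isT isT).
  exact: le_trans.
apply/ler_addgt0Pr => e e0; pose e2 := e / 2.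
have e20 : 0 < e2 by rewrite divr_gt0.
(* [M] exceeds [L - c'], the excess slope to be paid for on the exceptional open set. *)
pose M := L + `|c| + 1.
have M0 : 0 < M by rewrite ltr_wpDl// addr_ge0.
(* The derivative is known on the open interval only, so the endpoint 0 is made exceptional as
   well. *)
pose N' := N `|` [set 0].
have mN' : measurable N' by apply: measurableU.
pose mu := @lebesgue_measure R.
have N'0 : (mu N' = 0)%E.
  apply/eqP; rewrite eq_le measure_ge0 andbT.
  rewrite (le_trans (measureU2 _ _ _))//= [X in (X + _)%E]N0 add0e.
  by rewrite /mu lebesgue_measure_set1.
have [G [oG NO Od]] : exists G : set R, [/\ open G, N' `<=` G & (mu (G `\` N') < (e2 / M)%:E)%E].
  apply: lebesgue_regularity_outer => //; last exact: divr_gt0.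
  by rewrite [X in (X < _)%E]N'0 ltry.
have mO : measurable G by exact: measurable_realfun.open_measurable.
have muO : (mu G <= (e2 / M)%:E)%E.
  rewrite -(setDUK NO) (le_trans (measureU2 _ _ _))//; first exact: measurableD.
  by rewrite [X in (X + _)%E]N'0 add0e ltW.
have le_mu B C : measurable B -> measurable C -> B `<=` C -> (mu B <= mu C)%E.
  by move=> mB mC BC; apply: le_measure => //; exact/mem_set.
pose A t := G `&` `[0, t].
have mA t : measurable (A t) by apply: measurableI.
have AO t : (mu (A t) <= mu G)%E.
  by apply: (le_mu _ _ (mA t) mO); exact: subIsetl.
have Afin t : mu (A t) \is a fin_num.
  by rewrite ge0_fin_numE// (le_lt_trans (AO t))// (le_lt_trans muO)// ltry.
pose m t := fine (mu (A t)).
have mE t : mu (A t) = (m t)%:E by rewrite fineK.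
have m_ge0 t : 0 <= m t by rewrite fine_ge0.
have m_le t : m t <= e2 / M by rewrite -lee_fin -mE (le_trans (AO t)).
have m_homo s t : s <= t -> m s <= m t.
  move=> st; rewrite -lee_fin -!mE; apply: (le_mu _ _ (mA s) (mA t)) => x [Gx].
  by rewrite /= !in_itv/= => /andP[x0 xs]; split => //=; rewrite in_itv/= x0 (le_trans xs).
have m_step s t : 0 <= s -> s <= t -> `[s, t] `<=` G -> m s + (t - s) <= m t.
  move=> s0 st stO; rewrite -lee_fin EFinD -!mE.
  have -> : (t - s)%:E = mu `]s, t]%classic.
    by rewrite /mu lebesgue_measure_itv/= lte_fin; case: ltgtP st => // -> _; rewrite subrr.
  rewrite -measureU//=.
  - apply: (le_mu _ _ _ (mA t)); first by apply: measurableU; [exact: mA|exact: measurable_itv].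
    move=> x [[Gx]|] /=; rewrite !in_itv/= => /andP[h1 h2].
      by split => //=; rewrite in_itv/= h1 (le_trans h2).
    by split; [apply: stO|]; rewrite /= in_itv/= h2 ?(ltW h1)// (le_trans s0)// ltW.
  - exact: mA.
  - rewrite -subset0 => x [[_]] /=; rewrite !in_itv/=.
    by move=> /andP[_ xs] /andP[sx _]; move: (lt_le_trans sx xs); rewrite ltxx.
pose c' := c + e2.
(* Times up to which the estimate holds. The Lipschitz bound puts the supremum [s] in [S], and a
   supremum below 1 could be passed. *)
pose S := [set t | 0 <= t <= 1 /\ h t - h 0 <= c' * t + M * m t].
have S0 : S 0 by split; [rewrite lexx ler01|rewrite subrr mulr0 add0r mulr_ge0// ltW].
have Sub : has_ubound S by exists 1 => t [/andP[]].
have Sadh := sup_adherent_mem (ex_intro _ 0 S0) Sub.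
set s := sup S in Sadh.
have s0 : 0 <= s by exact: ub_le_sup.
have s1 : s <= 1 by apply: ge_sup => [|t [/andP[]]//]; exists 0.
have Ss : S s.
  split; first by rewrite s0 s1.
  apply/ler_addgt0Pr => eta eta0.
  pose k := eta / (L + `|c'| + 1).
  have k1 : 0 < L + `|c'| + 1 by rewrite ltr_wpDl// addr_ge0.
  have [t [/andP[t0 t1] ht] /andP[st ts]] := Sadh k (divr_gt0 eta0 k1).
  have hst : h s - h t <= L * (s - t).
    rewrite (le_trans (ler_norm _))// (le_trans (hL _ _ _ _)) ?s0 ?s1 ?t0 ?t1//.
    by rewrite ger0_norm// subr_ge0.
  have kE : k * (L + `|c'| + 1) = eta by rewrite divfK// gt_eqF.
  have c'k : c' * (t - s) <= `|c'| * (s - t).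
    by rewrite -normrN -{1}(opprB s t) mulrN -mulNr ler_wpM2r ?subr_ge0// ler_norm.
  have : (L + `|c'| + 1) * (s - t) <= eta.
    by rewrite -kE mulrC ler_wpM2r ?ltW// ltrBlDr addrC -ltrBlDr.
  have := ler_wpM2l (ltW M0) (m_homo _ _ ts).
  move: (M * m t) (M * m s) ht hst c'k => x y.
  have : 0 <= s - t by rewrite subr_ge0.
  set a := L * (s - t); set b := `|c'| * (s - t).
  rewrite mulrBr !mulrDl mul1r -/a -/b; lra.
have [s_lt1|] := ltP s 1; last first.
  move=> s_ge1; have s1E : s = 1 by apply/eqP; rewrite eq_le s1.
  move: Ss => [_]; rewrite s1E mulr1 => h1; rewrite (le_trans h1)//.
  have : M * m 1 <= e2 by rewrite mulrC -ler_pdivlMr.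
  by move=> hM; rewrite /c' [X in _ <= _ + X](splitr e) -/e2 addrA lerD2l.
exfalso.
suff [t [st t1 St]] : exists t, [/\ s < t, t <= 1 & h t - h s <= c' * (t - s) + M * (m t - m s)].
  have : S t.
    split; first by rewrite (le_trans s0 (ltW st)).
    move: Ss => [_]; move: St; rewrite !mulrBr; lra.
  by move=> /(ub_le_sup Sub); rewrite leNgt st.
(* At an exceptional point an interval to the right stays in [G], where the measure term absorbs the
   slope [L]; elsewhere the derivative gives slope at most [c + e2] just to the right. *)
have [Ns|Ns] := pselect (N' s).
  have /nbhs_ballP[r /= r0 hr] : nbhs s G by apply: open_nbhs_nbhs; split => //; exact: NO.
  pose t := Num.min 1 (s + r / 2).
  have st : s < t by rewrite lt_min s_lt1 ltrDl divr_gt0.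
  have t1 : t <= 1 by rewrite ge_min lexx.
  exists t; split => //.
  have stG : `[s, t]%classic `<=` G.
    move=> x /=; rewrite in_itv/= => /andP[sx xt]; apply: hr.
    rewrite /ball/= ltr_norml; apply/andP; split; last by rewrite (@le_lt_trans _ _ 0)// subr_le0.
    have : x <= s + r / 2 by rewrite (le_trans xt)// ge_min lexx orbT.
    by move=> xr; rewrite ltrNl opprB ltrBlDl (le_lt_trans xr)// ltrD2l ltr_pdivrMr// ltr_pMr// ltr1n.
  have hm := m_step s t s0 (ltW st) stG.
  have hst : h t - h s <= L * (t - s).
    rewrite (le_trans (ler_norm _))// (le_trans (hL _ _ _ _)) ?s0 ?s1 ?t1 ?(le_trans s0 (ltW st))//.
    by rewrite ger0_norm// subr_ge0 ltW.
  rewrite (le_trans hst)//.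
  have h1 : M * (t - s) <= M * (m t - m s) by rewrite ler_wpM2l ?(ltW M0)// lerBrDl.
  have h2 : (L - c') * (t - s) <= M * (t - s).
    rewrite ler_wpM2r ?subr_ge0 ?(ltW st)// /M /c'.
    have := ler_norm (- c); rewrite normrN; lra.
  move: h1 h2; rewrite mulrBl; lra.
have s_gt0 : 0 < s.
  rewrite lt_neqAle s0 andbT; apply/eqP => s0'; apply: Ns; right; exact: esym.
have [ds dc] : derivable h s 1 /\ 'D_1 h s <= c.
  have := contra_not (@hN s) (fun x => Ns (or_introl x)).
  by move=> /contrapT; apply; rewrite s_gt0.
have [r r0 hr] := derivable_eps ds e20.
pose t := Num.min 1 (s + r / 2).
have st : s < t by rewrite lt_min s_lt1 ltrDl divr_gt0.
exists t; split => //; first by rewrite ge_min lexx.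
have tr : t <= s + r / 2 by rewrite ge_min lexx orbT.
have ts0 : 0 <= t - s by rewrite subr_ge0 ltW.
have tsr : `|t - s| < r.
  by rewrite ger0_norm// ltrBlDl (le_lt_trans tr)// ltrD2l ltr_pdivrMr// ltr_pMr// ltr1n.
have := hr _ tsr; rewrite (addrC s) subrK (ger0_norm ts0).
rewrite ler_norml => /andP[_]; rewrite /c' mulrDl [_ *: _]mulrC => h1.
have h2 : 'D_1 h s * (t - s) <= c * (t - s) by rewrite ler_wpM2r.
have h3 : 0 <= M * (m t - m s) by rewrite mulr_ge0 ?(ltW M0)// subr_ge0 m_homo// ltW.
lra.
Qed.

Lemma ae_exists (P : R -> Prop) (s : R) : 0 < s ->
  {ae (@lebesgue_measure R), forall t, P t} -> exists t, 0 < t < s /\ P t.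
Proof.
move=> s0 [N [mN N0 hN]]; apply: contrapT => nP.
have : (@lebesgue_measure R `]0%R, s[ <= @lebesgue_measure R N)%E.
  apply: le_measure => [||t /=]; [exact/mem_set|exact/mem_set|rewrite in_itv/= => ts].
  by apply: hN => /= Pt; apply: nP; exists t.
by rewrite N0 lebesgue_measure_itv/= lte_fin s0 sube0 lee_fin leNgt s0.
Qed.

Lemma ae_lebesgueS (P Q : R -> Prop) : (forall t, P t -> Q t) ->
  {ae (@lebesgue_measure R), forall t, P t} -> {ae (@lebesgue_measure R), forall t, Q t}.
Proof. exact: (@filterS _ _ (ae_filter_ringOfSetsType (@lebesgue_measure R))). Qed.

Lemma ae_lebesgueI (P Q : R -> Prop) :
  {ae (@lebesgue_measure R), forall t, P t} -> {ae (@lebesgue_measure R), forall t, Q t} ->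
  {ae (@lebesgue_measure R), forall t, P t /\ Q t}.
Proof. exact: (@filterI _ _ (ae_filter_ringOfSetsType (@lebesgue_measure R))). Qed.

End AeMeanValue.

(** * Absolutely continuous curves and locally Lipschitz maps *)

Section Curves.
Context {R : realType}.

Lemma lipschitz_abs_cont N (c : R -> 'cV[R]_N) (L : R) :
  (forall s t, 0 <= s <= 1 -> 0 <= t <= 1 -> enorm (c s - c t) <= L * `|s - t|) ->
  abs_cont01 c.
Proof.
move=> cL e e0.
have L0 : 0 <= L.
  have := cL 0 1; rewrite !lexx ler01 sub0r normrN1 mulr1 => /(_ isT isT).
  exact/le_trans/enorm_ge0.
have L1 : 0 < L + 1 by rewrite ltr_wpDl.
exists (e / (L + 1)); first exact: divr_gt0.
move=> q a b ab _ h.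
apply: (@le_lt_trans _ _ ((L + 1) * \sum_(i < q) (b i - a i))); last first.
  by rewrite mulrC -ltr_pdivlMr.
rewrite mulr_sumr ler_sum// => i _; have [/andP[a0 aib] b1] := ab i.
rewrite (le_trans (cL _ _ _ _)) ?a0 ?b1 ?(le_trans a0 aib) ?(le_trans aib b1)//.
by rewrite ger0_norm ?subr_ge0// ler_wpM2r ?subr_ge0// lerDl.
Qed.

Lemma abs_cont_uniform N (c : R -> 'cV[R]_N) e : abs_cont01 c -> 0 < e ->
  exists2 d, 0 < d & forall s t, 0 <= s <= 1 -> 0 <= t <= 1 -> `|s - t| < d ->
    enorm (c s - c t) < e.
Proof.
move=> hc e0; have [d d0 hd] := hc e e0; exists d => // s t.
wlog st : s t / s <= t => [hw|] s01 t01.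
  have [|/ltW] := leP s t; first by move=> /hw; apply.
  by move=> /hw; rewrite enormB_sym distrC; apply.
have /andP[s0 s1] := s01; have /andP[t0 t1] := t01.
rewrite distrC ger0_norm ?subr_ge0// => std.
have := hd 1%N (fun=> s) (fun=> t); rewrite !big_ord1 enormB_sym; apply => //.
  by move=> i; rewrite s0 st t1.
by move=> i j; rewrite !ord1 eqxx.
Qed.

(** Compactness of the curve by contradiction: pairs within 1/(n+1) of the curve that violate the
    constant n accumulate at some [c t], where a local Lipschitz constant applies. *)
Lemma uniform_lipschitz_on_curve N k (D : set 'cV[R]_N) (F : 'cV[R]_N -> 'cV[R]_k)
    (c : R -> 'cV[R]_N) :
  loc_lipschitz_on D F -> abs_cont01 c -> (forall t, 0 <= t <= 1 -> D (c t)) ->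
  exists r L : R, [/\ 0 < r, 0 <= L & forall t, 0 <= t <= 1 -> forall x y,
    enorm (x - c t) < r -> enorm (y - c t) < r -> enorm (F x - F y) <= L * enorm (x - y)].
Proof.
move=> FD hc cD; apply: contrapT => hn.
have {}hn : forall n : nat, exists txy : R * 'cV[R]_N * 'cV[R]_N,
    [/\ 0 <= txy.1.1 <= 1, enorm (txy.1.2 - c txy.1.1) < n.+1%:R^-1,
     enorm (txy.2 - c txy.1.1) < n.+1%:R^-1 &
     ~ (enorm (F txy.1.2 - F txy.2) <= n%:R * enorm (txy.1.2 - txy.2))].
  move=> n; apply: contrapT => hn'; apply: hn; exists n.+1%:R^-1, n%:R; split => //.
  move=> t t01 x y xt yt; apply: contrapT => Fxy; apply: hn'.
  by exists (t, x, y).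
have [f hf] := choice hn.
have [|s [sk hs]] := @bolzano_weierstrass_fin _ unit (fun n _ => (f n).1.1) 1.
  by move=> n _; have [/andP[? ?] _ _ _] := hf n; rewrite ger0_norm.
have /cvg_ex[/= t ht] := hs tt.
have t01 : 0 <= t <= 1.
  apply/andP; split; first apply: (cvgr_to_ge ht).
    by apply: nearW => n; have [/andP[]] := hf (s n).
  by apply: (cvgr_to_le ht); apply: nearW => n; have [/andP[]] := hf (s n).
have [r r0 [L hL]] := FD _ (cD t t01).
have r20 : 0 < r / 2 by rewrite divr_gt0.
have [d d0 hd] := abs_cont_uniform hc r20.
have [N1 hN1] := inv_succ_lt r20.
have /cvgrPdist_lt/(_ _ d0)[N2 _ hN2] := ht.
have [N3 hN3] : exists n : nat, L <= n%:R.
  by exists (Num.bound `|L|); rewrite ltW// (le_lt_trans (ler_norm _))// archi_boundP.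
pose n := maxn N1 (maxn N2 N3).
have [t1 hx hy] := hf (s n); apply.
have nN : (n <= s n)%N by exact: sk.
have ct : enorm (c (f (s n)).1.1 - c t) < r / 2.
  by apply: hd => //; rewrite distrC; apply: hN2; rewrite /= /n leq_max leq_maxl orbT.
have nr : (s n).+1%:R^-1 < r / 2.
  by apply: hN1; rewrite (leq_trans _ nN)// /n leq_maxl.
rewrite (le_trans (hL _ _ _ _))//.
- rewrite (le_lt_trans (enorm_triangle (c (f (s n)).1.1) _ _))// (splitr r) ltrD//.
  exact: lt_trans nr.
- rewrite (le_lt_trans (enorm_triangle (c (f (s n)).1.1) _ _))// (splitr r) ltrD//.
  exact: lt_trans nr.
- rewrite ler_wpM2r ?enorm_ge0// (le_trans hN3)// ler_nat (leq_trans _ nN)//.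
  by rewrite /n !leq_max leqnn !orbT.
Qed.

(** When the total length is below [d], so is each interval, and its endpoints are mapped within the
    radius of the uniform Lipschitz bound. *)
Lemma abs_cont_comp N k (D : set 'cV[R]_N) (F : 'cV[R]_N -> 'cV[R]_k) (c : R -> 'cV[R]_N) :
  loc_lipschitz_on D F -> abs_cont01 c -> (forall t, 0 <= t <= 1 -> D (c t)) ->
  abs_cont01 (F \o c).
Proof.
move=> FD hc cD; have [r [L [r0 L0 hL]]] := uniform_lipschitz_on_curve FD hc cD.
have [d d0 hd] := abs_cont_uniform hc r0.
move=> e e0; have L1 : 0 < L + 1 by rewrite ltr_wpDl.
have [d' d'0 hd'] := hc _ (divr_gt0 e0 L1).
exists (Num.min d d'); first by rewrite lt_min d0.
move=> q a b ab dis; rewrite lt_min => /andP[sd /(hd' _ _ _ ab dis) s1].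
apply: (@le_lt_trans _ _ ((L + 1) * (\sum_(i < q) enorm (c (b i) - c (a i))))); last first.
  by rewrite mulrC -ltr_pdivlMr.
rewrite mulr_sumr ler_sum// => i _; have [/andP[a0 aib] b1] := ab i.
have a01 : 0 <= a i <= 1 by rewrite a0 (le_trans aib b1).
have b01 : 0 <= b i <= 1 by rewrite b1 (le_trans a0 aib).
rewrite /= (le_trans (hL (a i) a01 _ _ _ _))//.
- apply: hd => //; rewrite ger0_norm ?subr_ge0// (le_lt_trans _ sd)//.
  rewrite (bigD1 i)//= lerDl sumr_ge0// => j _; rewrite subr_ge0.
  by have [/andP[]] := ab j.
- by rewrite subrr enorm0.
- by rewrite ler_wpM2r ?enorm_ge0// lerDl.
Qed.

End Curves.

(** * Conservative fields: mean value, semicontinuity, transfer to the Clarke Jacobian *)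

Section Conservative.
Context {R : realType}.

Lemma derivable_line N (x v : 'cV[R]_N) (t : R) :
  derivable (fun t : R => x + t *: v) t 1 /\ 'D_1 (fun t : R => x + t *: v) t = v.
Proof.
have h : \forall k \near 0^', k^-1 *: ((fun t : R => x + t *: v) (k *: (1 : R) + t) - (x + t *: v)) = v.
  near=> k; have k0 : k != 0 by near: k; exact: nbhs_dnbhs_neq.
  rewrite [k *: (1 : R)]mulr1 opprD addrACA subrr add0r -scalerBl addrK.
  by rewrite scalerA mulVf// scale1r.
by split; [exact: (is_cvg_near_cst v)|exact: lim_near_cst].
Unshelve. all: by end_near. Qed.

Lemma derive_entry k (G : R -> 'cV[R]_k) t i : derivable G t 1 ->
  derivable (fun t => G t i ord0) t 1 /\
  'D_1 (fun t => G t i ord0) t = ('D_1 G t) i ord0.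
Proof.
move=> dG; split; first exact: ((derivable_mxP _ _ _).1 dG).
by rewrite derive_mx// mxE.
Qed.

(** For almost every t the derivative of [F] along the segment is [M *m v] for an element [M] of the
    field, so the mean value inequality applies to each component. *)
Lemma conservative_segment N k (D : set 'cV[R]_N) (F : 'cV[R]_N -> 'cV[R]_k) J
    (x v : 'cV[R]_N) (w : 'cV[R]_k) (e L : R) :
  conservative_on D F J ->
  (forall t, 0 <= t <= 1 -> D (x + t *: v)) ->
  (forall s t, 0 <= s <= 1 -> 0 <= t <= 1 ->
    enorm (F (x + s *: v) - F (x + t *: v)) <= L * `|s - t|) ->
  (forall t, 0 <= t <= 1 -> forall M, J (x + t *: v) M ->
    forall i, `|(M *m v - w) i ord0| <= e) ->
  forall i, `|(F (x + v) - F x - w) i ord0| <= e.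
Proof.
move=> [J0 [_ [_ hJ]]] cD cL hM i; pose c t : 'cV[R]_N := x + t *: v.
have cac : abs_cont01 c.
  apply: (@lipschitz_abs_cont _ _ _ (enorm v)) => s t _ _.
  by rewrite /c opprD addrACA subrr add0r -scalerBl enormZ mulrC.
have {}hJ := hJ c cac cD.
(* The two signs of [a] turn the one-sided mean value inequality into a bound on the absolute
   value. *)
suff h a : `|a| = 1 -> a * (F (x + v) - F x - w) i ord0 <= e.
  have := h 1 (normr1 _); have := h (-1) (normrN1 _).
  by rewrite mul1r mulN1r lerNl ler_norml => -> ->.
move=> a1; pose h t := a *: F (c t) i ord0.
suff : h 1 - h 0 <= a * w i ord0 + e.
  by rewrite /h /c scale1r scale0r addr0 !mxE /GRing.scale/= !mulrBr; lra.
apply: (@ae_derive_le _ _ L) => [s t s01 t01|].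
  rewrite /h -scalerBr normrZ a1 mul1r (le_trans _ (cL s t s01 t01))//.
  by rewrite (le_trans _ (entry_le_enorm _ i ord0))// !mxE.
apply: ae_lebesgueS hJ => t ht t01; have [_ [dF FE]] := ht t01.
have t01' : 0 <= t <= 1 by case/andP: t01 => /ltW-> /ltW->.
have [d1 d2] := derive_entry i dF.
split; first exact: derivableZ.
rewrite deriveZ// d2; have [M JM] := J0 _ (cD _ t01').
rewrite (FE _ JM) (derivable_line x v t).2.
rewrite -[leLHS](subrK (a * w i ord0)) addrC lerD2l /GRing.scale/= -mulrBr.
rewrite (le_trans (ler_norm _))// normrM a1 mul1r.
by have := hM t t01' M JM i; rewrite !mxE.
Qed.

(** Otherwise violating matrices at points tending to [z] would, by local boundedness, have a limit
    along a selection; the closed graph puts it in [J z], a contradiction. The matrix [v] may be a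
    single direction or the identity, which controls all of [M]. *)
Lemma conservative_usc N k q (D : set 'cV[R]_N) (F : 'cV[R]_N -> 'cV[R]_k) J z
    (v : 'M[R]_(N, q)) (w : 'M[R]_(k, q)) e :
  open D -> conservative_on D F J -> D z -> (forall M, J z M -> M *m v = w) -> 0 < e ->
  exists2 r, 0 < r & forall z', enorm (z' - z) < r ->
    D z' /\ forall M, J z' M -> forall i j, `|(M *m v - w) i j| <= e.
Proof.
move=> oD [_ [Jb [Jc _]]] Dz hw e0.
have [r0 r00 hr0] := open_enorm_ball oD Dz.
have [r1 r10 [C hC]] := Jb _ Dz.
apply: contrapT => hn.
have {}hn : forall n : nat, exists zM : 'cV[R]_N * 'M[R]_(k, N),
    [/\ enorm (zM.1 - z) < Num.min (Num.min r0 r1) n.+1%:R^-1, J zM.1 zM.2 &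
     exists ij, e < `|(zM.2 *m v - w) ij.1 ij.2|].
  move=> n; apply: contrapT => hn'; apply: hn.
  exists (Num.min (Num.min r0 r1) n.+1%:R^-1); first by rewrite !lt_min r00 r10 /= invr_gt0.
  move=> z' hz'; split; first by apply: hr0; move: hz'; rewrite !lt_min => /andP[/andP[]].
  move=> M JM i j; rewrite leNgt; apply/negP => heij.
  by apply: hn'; exists (z', M); split => //; exists (i, j).
have [f hf] := choice hn.
have Mb n i j : `|(f n).2 i j| <= C.
  have [+ JM _] := hf n; rewrite !lt_min => /andP[/andP[h0 h1] _].
  by apply: hC JM _ _ => //; exact: hr0.
have [s [sk [M hM]]] := bolzano_weierstrass_mx Mb.
have zz : (fun n => (f (s n)).1) @ \oo --> z.
  apply: (@cV_cvg_inv_succ _ _ _ (fun=> z)); first exact: cvg_cst.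
  move=> n; have [+ _ _] := hf (s n); rewrite !lt_min => /andP[_ h].
  by rewrite (lt_le_trans h)// lef_pV2 ?posrE// ler_nat ltnS.
have JM : J z M.
  apply: (Jc _ _ _ _ _ Dz zz hM) => n; last by have [] := hf (s n).
  by apply: hr0; have [+ _ _] := hf (s n); rewrite !lt_min => /andP[/andP[]].
have : (fun n => (f (s n)).2 *m v) @ \oo --> w.
  by rewrite -(hw _ JM); apply: cvg_mulmx hM _; exact: cvg_cst.
move=> /cvgrPdist_lt/(_ _ e0)[n _ /(_ n (leqnn n))] /=.
have [_ _ [[i j] /= hij]] := hf (s n).
rewrite ltNge => /negP; apply; apply: ltW.
by rewrite (lt_le_trans hij)// -(normrN (w - _)) opprB; exact: entry_le_norm.
Qed.

Lemma jac_dir_bound N k (F : 'cV[R]_N -> 'cV[R]_k) z v w C :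
  differentiable F z ->
  (exists2 r, 0 < r & forall s, 0 < s < r -> enorm (F (z + s *: v) - F z - s *: w) <= s * C) ->
  enorm (jac F z *m v - w) <= C.
Proof.
move=> dF [r r0 hr]; apply/ler_addgt0Pr => e e0.
have v1 : 0 < enorm v + 1 by rewrite ltr_wpDl ?enorm_ge0.
have [r' r'0 hr'] := differentiable_jac_eps dF (divr_gt0 e0 v1).
pose s := Num.min (r / 2) (r' / (enorm v + 1) / 2).
have s0 : 0 < s by rewrite lt_min !divr_gt0.
have sr : s < r by rewrite gt_min ltr_pdivrMr// ltr_pMr// ltr1n.
have sr' : enorm (s *: v) < r'.
  rewrite enormZ gtr0_norm// (@lt_trans _ _ (s * (enorm v + 1)))//.
    by rewrite ltr_pM2l// ltrDl.
  rewrite -ltr_pdivlMr// gt_min; apply/orP; right.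
  by rewrite ltr_pdivrMr// ltr_pMr ?divr_gt0// ltr1n.
have h1 := hr s; rewrite s0 sr in h1; have {}h1 := h1 isT.
have h2 := hr' _ sr'.
rewrite -(ler_pM2l s0) -{1}(gtr0_norm s0) -enormZ.
have -> : s *: (jac F z *m v - w) = (F (z + s *: v) - F z - s *: w) -
    (F (z + s *: v) - F z - jac F z *m (s *: v)).
  by rewrite [in RHS]opprB [RHS]addrC subrKA scalerBr -scalemxAr.
rewrite (le_trans (enormB _ _))// mulrDr lerD// (le_trans h2)//.
rewrite enormZ (gtr0_norm s0) mulrCA ler_wpM2l ?(ltW s0)//.
by rewrite mulrAC ler_pdivrMr// ler_wpM2l ?(ltW e0)// lerDl.
Qed.

(** The quotient bound gives the same bound for Jacobians at nearby points of differentiability. It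
    then passes to limits and to convex combinations, since the ball of radius [C] around [w] is
    closed and convex. *)
Lemma clarke_dir_bound N k (F : 'cV[R]_N -> 'cV[R]_k) z v w C r : 0 < r ->
  (forall x, enorm (x - z) < r -> exists2 r', 0 < r' & forall s, 0 < s < r' ->
    enorm (F (x + s *: v) - F x - s *: w) <= s * C) ->
  forall M, clarke_jac F z M -> enorm (M *m v - w) <= C.
Proof.
move=> r0 hr M [q [l [Ms [l0 [l1 [hMs ->]]]]]].
have hM i : enorm (Ms i *m v - w) <= C.
  have [zs [/cV_cvgP hz [dz hj]]] := hMs i.
  have [n hn] := hz _ r0.
  apply: (@cvg_enorm_le _ _ (fun j => jac F (zs (n + j)%N) *m v - w)).
    apply: (@cvgB _ 'cV[R]_k); last exact: cvg_cst.
    apply: cvg_mulmx; last exact: cvg_cst.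
    by apply: (@cvg_subseq _ (fun j => jac F (zs j)) (fun j => n + j)%N) hj => j; rewrite leq_addl.
  move=> j; apply: jac_dir_bound => //.
  by apply: hr; apply: hn; rewrite leq_addr.
have -> : (\sum_(i < q) l i *: Ms i) *m v - w = \sum_(i < q) l i *: (Ms i *m v - w).
  under [RHS]eq_bigr do rewrite scalerBr.
  rewrite sumrB -scaler_suml l1 scale1r mulmx_suml.
  by congr (_ - _); apply: eq_bigr => i _; rewrite scalemxAl.
rewrite (le_trans (enorm_sum _ _ _))// -[leRHS]mul1r -l1 mulr_suml ler_sum// => i _.
by rewrite enormZ ger0_norm// ler_wpM2l.
Qed.

Lemma clarke_mulmx_eq N k (D : set 'cV[R]_N) (F : 'cV[R]_N -> 'cV[R]_k) J z
    (v : 'cV[R]_N) (w : 'cV[R]_k) :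
  open D -> loc_lipschitz_on D F -> conservative_on D F J -> D z ->
  (forall M, J z M -> M *m v = w) -> forall M, clarke_jac F z M -> M *m v = w.
Proof.
move=> oD FD hJ Dz hw M hM; apply/eqP; rewrite -subr_eq0; apply/eqP/enorm_eq0.
apply/eqP; rewrite eq_le enorm_ge0 andbT; apply/ler_addgt0Pr => e e0; rewrite add0r.
have k1 : 0 < k%:R + 1 :> R by rewrite ltr_wpDl.
(* The mean value inequality controls single entries; the factor [k%:R + 1] pays for summing
   them. *)
have [r r0 hr] := conservative_usc oD hJ Dz hw (divr_gt0 e0 k1).
have [r' r'0 [L hL]] := FD _ Dz.
have m0 : 0 < Num.min r r' by rewrite lt_min r0.
apply: (clarke_dir_bound m0 _ hM) => x; rewrite lt_min => /andP[xr xr'].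
pose d := Num.min (r - enorm (x - z)) (r' - enorm (x - z)).
have d0 : 0 < d by rewrite lt_min !subr_gt0 xr.
have v1 : 0 < enorm v + 1 by rewrite ltr_wpDl ?enorm_ge0.
exists (d / (enorm v + 1)); first exact: divr_gt0.
move=> s /andP[s0]; rewrite ltr_pdivlMr// => sd.
have hin t : 0 <= t <= 1 -> enorm (x + t *: (s *: v) - z) < Num.min r r'.
  move=> /andP[t0 t1]; rewrite addrAC; apply: (@le_lt_trans _ _ (enorm (x - z) + s * (enorm v + 1))).
    rewrite (le_trans (enormD _ _))// lerD2l !enormZ ger0_norm// (gtr0_norm s0).
    rewrite -[leRHS]mul1r ler_pM ?mulr_ge0 ?enorm_ge0 ?(ltW s0)//.
    by rewrite ler_wpM2l ?(ltW s0)// lerDl.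
  by move: sd; rewrite !lt_min !ltrBrDl.
have hent := @conservative_segment _ _ _ _ _ x (s *: v) (s *: w) (s * (e / (k%:R + 1))) (L * enorm (s *: v)) hJ.
apply: le_trans (enorm_entry_le _ (hent _ _ _)) _.
- by rewrite mulr_ge0 ?(ltW s0)// ltW// divr_gt0.
- move=> t /hin; rewrite lt_min => /andP[h _]; exact: (hr _ h).1.
- move=> t1 t2 /hin; rewrite lt_min => /andP[_ h1] /hin; rewrite lt_min => /andP[_ h2].
  rewrite (le_trans (hL _ _ h1 h2))// opprD addrACA subrr add0r -scalerBl enormZ.
  by rewrite -mulrA (mulrC (enorm _)).
- move=> t /hin; rewrite lt_min => /andP[h _] M' JM' i.
  rewrite -scalemxAr -scalerBr mxE normrM (gtr0_norm s0) ler_wpM2l ?(ltW s0)//.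
  exact: (hr _ h).2.
- rewrite mulrCA ler_wpM2l ?(ltW s0)// mulrCA ler_piMr ?(ltW e0)//.
  by rewrite ler_pdivrMr// mul1r lerDl.
Qed.

End Conservative.

Module CompleteMatrix.
(** Registers matrices as a complete normed module, the structure over which [Baire] is stated. *)
HB.instance Definition _ (K : realType) (m n : nat) := NormedModule.on 'M[K]_(m, n).

Lemma Baire_mx (K : realType) (m n : nat) (V : nat -> set 'M[K]_(m, n)) :
  (forall i, open (V i) /\ dense (V i)) -> dense (\bigcap_i V i).
Proof. exact: Baire. Qed.
End CompleteMatrix.

(** * Density of the points of differentiability *)

Section Density.
Context {R : realType} {N k : nat}.
Implicit Types (D : set 'cV[R]_N) (F : 'cV[R]_N -> 'cV[R]_k)
  (J : 'cV[R]_N -> set 'M[R]_(k, N)).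

(* On a segment parallel to the j-th axis, J is almost everywhere single-valued
   in its j-th column; upper semicontinuity spreads this to a neighbourhood. *)
Lemma conservative_small_oscillation D F J z r e : open D -> conservative_on D F J ->
  D z -> 0 < r -> 0 < e ->
  exists2 x, enorm (x - z) < r & exists2 r', 0 < r' & forall x', enorm (x' - x) < r' ->
    D x' /\ forall M M', J x' M -> J x' M' -> forall i j, `|M i j - M' i j| <= e.
Proof.
move=> oD hJ Dz r0 e0.
(* [l] counts the columns whose oscillation is already controlled, on a ball that may shrink at each
   stage. *)
suff h l : exists2 x, enorm (x - z) < r &
    exists2 r', 0 < r' & forall x', enorm (x' - x) < r' ->
    D x' /\ forall M M', J x' M -> J x' M' ->
      forall i (j : 'I_N), (j < l)%N -> `|M i j - M' i j| <= e.
  have [x xz [r' r'0 hx]] := h N; exists x => //; exists r' => // x' /hx[Dx' hM].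
  by split => // M M' JM JM' i j; exact: hM.
elim: l => [|l [x xz [r' r'0 hx]]].
  exists z; first by rewrite subrr enorm0.
  by have [r' r'0 hr'] := open_enorm_ball oD Dz; exists r' => // x' /hr'.
have [lN|Nl] := ltnP l N; last first.
  exists x => //; exists r' => // x' /hx[Dx' hM]; split => // M M' JM JM' i j _.
  by apply: hM => //; exact: leq_trans (ltn_ord j) Nl.
pose j0 := Ordinal lN.
(* Half of the available room: the segment stays where the earlier columns are controlled and within
   [r] of [z]. *)
pose rho := Num.min r' (r - enorm (x - z)) / 2.
have m0 : 0 < Num.min r' (r - enorm (x - z)) by rewrite lt_min r'0 subr_gt0.
have rho0 : 0 < rho by rewrite divr_gt0.
have : rho < Num.min r' (r - enorm (x - z)) by rewrite ltr_pdivrMr// ltr_pMr// ltr1n.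
rewrite lt_min => /andP[rhor' rhor].
pose v : 'cV[R]_N := rho *: delta_mx j0 ord0.
have cx t : 0 <= t <= 1 -> enorm (x + t *: v - x) <= rho.
  move=> /andP[t0 t1]; rewrite addrAC subrr add0r !enormZ enorm_delta mulr1.
  by rewrite ger0_norm// gtr0_norm// ler_piMl// ltW.
have cD t : 0 <= t <= 1 -> D (x + t *: v).
  by move=> /cx h; apply: (hx _ _).1; exact: le_lt_trans h rhor'.
have cac : abs_cont01 (fun t => x + t *: v).
  apply: (@lipschitz_abs_cont _ _ _ (enorm v)) => s t _ _.
  by rewrite opprD addrACA subrr add0r -scalerBl enormZ mulrC.
have [t [t01 ht]] := ae_exists (@ltr01 R) (hJ.2.2.2 _ cac cD).
have [_ [_ hM]] := ht t01.
have t01' : 0 <= t <= 1 by case/andP: t01 => /ltW-> /ltW->.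
set y := x + t *: v in hM; rewrite (derivable_line x v t).2 in hM.
(* As [v] is [rho] times a basis vector, this tolerance places the entries of column [j0] within
   [e / 2] of a common value, hence within [e] of each other. *)
have e'0 : 0 < rho * (e / 2) by rewrite mulr_gt0// divr_gt0.
have [r3 r30 hr3] := conservative_usc oD hJ (cD _ t01') (fun M h => esym (hM M h)) e'0.
exists y.
  rewrite (le_lt_trans (enorm_triangle x _ _))// -ltrBrDr.
  exact: le_lt_trans (cx _ t01') rhor.
exists (Num.min r3 (r' - enorm (y - x))).
  by rewrite lt_min r30 subr_gt0 (le_lt_trans (cx _ t01')).
move=> x'; rewrite lt_min => /andP[x'r3]; rewrite ltrBrDr => x'y.
have [Dx' hM1] := hx x' (le_lt_trans (enorm_triangle y _ _) x'y).
have [_ hM2] := hr3 _ x'r3.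
split => // M M' JM JM' i j; rewrite ltnS leq_eqVlt => /orP[/eqP jl|]; last exact: hM1.
have -> : j = j0 by exact: val_inj.
have ME (P : 'M[R]_(k, N)) (w : 'cV[R]_k) :
    (P *m v - w) i ord0 = rho * P i j0 - w i ord0.
  by rewrite /v -scalemxAr mxE; congr (_ + _); rewrite mxE ?mulmx_delta_entry.
have := hM2 _ JM' i ord0; have := hM2 _ JM i ord0; rewrite !ME.
set c := (X in rho * _ - X); set a := M i j0; set b := M' i j0 => h1 h2.
rewrite -(ler_pM2l rho0) -{1}(gtr0_norm rho0) -normrM.
have -> : rho * (a - b) = (rho * a - c) - (rho * b - c) by ring.
rewrite (le_trans (ler_normB _ _))//.
by rewrite (le_trans (lerD h1 h2))// -mulrDr -splitr.
Qed.

(** By semicontinuity every matrix of the field near [z] is close to [M0], so the mean value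
    inequality along segments issuing from [z] shows that [M0] is the differential. *)
Lemma conservative_singleton_differentiable D F J z M0 : open D ->
  loc_lipschitz_on D F -> conservative_on D F J -> D z ->
  (forall M, J z M -> M = M0) -> differentiable F z.
Proof.
move=> oD FD hJ Dz hM0.
suff /jac_eps_differentiable[] : forall e, 0 < e ->
    exists2 r, 0 < r & forall h, enorm h < r ->
      enorm (F (z + h) - F z - M0 *m h) <= e * enorm h by [].
move=> e e0.
have hw M : J z M -> M *m 1%:M = M0 by move=> /hM0 ->; rewrite mulmx1.
have k1 : 0 < k%:R + 1 :> R by rewrite ltr_wpDl.
have N1 : 0 < N%:R + 1 :> R by rewrite ltr_wpDl.
pose e' := e / (k%:R + 1) / (N%:R + 1).
have e'0 : 0 < e' by rewrite !divr_gt0.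
have [r r0 hr] := conservative_usc oD hJ Dz hw e'0.
have [r' r'0 [L hL]] := FD _ Dz.
exists (Num.min r r'); first by rewrite lt_min r0.
move=> h; rewrite lt_min => /andP[hhr hhr'].
have hin (t : R) : 0 <= t <= 1 -> enorm (z + t *: h - z) <= enorm h.
  move=> /andP[t0 t1]; rewrite addrAC subrr add0r enormZ ger0_norm//.
  by rewrite ler_piMl// enorm_ge0.
apply: le_trans (enorm_entry_le _ (@conservative_segment _ _ _ _ _ _ z h (M0 *m h)
    (N%:R * e' * enorm h) (L * enorm h) hJ _ _ _)) _.
- by rewrite mulr_ge0 ?enorm_ge0// mulr_ge0// ltW.
- by move=> t /hin h1; apply: (hr _ _).1; exact: le_lt_trans h1 hhr.
- move=> s t /hin h1 /hin h2.
  rewrite (le_trans (hL _ _ (le_lt_trans h1 hhr') (le_lt_trans h2 hhr')))//.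
  by rewrite opprD addrACA subrr add0r -scalerBl enormZ -mulrA (mulrC (enorm _)).
- move=> t /hin h1 M JM i; rewrite -mulmxBl; apply: enorm_mulmx_entry_le => i' j.
  by have := (hr _ (le_lt_trans h1 hhr)).2 M JM i' j; rewrite mulmx1.
- have eE : e = (k%:R + 1) * ((N%:R + 1) * e').
    by rewrite /e' (mulrC (N%:R + 1)) divfK ?gt_eqF// mulrC divfK// gt_eqF.
  rewrite mulrA ler_wpM2r ?enorm_ge0// eE.
  apply: ler_pM => //; [by rewrite mulr_ge0// ltW|by rewrite lerDl|].
  by rewrite ler_wpM2r ?(ltW e'0)// lerDl.
Qed.

Lemma differentiable_dense D F z r : open D -> path_differentiable_on D F ->
  D z -> 0 < r -> exists x, [/\ enorm (x - z) < r, D x & differentiable F x].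
Proof.
move=> oD [FD [J hJ]] Dz r0.
pose U (n : nat) : set 'cV[R]_N := [set x | exists2 r', 0 < r' & forall x', enorm (x' - x) < r' ->
    D x' /\ forall M M', J x' M -> J x' M' -> forall i j, `|M i j - M' i j| <= n.+1%:R^-1].
(* [U n] is dense in [D] only, while Baire's theorem asks for density in the whole space; the
   exterior of [D] is added. *)
pose V n := U n `|` ~` closure D.
have oU n : open (U n).
  apply: enorm_ball_open => x [r' r'0 hr']; have r'20 : 0 < r' / 2 by rewrite divr_gt0.
  exists (r' / 2) => // y yx; exists (r' / 2) => // x' x'y; apply: hr'.
  by rewrite (le_lt_trans (enorm_triangle y _ _))// (splitr r') ltrD.
have hV n : open (V n) /\ dense (V n).
  split; first by apply: openU (oU n) _; exact/closed_openC/closed_closure.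
  move=> O O0 oO; have [[y [Oy Dy]]|OD] := pselect (O `&` D !=set0).
    have [r' r'0 hr'] := open_enorm_ball oO Oy.
    have n0 : 0 < n.+1%:R^-1 :> R by rewrite invr_gt0.
    have [x xy hx] := conservative_small_oscillation oD hJ Dy r'0 n0.
    by exists x; split; [exact: hr'|left].
  case: O0 => x Ox; exists x; split => //; right => cDx; apply: OD.
  have [] := cDx O; first exact: open_nbhs_nbhs.
  by move=> y [Dy Oy]; exists y.
pose B : set 'cV[R]_N := [set x | enorm (x - z) < r] `&` D.
have oB : open B.
  apply: openI oD; apply: enorm_ball_open => x xz.
  exists (r - enorm (x - z)); first by rewrite subr_gt0.
  by move=> y; rewrite ltrBrDr => h; exact: le_lt_trans (enorm_triangle x _ _) h.
have B0 : B !=set0 by exists z; split => //=; rewrite subrr enorm0.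
have [x [[/= xz Dx] hx]] := CompleteMatrix.Baire_mx hV B0 oB.
exists x; split => //; have [M0 JM0] := hJ.1 _ Dx.
apply: (conservative_singleton_differentiable oD FD hJ Dx (M0 := M0)) => M JM.
(* Two elements of the field at a point of every [U n] differ by at most 1/(n+1) for all n. *)
apply/matrixP => i j; apply/eqP; rewrite -subr_eq0 -normr_le0.
apply/ler_addgt0Pr => e e0; rewrite add0r; have [n hn] := inv_succ_lt e0.
apply: le_trans (ltW (hn n (leqnn n))).
have [[r' r'0 hr']|] := hx n I; last by case; exact: subset_closure.
by apply: (hr' x _).2 => //; rewrite subrr enorm0.
Qed.

End Density.

(** * The Clarke Jacobian of a path differentiable map is conservative *)

Section Clarke.
Context {R : realType} {N k : nat}.
Implicit Types (D : set 'cV[R]_N) (F : 'cV[R]_N -> 'cV[R]_k) (S : set 'M[R]_(k, N)).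

Lemma conv_hull_mem S M : S M -> conv_hull S M.
Proof.
move=> SM; exists 1%N, (fun=> 1), (fun=> M); split => //.
by rewrite !big_ord1 scale1r.
Qed.

Lemma clarke_lim_jac F z : differentiable F z -> clarke_lim F z (jac F z).
Proof.
move=> dF; exists (fun=> z); split; first exact: cvg_cst.
by split => //; exact: cvg_cst.
Qed.

(* A nontrivial affine dependency among the Ms lets us move along it until one weight vanishes. *)
Lemma conv_combination_drop q (l : 'I_q.+1 -> R) (Ms : 'I_q.+1 -> 'M[R]_(k, N)) :
  ((k * N).+1 <= q)%N -> (forall i, 0 <= l i) ->
  exists (l' : 'I_q -> R) (Ms' : 'I_q -> 'M[R]_(k, N)),
    [/\ forall i, 0 <= l' i, \sum_i l' i = \sum_i l i,
       forall i, exists j, Ms' i = Ms j &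
       \sum_i l' i *: Ms' i = \sum_i l i *: Ms i].
Proof.
move=> hq l0.
(* A left kernel vector of these rows is a dependency among the matrices with coefficients of sum 0;
   it exists because there are more rows than the [k * N + 1] columns. *)
pose A : 'M[R]_(q.+1, k * N + 1) := \matrix_(i < q.+1) row_mx (mxvec (Ms i)) 1%:M.
have : kermx A != 0.
  rewrite -mxrank_eq0 mxrank_ker subn_eq0 -ltnNge (leq_ltn_trans (rank_leq_col A))//.
  by rewrite addn1.
case/rowV0Pn => u /sub_kermxP uA u0.
have uM : \sum_i u ord0 i *: Ms i = 0.
  have : lsubmx (u *m A) = 0 by rewrite uA linear0.
  rewrite mulmx_sum_row; under eq_bigr do rewrite rowK.
  rewrite linear_sum/=; under eq_bigr do rewrite linearZ/= row_mxKl.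
  move=> /(congr1 vec_mx); rewrite linear_sum/= linear0 => h.
  by rewrite -[RHS]h; apply: eq_bigr => i _; rewrite linearZ/= mxvecK.
have us : \sum_i u ord0 i = 0.
  have : rsubmx (u *m A) = 0 by rewrite uA linear0.
  rewrite mulmx_sum_row; under eq_bigr do rewrite rowK.
  rewrite linear_sum/=; under eq_bigr do rewrite linearZ/= row_mxKr.
  move=> /(congr1 (fun B : 'M[R]_1 => B ord0 ord0)); rewrite summxE mxE => h.
  by rewrite -[RHS]h; apply: eq_bigr => i _; rewrite !mxE eqxx mulr1.
have [i1 ui1] : exists i, 0 < u ord0 i.
  apply: contrapT => hn.
  have un i : u ord0 i <= 0 by rewrite leNgt; apply/negP => h; apply: hn; exists i.
  move/eqP: u0; apply; apply/matrixP => a i; rewrite (ord1 a) mxE.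
  have : \sum_i - u ord0 i == 0 by rewrite sumrN us oppr0.
  rewrite psumr_eq0; last by move=> j _; rewrite oppr_ge0.
  by move=> /allP/(_ i (mem_index_enum _))/=; rewrite oppr_eq0 => /eqP.
(* The smallest ratio is the longest step along [u] that keeps all weights nonnegative, and it
   brings the weight of [i0] to 0. *)
have [i0 ui0 hmin] : exists2 i0, 0 < u ord0 i0 &
    forall i, 0 < u ord0 i -> l i0 / u ord0 i0 <= l i / u ord0 i.
  by case: (@Order.TotalTheory.arg_minP _ R _ i1 (fun i => 0 < u ord0 i) (fun i => l i / u ord0 i) ui1) => i0 h1 h2; exists i0.
pose t := l i0 / u ord0 i0.
have t0 : 0 <= t by rewrite divr_ge0// ltW.
pose l1 i := l i - t * u ord0 i.
have l10 i : 0 <= l1 i.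
  rewrite subr_ge0; have [ui|ui] := ltP 0 (u ord0 i).
    by rewrite -ler_pdivlMr//; exact: hmin.
  by apply: le_trans (l0 i); rewrite mulr_ge0_le0.
have l1i0 : l1 i0 = 0 by rewrite /l1 /t divfK ?subrr// gt_eqF.
exists (fun j => l1 (lift i0 j)), (fun j => Ms (lift i0 j)); split => //.
- transitivity (\sum_i l1 i); first by rewrite (bigD1_ord i0)//= l1i0 add0r.
  by rewrite sumrB -mulr_sumr us mulr0 subr0.
- by move=> i; exists (lift i0 i).
- transitivity (\sum_i l1 i *: Ms i).
    by rewrite (bigD1_ord i0)//= l1i0 scale0r add0r.
  under eq_bigr do rewrite scalerBl -scalerA.
  by rewrite sumrB -scaler_sumr uM scaler0 subr0.
Qed.

(** A length independent of [M] is what lets weights and matrices be extracted simultaneously along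
    a sequence. *)
Lemma caratheodory S M : conv_hull S M ->
  exists (l : 'I_(k * N).+1 -> R) (Ms : 'I_(k * N).+1 -> 'M[R]_(k, N)),
    [/\ forall i, 0 <= l i, \sum_i l i = 1, forall i, S (Ms i) & M = \sum_i l i *: Ms i].
Proof.
move=> [q [l [Ms [l0 [l1 [SMs ->]]]]]].
have [q' [hq' [l' [Ms' [l'0 l'1 SMs' ->]]]]] : exists q', (q' <= (k * N).+1)%N /\
    exists (l' : 'I_q' -> R) (Ms' : 'I_q' -> 'M[R]_(k, N)),
    [/\ forall i, 0 <= l' i, \sum_i l' i = 1, forall i, S (Ms' i) &
      \sum_(i < q) l i *: Ms i = \sum_i l' i *: Ms' i].
  elim: q l Ms l0 l1 SMs => [|q ih] l Ms l0 l1 SMs.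
    by exists 0%N; split => //; exists l, Ms.
  have [h|h] := leqP q.+1 (k * N).+1; first by exists q.+1; split => //; exists l, Ms.
  have [l' [Ms' [l'0 l'1 hMs' <-]]] := conv_combination_drop Ms h l0.
  by apply: ih => //; [rewrite l'1|move=> i; have [j ->] := hMs' i].
have [i0 _] : exists i0 : 'I_q', True.
  case: q' l' {hq' Ms' SMs' l'0} l'1 => [l'|q' _ _]; last by exists ord0.
  by rewrite big_ord0 => /esym/eqP; rewrite oner_eq0.
(* Shorter combinations are padded with weight 0 and an arbitrary matrix [Ms' i0] of [S], whence the
   need for an index in ['I_q']. *)
exists (fun i => if insub (val i) is Some j then l' j else 0).
exists (fun i => if insub (val i) is Some j then Ms' j else Ms' i0).
have hsum (V : nmodType) (f : 'I_q' -> V) :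
    \sum_(i < (k * N).+1) (if insub (val i) is Some j then f j else 0) = \sum_i f i.
  pose g (i : nat) := if (insub i : option 'I_q') is Some j then f j else 0.
  have -> : \sum_(i < q') f i = \sum_(i < q') g i.
    by apply: eq_bigr => i _; rewrite /g valK.
  rewrite (big_ord_widen _ g hq') [RHS]big_mkcond/=; apply: eq_bigr => i _.
  by rewrite /g; case: ifPn => // ?; rewrite insubN.
split.
- by move=> i; case: insubP => // j _ _; exact: l'0.
- by rewrite (hsum R).
- by move=> i; case: insubP => [j _ _|_]; exact: SMs'.
- rewrite -(hsum 'M[R]_(k, N)); apply: eq_bigr => i _.
  by case: insubP => // _; rewrite scale0r.
Qed.

(** The quotients of [F] in a coordinate direction are bounded by the Lipschitz constant, hence so
    is every column of a Clarke matrix. *)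
Lemma clarke_locally_bounded D F z : loc_lipschitz_on D F -> D z ->
  exists2 r : R, 0 < r & exists C : R, forall z' M, enorm (z' - z) < r ->
    clarke_jac F z' M -> forall i j, `|M i j| <= C.
Proof.
move=> FD Dz; have [r r0 [L hL]] := FD _ Dz; exists r => //; exists L => z' M z'r hM i j.
have r'0 : 0 < r - enorm (z' - z) by rewrite subr_gt0.
rewrite -(mulmx_delta_entry M i j) (le_trans (entry_le_enorm _ _ _))// -[_ *m _]subr0.
apply: (clarke_dir_bound r'0 _ hM) => x; rewrite ltrBrDr => hx.
have xz : enorm (x - z) < r by exact: le_lt_trans (enorm_triangle z' _ _) hx.
exists (r - enorm (x - z)); first by rewrite subr_gt0.
move=> s /andP[s0 sr]; rewrite scaler0 subr0.
have hs : enorm (s *: (delta_mx j ord0 : 'cV[R]_N)) = s by rewrite enormZ enorm_delta mulr1 gtr0_norm.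
rewrite (le_trans (hL _ _ _ xz))//.
  by rewrite addrAC (le_lt_trans (enormD _ _))// hs -ltrBrDl.
by rewrite addrAC subrr add0r hs mulrC.
Qed.

(** The Jacobians at points of differentiability tending to [z] are bounded, so some selection
    converges. *)
Lemma clarke_nonempty D F z : open D -> path_differentiable_on D F -> D z ->
  exists M, clarke_jac F z M.
Proof.
move=> oD FD Dz.
have hx (n : nat) : exists x, [/\ enorm (x - z) < n.+1%:R^-1, D x & differentiable F x].
  by apply: (differentiable_dense oD FD Dz); rewrite invr_gt0.
have [f hf] := choice hx.
have fz : f @ \oo --> z.
  by apply: (@cV_cvg_inv_succ _ _ _ (fun=> z)) => [|n]; [exact: cvg_cst|have [] := hf n].
have [r r0 [C hC]] := clarke_locally_bounded FD.1 Dz.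
have /cV_cvgP/(_ _ r0)[n hn] := fz.
have [j i l|s [sk [M hM]]] := @bolzano_weierstrass_mx _ _ _ (fun j => jac F (f (n + j)%N)) C.
  apply: hC; first by apply: hn; exact: leq_addr.
  by apply/conv_hull_mem/clarke_lim_jac; have [] := hf (n + j)%N.
exists M; apply: conv_hull_mem; exists (fun j => f (n + s j)%N); split.
  by apply: (@cvg_subseq _ f (fun j => n + s j)%N) fz => j; rewrite (leq_trans (sk j))// leq_addl.
by split => // j; have [] := hf (n + s j)%N.
Qed.

(** Diagonal argument: for each n a point of differentiability is chosen within 1/(n+1) of [zs n],
    with Jacobian within 1/(n+1) of [Ms n]. *)
Lemma clarke_lim_closed F (zs : nat -> 'cV[R]_N) (Ms : nat -> 'M[R]_(k, N))
    (z : 'cV[R]_N) (M : 'M[R]_(k, N)) :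
  zs @ \oo --> z -> Ms @ \oo --> M -> (forall j, clarke_lim F (zs j) (Ms j)) ->
  clarke_lim F z M.
Proof.
move=> hz hM hj.
have hx (n : nat) : exists x, [/\ enorm (x - zs n) < n.+1%:R^-1, differentiable F x &
    `|Ms n - jac F x| < n.+1%:R^-1].
  have [xs [/cV_cvgP hxs [dxs /cvgrPdist_lt hJ]]] := hj n.
  have n0 : 0 < n.+1%:R^-1 :> R by rewrite invr_gt0.
  have [n1 hn1] := hxs _ n0; have [n2 _ hn2] := hJ _ n0.
  exists (xs (maxn n1 n2)); split => //; first by apply: hn1; exact: leq_maxl.
  by apply: hn2; exact: leq_maxr.
have [f hf] := choice hx; exists f; split.
  by apply: (cV_cvg_inv_succ hz) => n; have [] := hf n.
split; first by move=> n; have [] := hf n.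
apply/cvgrPdist_lt => e e0; have e20 : 0 < e / 2 by rewrite divr_gt0.
have [n1 hn1] := inv_succ_lt e20; have /cvgrPdist_lt/(_ _ e20)[n2 _ hn2] := hM.
exists (maxn n1 n2) => // n /=; rewrite geq_max => /andP[h1 h2].
rewrite -(subrKA (Ms n)) (le_lt_trans (ler_normD _ _))// (splitr e) ltrD//; first exact: hn2.
by have [_ _ h] := hf n; exact: lt_trans h (hn1 _ h1).
Qed.

(** Caratheodory gives combinations of fixed length; first the weights, then the matrices converge
    along selections, and the limit matrices are again limits of Jacobians. *)
Lemma clarke_closed D F (zs : nat -> 'cV[R]_N) (Ms : nat -> 'M[R]_(k, N))
    (z : 'cV[R]_N) (M : 'M[R]_(k, N)) :
  loc_lipschitz_on D F -> D z -> zs @ \oo --> z -> Ms @ \oo --> M ->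
  (forall j, clarke_jac F (zs j) (Ms j)) -> clarke_jac F z M.
Proof.
move=> FD Dz hz hM hj.
have [r r0 [C hC]] := clarke_locally_bounded FD Dz.
have /cV_cvgP/(_ _ r0)[n hn] := hz.
have hx (j : nat) : exists lP : ('I_(k * N).+1 -> R) * ('I_(k * N).+1 -> 'M[R]_(k, N)),
    [/\ forall i, 0 <= lP.1 i, \sum_i lP.1 i = 1,
      forall i, clarke_lim F (zs (n + j)%N) (lP.2 i) &
      Ms (n + j)%N = \sum_i lP.1 i *: lP.2 i].
  by have [l [P h]] := caratheodory (hj (n + j)%N); exists (l, P).
have [f hf] := choice hx.
have [j i|s [sk hs]] := @bolzano_weierstrass_fin _ _ (fun j i => (f j).1 i) 1.
  have [h0 h1 _ _] := hf j; rewrite ger0_norm// -h1 (bigD1 i)//= lerDl sumr_ge0//.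
have [j i|t [tk ht]] := @bolzano_weierstrass_fin _ ('I_(k * N).+1 * ('I_k * 'I_N))%type
    (fun j i => (f (s j)).2 i.1 i.2.1 i.2.2) C.
  have [_ _ h _] := hf (s j); apply: hC (conv_hull_mem (h i.1)) _ _.
  by apply: hn; exact: leq_addr.
pose l i := limn (fun j => (f (s j)).1 i).
pose P i : 'M[R]_(k, N) := \matrix_(a, b) limn (fun j => (f (s (t j))).2 i a b).
have hl i : (fun j => (f (s (t j))).1 i) @ \oo --> l i.
  by apply: (@cvg_subseq _ (fun j => (f (s j)).1 i) t) => //; exact: hs.
have hP i : (fun j => (f (s (t j))).2 i) @ \oo --> P i.
  by apply/mx_cvgP => a b; rewrite mxE; exact: (ht (i, (a, b))).
have hst (T : topologicalType) (u : nat -> T) (x : T) : u @ \oo --> x ->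
    (fun j => u (n + s (t j))%N) @ \oo --> x.
  apply: (@cvg_subseq _ u (fun j => n + s (t j))%N) => j.
  by rewrite (leq_trans (tk j))// (leq_trans (sk _))// leq_addl.
exists (k * N).+1, l, P; split; [|split; [|split]].
- move=> i; apply: (cvgr_to_ge (hl i)); apply: nearW => j.
  by have [h _ _ _] := hf (s (t j)).
- have h1 : (fun j => \sum_i (f (s (t j))).1 i) @ \oo --> \sum_i l i by exact: cvg_sumr.
  have h2 : (fun j => \sum_i (f (s (t j))).1 i) @ \oo --> (1 : R).
    rewrite (_ : (fun j => _) = (fun=> 1)); first exact: cvg_cst.
    by apply/funext => j; have [] := hf (s (t j)).
  exact: (cvg_unique (@norm_hausdorff _ R) h1 h2).
- move=> i; apply: (clarke_lim_closed (hst _ _ _ hz) (hP i)) => j.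
  by have [] := hf (s (t j)).
- have h1 : (fun j => \sum_i (f (s (t j))).1 i *: (f (s (t j))).2 i) @ \oo --> \sum_i l i *: P i.
    by apply: (@cvg_sumr _ 'M[R]_(k, N)) => i; apply: (@cvgZ _ 'M[R]_(k, N)).
  have h2 : (fun j => \sum_i (f (s (t j))).1 i *: (f (s (t j))).2 i) @ \oo --> M.
    rewrite (_ : (fun j => _) = (fun j => Ms (n + s (t j))%N)); first exact: hst.
    by apply/funext => j; have [_ _ _ ->] := hf (s (t j)).
  exact: (cvg_unique (@norm_hausdorff _ 'M[R]_(k, N)) h2 h1).
Qed.

Lemma clarke_conservative D F : open D -> path_differentiable_on D F ->
  conservative_on D F (clarke_jac F).
Proof.
move=> oD FD; have [FL [J hJ]] := FD; split; first by move=> z; exact: clarke_nonempty.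
split; [|split].
- move=> z Dz; have [r r0 [C hC]] := clarke_locally_bounded FL Dz.
  by exists r => //; exists C => z' M _; exact: hC.
- by move=> zs Ms z M _ Dz hz hM; exact: clarke_closed FL Dz hz hM.
- move=> c hc cD; apply: ae_lebesgueS (hJ.2.2.2 c hc cD) => t ht t01.
  have [dc [dF h]] := ht t01; split => //; split => // M hM; apply/esym.
  apply: (clarke_mulmx_eq oD FL hJ _ _ hM); last by move=> M' /h.
  by apply: cD; case/andP: t01 => /ltW-> /ltW->.
Qed.

End Clarke.

(** * Minimizers of closed functions and fixed points of contractions *)

Section Minimization.
Context {R : realType} {n : nat}.
Implicit Types (h : 'cV[R]_n -> \bar R) (q : 'cV[R]_n -> R).

Lemma seq_closed (A : set 'cV[R]_n) :
  (forall (zs : nat -> 'cV[R]_n) (z : 'cV[R]_n), zs @ \oo --> z -> (forall j, A (zs j)) -> A z) ->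
  closed A.
Proof.
move=> hA; rewrite -(setCK A); apply: open_closedC; apply: enorm_ball_open => z nAz.
apply: contrapT => hn.
have {}hn (j : nat) : exists x, enorm (x - z) < j.+1%:R^-1 /\ A x.
  apply: contrapT => hn'; apply: hn; exists j.+1%:R^-1; first by rewrite invr_gt0.
  by move=> x xz Ax; apply: hn'; exists x.
have [f hf] := choice hn; apply: nAz; apply: (hA f) => [|j]; last exact: (hf j).2.
apply: (@cV_cvg_inv_succ _ _ _ (fun=> z)); first exact: cvg_cst.
by move=> j; exact: (hf j).1.
Qed.

Lemma closed_seq (A : set 'cV[R]_n) (zs : nat -> 'cV[R]_n) (z : 'cV[R]_n) N :
  closed A -> zs @ \oo --> z -> (forall j, (N <= j)%N -> A (zs j)) -> A z.
Proof. by move=> clA hz hA; apply: (closed_cvg A clA _ _ hz); exists N. Qed.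

Lemma lipschitz_seq_cvg q C : (forall x y, `|q x - q y| <= C * enorm (x - y)) ->
  forall (zs : nat -> 'cV[R]_n) (z : 'cV[R]_n), zs @ \oo --> z -> q \o zs @ \oo --> q z.
Proof.
move=> qC zs z /cV_cvgP hz; apply/cvgrPdist_lt => e e0.
have C1 : 0 < `|C| + 1 by rewrite ltr_wpDl.
have [N hN] := hz _ (divr_gt0 e0 C1); exists N => // j Nj /=.
rewrite (le_lt_trans (qC _ _))// enormB_sym.
apply: (@le_lt_trans _ _ ((`|C| + 1) * enorm (zs j - z))).
  by rewrite ler_wpM2r ?enorm_ge0// (le_trans (ler_norm _))// lerDl.
by rewrite mulrC -ltr_pdivlMr//; exact: hN.
Qed.

Lemma lte_real_dense (x y : \bar R) : (x < y)%E -> exists2 r, (x < r%:E)%E & (r%:E < y)%E.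
Proof.
case: x y => [x| |] [y| |]//.
- rewrite lte_fin => xy; exists ((x + y) / 2); rewrite lte_fin; first by rewrite midf_lt.
  by rewrite midf_lt.
- by move=> _; exists (x + 1); rewrite ?lte_fin ?ltrDl// ltry.
- by move=> _; exists (y - 1); rewrite ?ltNyr// lte_fin gtrDl oppr_lt0.
- by move=> _; exists 0; rewrite ?ltNyr ?ltry.
Qed.

(** Along a convergent sequence in a sublevel set, [h (zs j)] is eventually at most [c - q z + e];
    the sublevel sets of [h] are closed and [e] is arbitrary. *)
Lemma eclosed_add h q : eclosed h ->
  (forall (zs : nat -> 'cV[R]_n) (z : 'cV[R]_n), zs @ \oo --> z -> q \o zs @ \oo --> q z) ->
  eclosed (fun x => h x + (q x)%:E)%E.
Proof.
move=> clh hq c; apply: seq_closed => zs z hz /= hc.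
suff : (h z <= (c - q z)%:E)%E by rewrite EFinB leeBrDr.
apply/lee_addgt0Pr => e e0; rewrite -EFinD.
have /cvgrPdist_le/(_ _ e0)[N _ hN] := hq _ _ hz.
apply: (closed_seq (clh _) hz (N := N)) => j Nj /=.
have : (h (zs j) <= (c - q (zs j))%:E)%E by rewrite EFinB leeBrDr.
move/le_trans; apply; rewrite lee_fin -addrA lerD2l -lerBlDl.
have := hN j Nj; rewrite ler_norml => /andP[_ /=]; lra.
Qed.

(** The direct method: a minimizing sequence stays in the bounded sublevel set, and a limit of it
    lies in every sublevel set above the infimum. *)
Lemma eclosed_min h x0 c0 B : eclosed h -> (h x0 <= c0%:E)%E ->
  (forall x, (h x <= c0%:E)%E -> enorm x <= B) ->
  exists u, forall v, (h u <= h v)%E.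
Proof.
move=> clh hx0 hB; pose m := ereal_inf [set h x | x in [set: 'cV[R]_n]].
have mh v : (m <= h v)%E by apply: ereal_inf_lbound; exists v.
have [mc0|] := ltP m c0%:E; last first.
  by move=> c0m; exists x0 => v; rewrite (le_trans hx0)// (le_trans c0m).
(* Real levels decreasing to the infimum; the value -oo is allowed for [m], with levels [- j]. *)
have [c cm hc] : exists2 c : nat -> R, forall j, (m < (c j)%:E)%E &
    forall r, (m < r%:E)%E -> exists N, forall j, (N <= j)%N -> c j <= r.
  case mE : m => [r| |].
  - exists (fun j => r + j.+1%:R^-1); first by move=> j; rewrite lte_fin ltrDl invr_gt0.
    move=> r'; rewrite lte_fin -subr_gt0 => /inv_succ_lt[N hN].
    by exists N => j /hN/ltW; rewrite lerBrDl.
  - by move: mc0; rewrite mE.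
  - exists (fun j => - j%:R); first by move=> j; rewrite ltNyr.
    move=> r _; exists (Num.bound `|r|) => j hj; rewrite lerNl.
    rewrite (le_trans (ler_norm _))// normrN ltW//.
    by rewrite (lt_le_trans (archi_boundP (normr_ge0 r)))// ler_nat.
have hx (j : nat) : exists x, (h x <= (c j)%:E)%E /\ (h x <= c0%:E)%E.
  have : (m < (Num.min (c j) c0)%:E)%E.
    by rewrite /Num.min; case: ifP.
  move=> /ereal_inf_lt[_ [x _ <-]] hxlt; exists x.
  by split; rewrite ltW// (lt_le_trans hxlt)// lee_fin ge_min lexx ?orbT.
have [f hf] := choice hx.
have [s [sk [u hu]]] := bolzano_weierstrass_cV (fun j => hB _ (hf j).2).
exists u => v; apply: le_trans (mh v); rewrite leNgt; apply/negP => /lte_real_dense[r mr].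
apply/negP; rewrite -leNgt.
have [N hN] := hc _ mr.
apply: (closed_seq (clh r) hu (N := N)) => j Nj /=.
by rewrite (le_trans (hf _).1)// lee_fin hN// (leq_trans Nj).
Qed.

(** A minimizer [u] of the displacement |x - F x| has displacement 0, since passing from [u] to
    [F u] multiplies it by at most [c]. *)
Lemma enorm_fixed_point (F : 'cV[R]_n -> 'cV[R]_n) c : 0 <= c < 1 -> lipschitz_with c F ->
  exists x, F x = x.
Proof.
move=> /andP[c0 c1] Fc; pose q x := enorm (x - F x).
have c1' : 0 < 1 - c by rewrite subr_gt0.
have cl : eclosed (fun x => 0%:E + (q x)%:E)%E.
  apply: (@eclosed_add (fun=> 0%:E)).
    by move=> r; apply: seq_closed => zs z _ /(_ 0%N).
  apply: (@lipschitz_seq_cvg q (1 + c)) => x y.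
  wlog : x y / q y <= q x => [hw|].
    have [|/ltW] := leP (q y) (q x); first exact: hw.
    by move/hw; rewrite distrC enormB_sym.
  rewrite -subr_ge0 => /ger0_norm ->; rewrite lerBlDr mulrDl mul1r.
  rewrite /q -[X in enorm X <= _](_ : (x - y) + ((F y - F x) + (y - F y)) = _).
    rewrite (le_trans (enormD _ _))// -[leRHS]addrA lerD2l (le_trans (enormD _ _))// lerD2r.
    by rewrite (le_trans (Fc _ _))// enormB_sym.
  by rewrite (addrC (F y - F x)) !subrKA.
(* The radius comes from (1 - c)|x| <= |x - F x| + |F 0|, with displacement at most that of 0. *)
have [||u hu] := @eclosed_min _ 0 (q 0) (enorm (F 0) * 2 / (1 - c)) cl.
- by rewrite add0e.
- move=> x; rewrite add0e lee_fin /q sub0r enormN => h.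
  rewrite ler_pdivlMr// mulrBr mulr1.
  have h1 : enorm x <= enorm (x - F x) + enorm (F x) by rewrite -{1}(subrK (F x) x) enormD.
  have h2 : enorm (F x) <= enorm (F x - F 0) + enorm (F 0) by rewrite -{1}(subrK (F 0) (F x)) enormD.
  have h3 := Fc x 0; rewrite subr0 in h3; lra.
exists u; apply/esym/eqP; rewrite -subr_eq0; apply/eqP/enorm_eq0/eqP.
rewrite eq_le enorm_ge0 andbT -(pmulr_rle0 _ c1') mulrBl mul1r subr_le0.
by have := hu (F u); rewrite !add0e lee_fin => /le_trans; apply; exact: Fc.
Qed.

End Minimization.

(** * Proximal maps, conjugates and the forward-backward characterization *)

Section Prox.
Context {R : realType} {n : nat}.
Implicit Types (h g : 'cV[R]_n -> \bar R) (x y u v : 'cV[R]_n).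

Lemma enorm_dist_lip x u v : `|enorm (x - u) - enorm (x - v)| <= 1 * enorm (u - v).
Proof.
rewrite mul1r ler_norml; apply/andP; split.
  by rewrite lerNl opprB lerBlDl (enorm_triangle u).
by rewrite lerBlDl (le_trans (enorm_triangle v _ _))// (enormB_sym v u).
Qed.

(** Let [m] be the minimum of [h] on the unit ball around [x0]. For [v] at distance d > 1, the point
    at fraction 1/d of the segment from [x0] to [v] lies in that ball, so convexity bounds [h v]
    below by c0 - d (c0 - m). This conical minorant suffices for coercivity. *)
Lemma convex_lower_bound h x0 : closed_convex_proper h -> h x0 \is a fin_num ->
  exists m A : R, 0 <= A /\ forall v, ((m - A * enorm (v - x0))%:E <= h v)%E.
Proof.
move=> [clh [cvh [hNy _]]] /fineK; set c0 := fine (h x0) => hx0.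
(* The value +oo outside the unit ball turns the constraint into bounded sublevel sets. *)
pose h1 v : \bar R := if enorm (v - x0) <= 1 then h v else +oo%E.
have h1P c v : (h1 v <= c%:E)%E -> enorm (v - x0) <= 1 /\ (h v <= c%:E)%E.
  by rewrite /h1; case: ifP.
have h1x0 : h1 x0 = c0%:E by rewrite /h1 subrr enorm0 ler01 hx0.
have clh1 : eclosed h1.
  move=> c; apply: seq_closed => zs z hz hc /=.
  have -> : h1 z = h z.
    rewrite /h1 ifT//; apply: (@cvg_enorm_le _ _ (fun j => zs j - x0)).
      by apply: (@cvgB _ 'cV[R]_n) => //; exact: cvg_cst.
    by move=> j; exact: (h1P _ _ (hc j)).1.
  apply: (closed_seq (clh c) hz (N := 0%N)) => j _; exact: (h1P _ _ (hc j)).2.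
have [||u hu] := @eclosed_min _ _ h1 x0 c0 (1 + enorm x0) clh1.
- by rewrite h1x0.
- move=> v /h1P[h2 _]; rewrite -[v](subrK x0) (le_trans (enormD _ _))//.
  by rewrite lerD2r.
have /h1P[u1 huc0] : (h1 u <= c0%:E)%E by rewrite -h1x0.
have [m hm] : exists m, h u = m%:E.
  by move: huc0 (hNy u); case: (h u) => [r| |]//; exists r.
have h1u : h1 u = m%:E by rewrite /h1 u1.
have mc0 : m <= c0 by move: huc0; rewrite hm lee_fin.
exists m, (c0 - m); split; first by rewrite subr_ge0.
move=> v; set d := enorm (v - x0); have d0 : 0 <= d := enorm_ge0 _.
have [d1|d1] := leP d 1.
  apply: (@le_trans _ _ (h1 v)); last by rewrite /h1 -/d d1.
  rewrite (le_trans _ (hu v))// h1u lee_fin gerBl mulr_ge0// subr_ge0//.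
have dgt0 : 0 < d by exact: lt_trans d1.
pose t := d^-1.
have t01 : 0 < t < 1 by rewrite invr_gt0 dgt0 invf_lt1.
have := cvh v x0 t t01; rewrite -hx0.
have hw : (m%:E <= h (t *: v + (1 - t) *: x0)%R)%E.
  have := hu (t *: v + (1 - t) *: x0); rewrite h1u /h1 ifT//.
  rewrite scalerBl scale1r addrA addrAC addrK -scalerBr enormZ -/d.
  by rewrite ger0_norm ?mulVf ?gt_eqF// invr_ge0 ltW.
move=> /(le_trans hw); case: (h v) (hNy v) => [r _| |]//=; last by rewrite leey.
rewrite -!EFinM -EFinD !lee_fin => hr.
have : d * m <= d * (t * r + (1 - t) * c0) by rewrite ler_wpM2l.
rewrite mulrDr !mulrA mulrBr mulr1 mulfV ?gt_eqF// mul1r !mulrBl mul1r; nra.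
Qed.

(** The quadratic term outgrows the conical minorant of [h], so a sublevel set of the sum is
    bounded. *)
Lemma prox_exists h x : closed_convex_proper h -> exists u, is_prox h x u.
Proof.
move=> ccp; have [clh [cvh [hNy [x0 hx0fin]]]] := ccp.
have [m [A [A0 hlow]]] := convex_lower_bound ccp hx0fin.
have hx0 := fineK hx0fin; set c0 := fine (h x0) in hx0.
pose q v := enorm (x - v) ^+ 2 / 2.
have clH : eclosed (fun v => h v + (q v)%:E)%E.
  apply: eclosed_add => // zs z hz.
  have he := lipschitz_seq_cvg (enorm_dist_lip x) hz.
  rewrite (_ : q \o zs = (fun j => (enorm (x - zs j) * enorm (x - zs j)) * 2^-1)).
    by rewrite /q expr2; apply: cvgMl; exact: cvgM.
  by apply/funext => j; rewrite /= /q expr2.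
pose c' := c0 + q x0.
pose d0 := enorm (x - x0).
pose E := c' - m + A * d0.
(* With s = |x - v|, membership in the sublevel set gives s^2 / 2 <= E + A s, hence s <= 2 A + 2
   (|E| + 1). *)
have [||u hu] := @eclosed_min _ _ _ x0 c' (enorm x + (2 * A + 2 * (`|E| + 1))) clH.
- by rewrite -hx0 -EFinD.
- move=> v hv.
  have : ((m - A * enorm (v - x0) + q v)%:E <= c'%:E)%E.
    by rewrite EFinD (le_trans _ hv)// leeD2r.
  rewrite lee_fin /q.
  have h1 : enorm (v - x0) <= enorm (x - v) + d0.
    by rewrite (le_trans (enorm_triangle x _ _))// (enormB_sym v x).
  have h2 : enorm v <= enorm x + enorm (x - v) by rewrite -{1}(subKr x v) enormB.
  have := enorm_ge0 (x - v); set s := enorm (x - v) in h1 h2 * => s0 h3.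
  suff : s <= 2 * A + 2 * (`|E| + 1) by lra.
  have h4 : s ^+ 2 / 2 <= E + A * s.
    have : A * enorm (v - x0) <= A * (s + d0) by rewrite ler_wpM2l.
    by rewrite /E mulrDr; lra.
  have h5 := ler_norm E; have h6 := normr_ge0 E.
  rewrite leNgt; apply/negP => h7.
  have h8 : s * (s / 2 - A) > s * (`|E| + 1) by rewrite ltr_pM2l; lra.
  have h9 : s * (`|E| + 1) >= 1 * (`|E| + 1) by rewrite ler_wpM2r; lra.
  by move: h8; rewrite mulrBr expr2 in h4 *; lra.
by exists u => v; exact: hu.
Qed.

(** The passage to the limit t -> 0 in the first-order optimality arguments. *)
Lemma le_scaled_le0 (a b : R) : (forall t, 0 < t < 1 -> a <= t * b) -> a <= 0.
Proof.
move=> h; rewrite leNgt; apply/negP => a0.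
have b1 : 0 < `|b| + a + 1 by rewrite ltr_wpDl// addr_ge0// ltW.
have t01 : 0 < a / (`|b| + a + 1) < 1.
  rewrite divr_gt0//= ltr_pdivrMr// mul1r.
  by have := normr_ge0 b; lra.
have := h _ t01; rewrite leNgt => /negP; apply.
rewrite mulrAC ltr_pdivrMr// ltr_pM2l//.
by have := ler_norm b; lra.
Qed.

Lemma sqr_enormB u v : enorm (u - v) ^+ 2 = enorm u ^+ 2 - 2 * dotv u v + enorm v ^+ 2.
Proof.
by rewrite !sqr_enorm !(dotvDl, dotvDr, dotvNl, dotvNr) (dotvC v u); ring.
Qed.

(** This says that x - u is a subgradient of [h] at [u]. One direction tests minimality at t v + (1
    - t) u and lets t tend to 0; the other expands the square. *)
Lemma is_proxP h x u : closed_convex_proper h ->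
  is_prox h x u <-> h u \is a fin_num /\
    forall v, (h u + (dotv (x - u) (v - u))%:E <= h v)%E.
Proof.
move=> [_ [cvh [hNy [x0 hx0]]]]; split.
  move=> hu.
  have [r hr] : exists r, h u = r%:E.
    have := hu x0; rewrite -(fineK hx0) -EFinD.
    by case: (h u) (hNy u) => [r| |]//; exists r.
  rewrite hr; split => // v; case hv : (h v) (hNy v) => [s| |]// _; last by rewrite leey.
  rewrite -EFinD lee_fin -subr_le0.
  apply: (@le_scaled_le0 _ (enorm (v - u) ^+ 2 / 2)) => t t01.
  have /andP[t0 t1] := t01.
  have := hu (t *: v + (1 - t) *: u); rewrite hr.
  have := cvh v u t t01; rewrite hr hv -!EFinM -EFinD.
  case: (h (t *: v + (1 - t) *: u)) (hNy (t *: v + (1 - t) *: u)) => [w| |]// _.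
  rewrite -!EFinD !lee_fin.
  have -> : x - (t *: v + (1 - t) *: u) = (x - u) - t *: (v - u).
    by apply/matrixP => i j; rewrite !mxE; ring.
  rewrite (sqr_enormB (x - u) (t *: _)) enormZ exprMn dotvZr real_normK ?num_real// => h1 h2.
  rewrite -(ler_pM2l t0); move: h1 h2.
  set D := dotv _ _; set a := enorm _ ^+ 2; set b := enorm _ ^+ 2 => h1 h2.
  nra.
move=> [/fineK hr hu] v; rewrite -hr; rewrite -hr in hu.
have := hu v; case: (h v) (hNy v) => [s| |]// _; last by move=> _; rewrite addye// leey.
rewrite -!EFinD !lee_fin.
have -> : x - v = (x - u) - (v - u) by rewrite opprB addrA subrK.
rewrite (sqr_enormB (x - u)); have := sqr_ge0 (enorm (v - u)); lra.
Qed.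

(** Adding the two subgradient inequalities gives |u - v|^2 <= <x - y, u - v>, and Cauchy-Schwarz
    concludes. *)
Lemma is_prox_nonexpansive h x y u v : closed_convex_proper h ->
  is_prox h x u -> is_prox h y v -> enorm (u - v) <= enorm (x - y).
Proof.
move=> ccp /(is_proxP _ _ ccp)[/fineK hu Hu] /(is_proxP _ _ ccp)[/fineK hv Hv].
have := Hu v; have := Hv u; rewrite -hu -hv -!EFinD !lee_fin.
set a := fine _; set b := fine _ => h1 h2.
have h3 : enorm (u - v) ^+ 2 <= dotv (x - y) (u - v).
  have e1 : dotv (x - u) (v - u) = - dotv (x - u) (u - v) by rewrite -dotvNr opprB.
  have e2 : dotv (x - y) (u - v) = dotv (x - u) (u - v) - dotv (y - v) (u - v) + dotv (u - v) (u - v).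
    by rewrite -dotvNl -!dotvDl; congr dotv; apply/matrixP => i j; rewrite !mxE; ring.
  rewrite sqr_enorm e2 e1 in h2 *; lra.
have [->|uv] := eqVneq (enorm (u - v)) 0; first exact: enorm_ge0.
have uv0 : 0 < enorm (u - v) by rewrite lt0r uv enorm_ge0.
by rewrite -(ler_pM2r uv0) -expr2 (le_trans h3)// dotv_enorm_le.
Qed.

Lemma is_prox_prox h x : closed_convex_proper h -> is_prox h x (prox h x).
Proof. by move=> ccp; apply: (xgetPex 0); exact: prox_exists. Qed.

Lemma is_prox_eq h x u : closed_convex_proper h -> is_prox h x u <-> u = prox h x.
Proof.
move=> ccp; split=> [hu|->]; last exact: is_prox_prox.
have := is_prox_nonexpansive ccp hu (is_prox_prox x ccp); rewrite subrr enorm0 => h0.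
by apply/eqP; rewrite -subr_eq0; apply/eqP/enorm_eq0/eqP; rewrite eq_le h0 enorm_ge0.
Qed.

Lemma closed_convex_proper_econj g : closed_convex_proper g -> closed_convex_proper (econj g).
Proof.
move=> ccp; have [_ [_ [gNy [x0 gx0]]]] := ccp; have hx0 := fineK gx0.
have le_conj y u r : g u = r%:E -> ((dotv y u - r)%:E <= econj g y)%E.
  by move=> gu; apply: ereal_sup_ubound; exists u => //; rewrite gu.
have conj_le y (c : \bar R) : (forall u r, g u = r%:E -> ((dotv y u - r)%:E <= c)%E) ->
    (econj g y <= c)%E.
  move=> hc; apply: ge_ereal_sup => _ [u _ <-].
  by case gu : (g u) (gNy u) => [r| |]// _; [exact: hc gu|rewrite leNye].
have conjNy y : econj g y != -oo%E.
  by have := le_conj y _ _ (esym hx0); case: (econj g y).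
split; [|split; [|split]] => //.
- move=> c; apply: seq_closed => ys y hy hc /=; apply: conj_le => u r gu.
  rewrite lee_fin lerBlDr.
  have hd : (fun j => dotv u (ys j)) @ \oo --> dotv u y.
    by apply: (cvg_comp _ _ hy); exact: dotv_continuous.
  rewrite dotvC; apply: (cvgr_to_le hd); apply: nearW => j.
  by rewrite dotvC -lerBlDr -lee_fin; exact: le_trans (le_conj _ _ _ gu) (hc j).
- move=> y y' t /andP[t0 t1]; apply: conj_le => u r gu.
  have := le_conj y _ _ gu; have := le_conj y' _ _ gu.
  have t1' : 0 < 1 - t by rewrite subr_gt0.
  case: (econj g y) (conjNy y) => [a| |]//; case: (econj g y') (conjNy y') => [b| |]// _ _.
  + rewrite -!EFinM -!EFinD !lee_fin dotvDl !dotvZl => h1 h2; nra.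
  + by rewrite gt0_muley// addey ?leey//.
  + by rewrite gt0_muley// addye ?leey//.
  + by rewrite !gt0_muley// addye ?leey.
(* A point where the conjugate is finite: x0 - u0 is a subgradient of [g] at the proximal point
   [u0], so the supremum is attained there. *)
- have [u0 /(is_proxP _ _ ccp)[/fineK gu0 hu0]] := prox_exists x0 ccp.
  exists (x0 - u0).
  have hle : (econj g (x0 - u0)%R <= (dotv (x0 - u0) u0 - fine (g u0))%:E)%E.
    apply: conj_le => u r gu; have := hu0 u; rewrite gu -gu0 -EFinD !lee_fin dotvDr dotvNr; lra.
  by rewrite fin_numElt ltNye conjNy/= (le_lt_trans hle)// ltry.
Qed.

Lemma closed_convex_proper_scale h (c : R) : 0 < c -> closed_convex_proper h ->
  closed_convex_proper (fun u => c%:E * h u)%E.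
Proof.
move=> c0 [clh [cvh [hNy [x0 hx0]]]]; split; [|split; [|split]].
- move=> r; rewrite (_ : [set x | _] = [set x | (h x <= (c^-1 * r)%:E)%E]) //.
  by apply/funext => x /=; rewrite EFinM lee_pdivlMl.
- move=> x y t t01; have := cvh x y t t01; have /andP[t0 t1] := t01.
  have t1' : 0 < 1 - t by rewrite subr_gt0.
  case: (h x) (hNy x) => [a| |]//; case: (h y) (hNy y) => [b| |]// _ _ h1.
  + have := h1; rewrite -(@lee_pmul2l _ c%:E)// => h2; rewrite (le_trans h2)//.
    by rewrite -!EFinM -!EFinD lee_fin; lra.
  + by rewrite !gt0_muley// addey ?leey.
  + by rewrite !gt0_muley// addye ?leey.
  + by rewrite !gt0_muley// addye ?leey.
- move=> x; case: (h x) (hNy x) => [a| |]// _; by rewrite gt0_muley.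
- by exists x0; rewrite fin_numM.
Qed.

(** Both sides say that - G y is a subgradient of [h] at [y], the factor [c] cancelling out. The
    quadratic upper bound makes [phi] first-order along t v + (1 - t) y as t -> 0; the lower bound
    gives the converse. *)
Lemma forward_backward_fixed_point (phi : 'cV[R]_n -> R) (G : 'cV[R]_n -> 'cV[R]_n) h b c y :
  0 < c -> closed_convex_proper h ->
  (forall y v, phi y + dotv (G y) (v - y) <= phi v) ->
  (forall y v, phi v <= phi y + dotv (G y) (v - y) + b * enorm (v - y) ^+ 2) ->
  (forall v, ((phi y)%:E + h y <= (phi v)%:E + h v)%E) <->
  y = prox (fun u => c%:E * h u)%E (y - c *: G y).
Proof.
move=> c0 ccp hlo hup; have ccp' := closed_convex_proper_scale c0 ccp.
rewrite -(is_prox_eq _ _ ccp') (is_proxP _ _ ccp').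
have [_ [cvh [hNy [x0 hx0]]]] := ccp.
have dE v : dotv (y - c *: G y - y) (v - y) = - (c * dotv (G y) (v - y)).
  by rewrite addrAC subrr add0r dotvNl dotvZl.
split.
  move=> hy.
  have [r hr] : exists r, h y = r%:E.
    have := hy x0; rewrite -(fineK hx0) -EFinD.
    by case: (h y) (hNy y) => [r| |]//; exists r.
  rewrite hr; split => // v; case hv : (h v) (hNy v) => [s| |]// _; last by rewrite gt0_muley// leey.
  rewrite -!EFinM -EFinD lee_fin dE -mulrBr ler_pM2l// -subr_le0.
  apply: (@le_scaled_le0 _ (b * enorm (v - y) ^+ 2)) => t t01.
  have /andP[t0 t1] := t01.
  have := hy (t *: v + (1 - t) *: y); rewrite hr.
  have := cvh v y t t01; rewrite hr hv -!EFinM -EFinD.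
  case: (h (t *: v + (1 - t) *: y)) (hNy (t *: v + (1 - t) *: y)) => [w| |]// _.
  rewrite -!EFinD !lee_fin.
  have := hup y (t *: v + (1 - t) *: y).
  have -> : t *: v + (1 - t) *: y - y = t *: (v - y).
    by apply/matrixP => i j; rewrite !mxE; ring.
  rewrite dotvZr enormZ exprMn real_normK ?num_real// => h1 h2 h3.
  rewrite -(ler_pM2l t0); move: h1 h2 h3.
  set D := dotv _ _; set a := enorm _ ^+ 2; set P := phi (_ + _) => h1 h2 h3.
  nra.
move=> [hyfin hy] v.
have [r hr] : exists r, h y = r%:E.
  by case: (h y) (hNy y) hyfin => [r| |]//; [exists r|rewrite gt0_muley].
have := hy v; rewrite hr; case: (h v) (hNy v) => [s| |]// _; last by rewrite addey ?leey.
rewrite -!EFinM -!EFinD !lee_fin dE -mulrBr ler_pM2l//.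
by have := hlo y v; lra.
Qed.

End Prox.

(** * Consequences of quadratic bounds *)

Section QuadraticBounds.
Context {R : realType} {n : nat}.

Lemma quadratic_differentiable (h : 'cV[R]_n -> R) y x C :
  (forall v, `|h v - h y - dotv x (v - y)| <= C * enorm (v - y) ^+ 2) ->
  differentiable h y /\ grad h y = x.
Proof.
move=> hC; apply: grad_eps_differentiable => e e0.
have C1 : 0 < `|C| + 1 by rewrite ltr_wpDl.
exists (e / (`|C| + 1)); first exact: divr_gt0.
move=> v; rewrite ltr_pdivlMr// => hv; have := hC (y + v); rewrite (addrAC y) subrr add0r.
move=> /le_trans; apply; rewrite expr2 mulrA ler_wpM2r ?enorm_ge0//.
apply: le_trans (ltW hv); rewrite mulrC ler_wpM2l ?enorm_ge0//.
by rewrite (le_trans (ler_norm _))// lerDl.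
Qed.

(** The lower model based at the convex combination [w] is evaluated at [x] and at [y]; in the
    weighted average the linear terms cancel. *)
Lemma strongly_convex_lower (h : 'cV[R]_n -> R) (G : 'cV[R]_n -> 'cV[R]_n) mu :
  (forall y v, h y + dotv (G y) (v - y) + mu / 2 * enorm (v - y) ^+ 2 <= h v) ->
  strongly_convex mu h.
Proof.
move=> hG x y t /andP[t0 t1]; set w := t *: x + (1 - t) *: y.
have := hG w x; have := hG w y.
have -> : y - w = - t *: (x - y) by apply/matrixP => i j; rewrite !mxE; ring.
have -> : x - w = (1 - t) *: (x - y) by apply/matrixP => i j; rewrite !mxE; ring.
rewrite !dotvZr !enormZ !exprMn !real_normK ?num_real// sqrrN.
move: (h w) (h x) (h y) (dotv _ _) (enorm _ ^+ 2) => a b c d e h1 h2.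
have t1' : 0 <= 1 - t by rewrite subr_ge0.
have := ler_wpM2l t0 h2; have := ler_wpM2l t1' h1; nra.
Qed.

End QuadraticBounds.

(** * Smooth strongly convex functions and their conjugates *)

Section SmoothStronglyConvex.
Context {R : realType} {n : nat}.
Variables (f : 'cV[R]_n -> R) (alpha beta : R).
Hypotheses (alpha0 : 0 < alpha) (alpha_beta : alpha <= beta).
Hypotheses (df : forall x, differentiable f x) (scf : strongly_convex alpha f)
  (lipf : lipschitz_with beta (grad f)).

Let beta0 : 0 < beta. Proof. exact: lt_le_trans alpha_beta. Qed.

(** Strong convexity between [x] and [y] at a small weight [t] is compared with the first-order
    expansion at [x], then divided by [t]. *)
Lemma gradient_lower_bound x y :
  f x + dotv (grad f x) (y - x) + alpha / 2 * enorm (y - x) ^+ 2 <= f y.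
Proof.
apply/ler_addgt0Pr => e e0; set d := y - x; set a := enorm d.
have a0 : 0 <= a := enorm_ge0 d.
have a1 : 0 < a + 1 by rewrite ltr_wpDl.
have e20 : 0 < e / 2 by rewrite divr_gt0.
have [r r0 hr] := differentiable_grad_eps (df x) (divr_gt0 e20 a1).
pose k := alpha / 2 * a ^+ 2.
have k0 : 0 <= k by rewrite mulr_ge0 ?sqr_ge0// divr_ge0// ltW.
(* Small enough to be a convex weight, to stay within the radius of the expansion, and to make the
   second-order term [t * k] at most [e / 2]. *)
pose t := Num.min (Num.min (1 / 2) (r / (a + 1) / 2)) (e / 2 / (k + 1)).
have k1 : 0 < k + 1 by rewrite ltr_wpDl.
have t0 : 0 < t by rewrite !lt_min !divr_gt0.
have t1 : t <= 1 / 2 by rewrite !ge_min lexx.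
have tr : t * (a + 1) <= r / 2.
  have : t <= r / (a + 1) / 2 by rewrite !ge_min lexx ?orbT.
  by rewrite mulrAC ler_pdivlMr.
have tk : t * (k + 1) <= e / 2.
  by rewrite -ler_pdivlMr// !ge_min lexx ?orbT.
have hd : enorm (t *: d) < r by rewrite enormZ gtr0_norm// -/a; lra.
have := hr _ hd; rewrite dotvZr enormZ (gtr0_norm t0) -/a ler_norml => /andP[h1 _].
have t01 : 0 <= t <= 1 by apply/andP; split; lra.
have := scf y x t01.
have -> : t *: y + (1 - t) *: x = x + t *: d by apply/matrixP => i j; rewrite !mxE; ring.
rewrite -/d -/a => h2.
have h3 : e / 2 / (a + 1) * (t * a) <= t * (e / 2).
  by rewrite mulrCA ler_wpM2l ?(ltW t0)// mulrAC ler_pdivrMr// ler_wpM2l ?(ltW e20)// lerDl.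
have h4 : t * (t * k) <= t * (e / 2) by rewrite ler_wpM2l ?(ltW t0)//; lra.
rewrite -(ler_pM2l t0); have := h2; rewrite (_ : alpha / 2 * t * (1 - t) * a ^+ 2 = t * k - t * (t * k)); last first.
  by rewrite /k; ring.
rewrite -/k; move: h1 h3 h4; move: (f (x + _)) (f x) (f y) (dotv _ _) (_ / _ * _) => A B C D E h1 h3 h4 h5.
rewrite !mulrDr; lra.
Qed.

Lemma gradient_monotone x y :
  alpha * enorm (x - y) ^+ 2 <= dotv (grad f x - grad f y) (x - y).
Proof.
have := gradient_lower_bound x y; have := gradient_lower_bound y x.
move: (grad f x) (grad f y) (f x) (f y) => u v a b.
rewrite (enormB_sym y x) dotvDl dotvNl -(opprB x y) dotvNr.
move: (dotv u _) (dotv v _) (enorm _ ^+ 2) => c d e; lra.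
Qed.

(* Halving the segment improves the constant c in front of beta |d|^2 to c / 2 + 1 / 4,
   whose iterates tend to 1 / 2. *)
Lemma gradient_upper_bound_iter k x d :
  f (x + d) <= f x + dotv (grad f x) d + (2^-1 + 2^-1 ^+ k.+1) * (beta * enorm d ^+ 2).
Proof.
have hgrad x1 d1 v : dotv (grad f (x1 + d1) - grad f x1) v <= beta * enorm d1 * enorm v.
  rewrite (le_trans (dotv_enorm_le _ _))// ler_wpM2r ?enorm_ge0//.
  by rewrite (le_trans (lipf _ _))// addrAC subrr add0r.
elim: k x d => [|k ih] x d.
  (* At stage 0 the constant is 1: convexity based at [x + d], then the Lipschitz bound on the
     gradient. *)
  have := gradient_lower_bound (x + d) x; have := hgrad x d d.
  move: (grad f x) (grad f (x + d)) => u v; rewrite opprD addrA subrr add0r.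
  rewrite dotvNr enormN dotvDl dotvNl -mulrA -expr2 expr1.
  have : 0 <= alpha / 2 * enorm d ^+ 2 by rewrite mulr_ge0 ?sqr_ge0// divr_ge0// ltW.
  move: (beta * _) (alpha / 2 * _) (f _) (f _) (dotv _ _) (dotv _ _) => B A a b c d'; lra.
pose d2 := 2^-1 *: d.
have dE : x + d = (x + d2) + d2 by rewrite -addrA -scalerDl [X in X *: _](_ : _ = 1) ?scale1r//; lra.
rewrite dE; have := ih (x + d2) d2; have := ih x d2; have := hgrad x d2 d2.
move: (grad f x) (grad f (x + d2)) => u v.
have -> : dotv u d = 2 * dotv u d2 by rewrite dotvZr mulrA mulfV ?mul1r.
rewrite dotvDl dotvNl -mulrA -expr2 [2^-1 ^+ k.+2]exprS.
have -> : enorm d2 ^+ 2 = 4^-1 * enorm d ^+ 2.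
  by rewrite enormZ exprMn ger0_norm ?invr_ge0// expr2 -invfM -natrM.
rewrite (mulrCA beta).
move: (f _) (f _) (f _) (dotv _ _) (dotv _ _) (beta * _) (2^-1 ^+ k.+1) => A B C D E X q; lra.
Qed.

(** The limit of the iterated bounds, with 2^-(k+1) <= 1/(k+1); halving stands in for integrating
    the gradient along the segment. *)
Lemma gradient_upper_bound x d :
  f (x + d) <= f x + dotv (grad f x) d + beta / 2 * enorm d ^+ 2.
Proof.
apply/ler_addgt0Pr => e e0; set B := beta * enorm d ^+ 2.
have B0 : 0 <= B by rewrite mulr_ge0 ?sqr_ge0// ltW.
have B1 : 0 < B + 1 by rewrite ltr_wpDl.
have [k hk] := inv_succ_lt (divr_gt0 e0 B1).
rewrite (le_trans (gradient_upper_bound_iter k x d))// -[leRHS]addrA lerD2l -/B mulrDl.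
rewrite [beta / 2]mulrC -mulrA -/B lerD2l.
have : 2^-1 ^+ k.+1 <= k.+1%:R^-1 :> R.
  by rewrite exprVn lef_pV2 ?posrE ?exprn_gt0// -natrX ler_nat ltnW// ltn_expl.
have := ltW (hk k (leqnn k)); rewrite ler_pdivlMr// => h1 h2.
rewrite (le_trans (ler_wpM2r B0 h2))// (le_trans _ h1)// ler_wpM2l// ?invr_ge0//.
by rewrite lerDl.
Qed.

(** A solution is a fixed point of x - tau (grad f x - z). The step tau = alpha / beta^2 minimizes
    the squared factor 1 - 2 alpha tau + beta^2 tau^2, which becomes 1 - alpha tau. *)
Lemma gradient_surjective z : exists x, grad f x = z.
Proof.
pose tau := alpha / beta ^+ 2; pose F x := x - tau *: (grad f x - z).
have b20 : 0 < beta ^+ 2 by rewrite exprn_gt0.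
have tau0 : 0 < tau by rewrite divr_gt0.
pose c2 := 1 - alpha * tau.
have at1 : alpha * tau <= 1.
  by rewrite /tau mulrA ler_pdivrMr// mul1r -expr2 ler_pXn2r// nnegrE ltW.
have c20 : 0 <= c2 by rewrite subr_ge0.
have [||x hx] := @enorm_fixed_point _ _ F (Num.sqrt c2).
- rewrite sqrtr_ge0/= -[X in _ < X](@sqrtr1 R) ltr_sqrt// gtrDl oppr_lt0 mulr_gt0//.
- move=> x y; apply: enorm_le_sqr; first by rewrite mulr_ge0 ?sqrtr_ge0 ?enorm_ge0.
  rewrite exprMn sqr_sqrtr// -sqr_enorm.
  have -> : F x - F y = (x - y) - tau *: (grad f x - grad f y).
    rewrite /F; move: (grad f x) (grad f y) => u v.
    by apply/matrixP => i j; rewrite !mxE; ring.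
  have h1 := gradient_monotone x y; have := lipf x y.
  move: (grad f x - grad f y) h1 => u h1 hu; rewrite dotvC in h1.
  rewrite (sqr_enormB (x - y)) enormZ exprMn real_normK ?num_real// dotvZr.
  have h2 : enorm u ^+ 2 <= beta ^+ 2 * enorm (x - y) ^+ 2.
    by rewrite -exprMn ler_pXn2r ?nnegrE ?mulr_ge0 ?enorm_ge0 ?(ltW beta0).
  have h3 : tau ^+ 2 * enorm u ^+ 2 <= alpha * tau * enorm (x - y) ^+ 2.
    rewrite (le_trans (ler_wpM2l (sqr_ge0 _) h2))// mulrA ler_wpM2r ?sqr_ge0//.
    by rewrite expr2 -mulrA (mulrC alpha) ler_wpM2l ?(ltW tau0)// /tau divfK ?gt_eqF.
  have h4 := ler_wpM2l (ltW tau0) h1.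
  rewrite mulrA (mulrC tau alpha) in h4; rewrite /c2 mulrBl mul1r; move: h3 h4.
  move: (tau ^+ 2 * _) (alpha * tau * _) (dotv _ _) => A B C; lra.
exists x; move: hx; rewrite /F; move: (grad f x) => u /eqP.
rewrite -subr_eq0 addrAC subrr add0r oppr_eq0 scaler_eq0 gt_eqF//= subr_eq0.
by move/eqP.
Qed.

(** Turns out to be the gradient of the conjugate; the default 0 is never taken, by surjectivity of
    the gradient. *)
Definition grad_inv z := xget 0 [set x | grad f x = z].

Lemma grad_invK z : grad f (grad_inv z) = z.
Proof. exact: (xgetPex 0 (gradient_surjective z)). Qed.

(** The supremum is attained where the gradient of [f] equals [z], because [f] lies above its
    tangent there. *)
Lemma fconjE z : fconj f z = (dotv z (grad_inv z) - f (grad_inv z))%:E.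
Proof.
apply/eqP; rewrite eq_le; apply/andP; split.
  apply: ge_ereal_sup => _ [u _ <-]; rewrite lee_fin.
  have := gradient_lower_bound (grad_inv z) u; rewrite grad_invK.
  have : 0 <= alpha / 2 * enorm (u - grad_inv z) ^+ 2.
    by rewrite mulr_ge0 ?sqr_ge0// divr_ge0// ltW.
  move: (grad_inv z) => x; rewrite dotvDr dotvNr.
  move: (dotv _ _) (dotv _ _) (alpha / 2 * _) (f _) (f _) => A B C D E; lra.
by apply: ereal_sup_ubound; exists (grad_inv z).
Qed.

Lemma fconj_ge z u : dotv z u - f u <= fine (fconj f z).
Proof. by rewrite -lee_fin fineK ?fconjE//; rewrite -fconjE; apply: ereal_sup_ubound; exists u. Qed.

Lemma grad_inv_lipschitz z z' :
  enorm (grad_inv z - grad_inv z') <= alpha^-1 * enorm (z - z').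
Proof.
have := gradient_monotone (grad_inv z) (grad_inv z'); rewrite !grad_invK.
move=> /le_trans /(_ (dotv_enorm_le _ _)); set a := enorm (_ - grad_inv _).
have [->|a0] := eqVneq a 0; first by rewrite mulr_ge0 ?invr_ge0 ?enorm_ge0 ?(ltW alpha0).
have a0' : 0 < a by rewrite lt0r a0 enorm_ge0.
by rewrite expr2 mulrA ler_pM2r// ler_pdivlMl.
Qed.

Lemma fconj_lower z z' : fine (fconj f z) + dotv (grad_inv z) (z' - z) +
  beta^-1 / 2 * enorm (z' - z) ^+ 2 <= fine (fconj f z').
Proof.
(* This test point maximizes <z', u> minus the quadratic upper model of [f] at [grad_inv z]. *)
apply: le_trans (fconj_ge z' (grad_inv z + beta^-1 *: (z' - z))).
rewrite fconjE/=; have := gradient_upper_bound (grad_inv z) (beta^-1 *: (z' - z)).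
rewrite grad_invK; move: (grad_inv z) => x.
rewrite (dotvDr x (_ *: _) z') !dotvZr enormZ exprMn real_normK ?num_real//.
rewrite (dotvDr z' (- z) x) dotvNr (dotvC x z') (dotvC x z).
have -> : beta / 2 * (beta^-1 ^+ 2 * enorm (z' - z) ^+ 2) = beta^-1 / 2 * enorm (z' - z) ^+ 2.
  by field; rewrite gt_eqF.
have : beta^-1 * dotv z' (z' - z) - beta^-1 * dotv z (z' - z) = beta^-1 * enorm (z' - z) ^+ 2.
  by rewrite -mulrBr sqr_enorm [in RHS]dotvDl dotvNl.
move: (f (x + _)) (f x) => A B.
move: (dotv z' x) (dotv z x) (dotv z' _) (dotv z _) (_ ^+ 2) beta^-1 => a b c d e bi; lra.
Qed.

Lemma fconj_upper z z' : fine (fconj f z') <= fine (fconj f z) + dotv (grad_inv z) (z' - z) +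
  alpha^-1 / 2 * enorm (z' - z) ^+ 2.
Proof.
rewrite !fconjE/=; have := gradient_lower_bound (grad_inv z) (grad_inv z').
rewrite grad_invK; move: (grad_inv z) (grad_inv z') => x x'.
(* Completing the square bounds <x' - x, z' - z> - alpha/2 |x' - x|^2 by |z' - z|^2 / (2 alpha). *)
have := dotv_ge0 (alpha *: (x' - x) - (z' - z)).
rewrite -sqr_enorm (sqr_enormB (alpha *: _)) enormZ exprMn real_normK ?num_real// dotvZl.
have : dotv (x' - x) (z' - z) = dotv z' x' - dotv z x' - dotv x (z' - z).
  by rewrite (dotvDl x') dotvNl (dotvDr z' (- z) x') dotvNr !(dotvC x').
rewrite (dotvDr x' (- x) z) dotvNr.
set a := dotv z' x'; set b := dotv z x'; set c := dotv z x; set d := dotv x (z' - z).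
set e := dotv (x' - x) _; set P := enorm (x' - x) ^+ 2; set Q := enorm (z' - z) ^+ 2.
move=> eE h1 h2.
have h3 : 0 <= alpha^-1 / 2 * (alpha ^+ 2 * P - 2 * (alpha * e) + Q).
  by rewrite mulr_ge0// divr_ge0// invr_ge0 ltW.
have h4 : alpha^-1 / 2 * (alpha ^+ 2 * P - 2 * (alpha * e) + Q) = alpha / 2 * P - e + alpha^-1 / 2 * Q.
  by field; rewrite gt_eqF.
rewrite h4 in h3; move: eE h2 h3; clear.
move: (f x) (f x') (alpha / 2 * P) (alpha^-1 / 2 * Q) => fx fx' p q; lra.
Qed.

Lemma fconj_differentiable z :
  differentiable (fun z => fine (fconj f z)) z /\
  grad (fun z => fine (fconj f z)) z = grad_inv z.
Proof.
apply: (@quadratic_differentiable _ _ _ _ _ (alpha^-1 / 2)) => v.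
have := fconj_lower z v; have := fconj_upper z v.
have : 0 <= beta^-1 / 2 * enorm (v - z) ^+ 2.
  by rewrite mulr_ge0 ?sqr_ge0// divr_ge0// invr_ge0 ltW.
have : 0 <= alpha^-1 / 2 * enorm (v - z) ^+ 2.
  by rewrite mulr_ge0 ?sqr_ge0// divr_ge0// invr_ge0 ltW.
move: (fine _) (fine _) (dotv _ _) (_ * _) (_ * _) => A B C D E.
by move=> h0 h1 h2 h3; rewrite ler_norml; apply/andP; split; lra.
Qed.

End SmoothStronglyConvex.

(** * Extreme eigenvalues and singular values *)

Section SingularValues.
Context {R : realType}.

(* The quadratic form of A - mu is nonnegative and vanishes at the minimizer y on the sphere,
   hence its polar form vanishes at y. *)
Lemma rayleigh_min n (A : 'M[R]_n) (y0 : 'cV[R]_n) : A^T = A -> y0 != 0 ->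
  exists mu y, [/\ enorm y = 1, A *m y = mu *: y &
    forall v, mu * enorm v ^+ 2 <= dotv v (A *m v)].
Proof.
move=> AT y00; pose q v := dotv v (A *m v).
have qcvg (zs : nat -> 'cV[R]_n) (z : 'cV[R]_n) : zs @ \oo --> z -> q \o zs @ \oo --> q z.
  move=> hz; have /mx_cvgP/(_ ord0 ord0) : (fun j => (zs j)^T *m (A *m zs j)) @ \oo --> z^T *m (A *m z).
    apply: cvg_mulmx; last by apply: cvg_mulmx => //; exact: cvg_cst.
    by apply/mx_cvgP => i j; rewrite mxE; under eq_fun do rewrite mxE; exact: ((mx_cvgP _ _).1 hz).
  have <- : q \o zs = (fun j => ((zs j)^T *m (A *m zs j)) ord0 ord0).
    by apply/funext => j; rewrite -dotvE.
  by rewrite -dotvE.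
(* The quadratic form restricted to the unit sphere, with +oo elsewhere, has closed and bounded real
   sublevel sets. *)
pose h v : \bar R := if enorm v == 1 then (q v)%:E else +oo%E.
have hP c v : (h v <= c%:E)%E -> enorm v = 1 /\ q v <= c.
  by rewrite /h; case: ifP => // /eqP ->; rewrite lee_fin.
have hE v : enorm v = 1 -> h v = (q v)%:E by move=> v1; rewrite /h v1 eqxx.
have clh : eclosed h.
  move=> c; apply: seq_closed => zs z hz hc /=.
  have z1 : enorm z = 1.
    have h1 := @lipschitz_seq_cvg _ _ (@enorm R n) 1 _ zs z hz.
    have {}h1 : (fun j => enorm (zs j)) @ \oo --> enorm z.
      apply: h1 => x y; have := enorm_dist_lip 0 x y; rewrite !sub0r !enormN//.
    have h2 : (fun j => enorm (zs j)) @ \oo --> (1 : R).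
      rewrite (_ : (fun j => _) = fun=> 1); first exact: cvg_cst.
      by apply/funext => j; exact: (hP _ _ (hc j)).1.
    exact: (cvg_unique (@norm_hausdorff _ R) h1 h2).
  rewrite hE// lee_fin; apply: (cvgr_to_le (qcvg _ _ hz)); apply: nearW => j.
  exact: (hP _ _ (hc j)).2.
have ny0 : 0 < enorm y0.
  by rewrite lt0r enorm_ge0 andbT; apply: contra y00 => /eqP/enorm_eq0 ->.
pose y1 := (enorm y0)^-1 *: y0.
have y11 : enorm y1 = 1.
  by rewrite enormZ ger0_norm ?invr_ge0 ?enorm_ge0// mulVf ?gt_eqF.
have [||y hy] := @eclosed_min _ _ h y1 (q y1) 1 clh.
- by rewrite hE.
- by move=> v /hP[->].
have [y1' _] : enorm y = 1 /\ q y <= q y1 by apply: hP; rewrite -hE.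
pose mu := q y.
have muq v : mu * enorm v ^+ 2 <= q v.
  have [->|v0] := eqVneq v 0; first by rewrite enorm0 expr0n mulr0 /q dotv0l.
  have nv : 0 < enorm v.
    by rewrite lt0r enorm_ge0 andbT; apply: contra v0 => /eqP/enorm_eq0 ->.
  have v1 : enorm ((enorm v)^-1 *: v) = 1.
    by rewrite enormZ ger0_norm ?invr_ge0 ?enorm_ge0// mulVf ?gt_eqF.
  have := hy ((enorm v)^-1 *: v); rewrite !hE// lee_fin /q -scalemxAr dotvZl dotvZr mulrA -invfM -expr2.
  by rewrite mulrC ler_pdivlMr// exprn_gt0.
exists mu, y; split => //.
have sym v w : dotv v (A *m w) = dotv w (A *m v) by rewrite -{1}AT -dotv_trmx dotvC.
(* Nonnegativity at y + t v reads 0 <= 2 t (polar term) + t^2 (form at v); dividing by t and letting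
   t -> 0 leaves the polar term. The vectors w and - w then give equality. *)
have polar v : 0 <= dotv v (A *m y) - mu * dotv v y.
  rewrite -oppr_le0.
  apply: (@le_scaled_le0 _ _ ((q v - mu * enorm v ^+ 2) / 2)) => t /andP[t0 _].
  have := muq (y + t *: v); rewrite sqr_enorm /q mulmxDr -scalemxAr.
  rewrite !(dotvDl, dotvDr, dotvZl, dotvZr) -!sqr_enorm y1' expr1n (sym y v) (dotvC y v) -/(q y) -/(q v) -/mu.
  move=> hyp; rewrite -(ler_pM2l t0); move: hyp; rewrite /mu.
  move: (dotv v (A *m y)) (dotv v y) (q v) (enorm v ^+ 2) (q y) => a b c d e; clear; lra.
apply: dotv_inj => w; rewrite dotvZr; apply/eqP; rewrite -subr_eq0 eq_le polar andbT.
by have := polar (- w); rewrite !dotvNl mulrN -opprD oppr_ge0.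
Qed.

(** [eigenvalue] is defined by row vectors; symmetry allows the column eigenvector to be
    transposed. *)
Lemma eigenvalue_symmetric n (A : 'M[R]_n) mu (y : 'cV[R]_n) : A^T = A -> enorm y = 1 ->
  A *m y = mu *: y -> eigenvalue A mu.
Proof.
move=> AT y1 Ay; apply/eigenvalueP; exists y^T.
  by rewrite -{1}AT -trmx_mul Ay linearZ.
apply/eqP => /(congr1 trmx); rewrite trmxK trmx0 => y0.
by move: y1; rewrite y0 enorm0 => /esym/eqP; rewrite oner_eq0.
Qed.

(** The Rayleigh argument for K K^T and for its opposite yields eigenvalues bounding the form |K^T
    y|^2 from below and above, and their square roots are singular values. *)
Lemma singular_value_bounds m n (K : 'M[R]_(m, n)) (lam lamb : R) : 0 < lam -> 
  (forall y : 'cV[R]_m, exists x : 'cV[R]_n, K *m x = y) ->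
  (forall s, singular_value K s -> lam <= s <= lamb) ->
  forall y, lam ^+ 2 * enorm y ^+ 2 <= enorm (K^T *m y) ^+ 2 <= lamb ^+ 2 * enorm y ^+ 2.
Proof.
move=> lam0 surj hs y.
have [->|y0] := eqVneq y 0; first by rewrite mulmx0 !enorm0 expr0n !mulr0 lexx.
(* A right inverse of [K] forces m <= n, which selects K K^T in the definition of singular
   values. *)
have mn : (m <= n)%N.
  have [X hX] := choice surj.
  apply: (@mulmx1_min _ _ _ K (\matrix_(i, j) X (delta_mx j ord0) i ord0)).
  apply/matrixP => i j; have /matrixP/(_ i ord0) := hX (delta_mx j ord0).
  rewrite !mxE eqxx andbT => <-; apply: eq_bigr => l _; by rewrite !mxE.
pose A := K *m K^T.
have AT : A^T = A by rewrite trmx_mul trmxK.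
have qA v : dotv v (A *m v) = enorm (K^T *m v) ^+ 2.
  by rewrite -mulmxA dotvC dotv_trmx sqr_enorm.
have eig mu v : enorm v = 1 -> A *m v = mu *: v -> lam ^+ 2 <= mu <= lamb ^+ 2.
  move=> v1 Av; have mu0 : 0 <= mu.
    have := qA v; rewrite Av dotvZr -sqr_enorm v1 expr1n mulr1 => ->; exact: sqr_ge0.
  have /hs/andP[h1 h2] : singular_value K (Num.sqrt mu).
    by split; [exact: sqrtr_ge0|rewrite mn sqr_sqrtr//; exact: eigenvalue_symmetric Av].
  by rewrite -(sqr_sqrtr mu0) !ler_pXn2r ?nnegrE ?sqrtr_ge0 ?(ltW lam0)// ?h1 ?h2// (le_trans (ltW lam0))// (le_trans h1).
apply/andP; split.
  have [mu [v [v1 Av hmu]]] := rayleigh_min AT y0.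
  have /andP[h1 _] := eig _ _ v1 Av.
  by rewrite -qA (le_trans _ (hmu y))// ler_wpM2r ?sqr_ge0.
have NAT : (- A)^T = - A by rewrite linearN/= AT.
have [mu [v [v1 Av hmu]]] := rayleigh_min NAT y0.
have Av' : A *m v = (- mu) *: v by rewrite scaleNr -Av mulNmx opprK.
have /andP[_ h2] := eig _ _ v1 Av'.
have := hmu y; rewrite mulNmx dotvNr qA lerNr -mulNr => /le_trans; apply.
by rewrite ler_wpM2r ?sqr_ge0.
Qed.

(** From |K x|^2 = <x, K^T K x> <= |x| c |K x|. *)
Lemma mulmx_le_of_trmx m n (K : 'M[R]_(m, n)) (c : R) : 0 <= c ->
  (forall y, enorm (K^T *m y) <= c * enorm y) -> forall x, enorm (K *m x) <= c * enorm x.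
Proof.
move=> c0 hc x; have [->|x0] := eqVneq (enorm (K *m x)) 0; first by rewrite mulr_ge0 ?enorm_ge0.
have nx : 0 < enorm (K *m x) by rewrite lt0r x0 enorm_ge0.
rewrite -(ler_pM2l nx) -expr2 sqr_enorm dotv_trmx (le_trans (dotv_enorm_le _ _))//.
by rewrite mulrC [leRHS]mulrCA mulrA ler_wpM2r ?enorm_ge0.
Qed.

End SingularValues.

(** * The smooth part of the dual objective *)

Section DualSmoothPart.
Context {R : realType} {m n : nat}.
Variables (f : 'cV[R]_n -> R) (alpha beta lam lamb : R) (K : 'M[R]_(m, n)).
Hypotheses (alpha0 : 0 < alpha) (alpha_beta : alpha <= beta) (lam0 : 0 < lam)
  (lam_lamb : lam <= lamb).
Hypotheses (df : forall x, differentiable f x) (scf : strongly_convex alpha f)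
  (lipf : lipschitz_with beta (grad f)).
Hypotheses (surjK : forall y : 'cV[R]_m, exists x : 'cV[R]_n, K *m x = y)
  (svK : forall s, singular_value K s -> lam <= s <= lamb).

Let phi y := fine (fconj f (- K^T *m y)).
Let G y := - (K *m grad_inv f (- K^T *m y)).

Let beta0 : 0 < beta. Proof. exact: lt_le_trans alpha_beta. Qed.
Let lamb0 : 0 < lamb. Proof. exact: lt_le_trans lam_lamb. Qed.

Let KT_diff (y v : 'cV[R]_m) : - K^T *m v - - K^T *m y = - (K^T *m (v - y)).
Proof. by rewrite -mulmxBr mulNmx. Qed.

Let dotv_KT (y v : 'cV[R]_m) : dotv (grad_inv f (- K^T *m y)) (- (K^T *m (v - y))) = dotv (G y) (v - y).
Proof. by rewrite /G; move: (grad_inv _ _) => x; rewrite dotvNr dotvNl -dotv_trmx. Qed.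

(** The lower model of the conjugate is composed with - K^T, and |K^T v| >= lam |v| keeps the
    quadratic term. *)
Lemma dual_lower y v :
  phi y + dotv (G y) (v - y) + lam ^+ 2 / beta / 2 * enorm (v - y) ^+ 2 <= phi v.
Proof.
have := fconj_lower alpha0 alpha_beta df scf lipf (- K^T *m y) (- K^T *m v).
rewrite KT_diff dotv_KT enormN => /(le_trans _); apply; rewrite lerD2l.
have /andP[h _] := singular_value_bounds lam0 surjK svK (v - y).
rewrite (_ : lam ^+ 2 / beta / 2 * _ = beta^-1 / 2 * (lam ^+ 2 * enorm (v - y) ^+ 2)).
  by rewrite ler_wpM2l// divr_ge0// invr_ge0 ltW.
by rewrite [RHS]mulrA; congr (_ * _); rewrite [RHS]mulrC mulrA.
Qed.

Lemma dual_upper y v :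
  phi v <= phi y + dotv (G y) (v - y) + lamb ^+ 2 / alpha / 2 * enorm (v - y) ^+ 2.
Proof.
have := fconj_upper alpha0 alpha_beta df scf lipf (- K^T *m y) (- K^T *m v).
rewrite KT_diff dotv_KT enormN => /le_trans; apply; rewrite lerD2l.
have /andP[_ h] := singular_value_bounds lam0 surjK svK (v - y).
rewrite (_ : lamb ^+ 2 / alpha / 2 * _ = alpha^-1 / 2 * (lamb ^+ 2 * enorm (v - y) ^+ 2)).
  by rewrite ler_wpM2l// divr_ge0// invr_ge0 ltW.
by rewrite [RHS]mulrA; congr (_ * _); rewrite [RHS]mulrC mulrA.
Qed.

Lemma dual_differentiable y : differentiable phi y /\ grad phi y = G y.
Proof.
apply: (@quadratic_differentiable _ _ _ _ _ (lamb ^+ 2 / alpha / 2)) => v.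
have := dual_lower y v; have := dual_upper y v.
have : 0 <= lam ^+ 2 / beta / 2 * enorm (v - y) ^+ 2.
  by rewrite mulr_ge0 ?sqr_ge0// !divr_ge0// ?sqr_ge0// ltW.
have : 0 <= lamb ^+ 2 / alpha / 2 * enorm (v - y) ^+ 2.
  by rewrite mulr_ge0 ?sqr_ge0// !divr_ge0// ?sqr_ge0// ltW.
move: (phi _) (phi _) (dotv _ _) (_ * _) (_ * _) => A B C D E.
by move=> h0 h1 h2 h3; rewrite ler_norml; apply/andP; split; lra.
Qed.

(** [K] inherits the norm bound of its transpose, so the constants lamb, 1 / alpha and lamb of the
    three factors multiply. *)
Lemma dual_gradient_lipschitz : lipschitz_with (lamb ^+ 2 / alpha) (grad phi).
Proof.
have KT y : enorm (K^T *m y) <= lamb * enorm y.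
  have /andP[_ h] := singular_value_bounds lam0 surjK svK y.
  rewrite -(ler_pXn2r (n := 2))// ?nnegrE ?enorm_ge0// ?mulr_ge0 ?enorm_ge0 ?(ltW lamb0)//.
  by rewrite exprMn.
move=> x y; rewrite (dual_differentiable x).2 (dual_differentiable y).2.
rewrite /G -opprD enormN -mulmxBr.
rewrite (le_trans (mulmx_le_of_trmx (ltW lamb0) KT _))//.
rewrite (le_trans (ler_wpM2l (ltW lamb0) (grad_inv_lipschitz alpha0 alpha_beta df scf lipf _ _)))//.
rewrite KT_diff enormN.
rewrite -[leRHS]mulrA [leRHS]mulrC expr2 mulrA.
have -> : alpha^-1 * enorm (x - y) * (lamb * lamb) = lamb / alpha * (lamb * enorm (x - y)) by ring.
by rewrite ler_wpM2l// divr_ge0// ltW.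
Qed.

Lemma dual_strongly_convex : strongly_convex (lam ^+ 2 / beta) phi.
Proof. exact: strongly_convex_lower dual_lower. Qed.

(** In the expanded square, the cross term is bounded by strong monotonicity (the two lower models
    added) and the last term by the Lipschitz constant of the gradient. *)
Lemma dual_gradient_contraction c y v : 0 < c ->
  enorm ((y - c *: grad phi y) - (v - c *: grad phi v)) ^+ 2 <=
  (1 - 2 * c * (lam ^+ 2 / beta) + c ^+ 2 * (lamb ^+ 2 / alpha) ^+ 2) * enorm (y - v) ^+ 2.
Proof.
move=> c0; have := dual_lower y v; have := dual_lower v y; have := dual_gradient_lipschitz y v.
rewrite -(dual_differentiable y).2 -(dual_differentiable v).2.
move: (grad phi y) (grad phi v) (phi y) (phi v) => u w a b hl.
rewrite (enormB_sym v y) -(opprB y v) dotvNr => h1 h2.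
have -> : y - c *: u - (v - c *: w) = (y - v) - c *: (u - w).
  by apply/matrixP => i j; rewrite !mxE; ring.
rewrite (sqr_enormB (y - v)) enormZ exprMn real_normK ?num_real// dotvZr.
have h3 : enorm (u - w) ^+ 2 <= (lamb ^+ 2 / alpha) ^+ 2 * enorm (y - v) ^+ 2.
  by rewrite -exprMn ler_pXn2r// nnegrE ?enorm_ge0// mulr_ge0 ?enorm_ge0// divr_ge0 ?sqr_ge0// ltW.
have h4 : lam ^+ 2 / beta * enorm (y - v) ^+ 2 <= dotv (y - v) (u - w).
  move: h1 h2; rewrite dotvDr dotvNr !(dotvC (y - v)).
  move: (dotv u _) (dotv w _) (lam ^+ 2 / beta) (enorm _ ^+ 2) => p q r s; lra.
have h5 := ler_wpM2l (ltW c0) h4; have h6 := ler_wpM2l (sqr_ge0 c) h3.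
move: h5 h6; move: (lam ^+ 2 / beta) ((lamb ^+ 2 / alpha) ^+ 2) (enorm _ ^+ 2) (enorm _ ^+ 2) (dotv _ _).
by move=> p q r s t; rewrite !mulrDl !mulNr !mulrA; lra.
Qed.

End DualSmoothPart.

(** * Locally Lipschitz maps, Clarke selections and derivatives of blocks *)

Section LocLipschitz.
Context {R : realType}.

Lemma loc_lipschitz_ge0 N k (D : set 'cV[R]_N) (F : 'cV[R]_N -> 'cV[R]_k) z :
  loc_lipschitz_on D F -> D z -> exists r L : R, [/\ 0 < r, 0 <= L & forall x y,
    enorm (x - z) < r -> enorm (y - z) < r -> enorm (F x - F y) <= L * enorm (x - y)].
Proof.
move=> FD Dz; have [r r0 [L hL]] := FD _ Dz; exists r, `|L|; split => // x y xr yr.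
by rewrite (le_trans (hL _ _ xr yr))// ler_wpM2r ?enorm_ge0// ler_norm.
Qed.

Lemma loc_lipschitz_le N k k1 k2 (D : set 'cV[R]_N) (F : 'cV[R]_N -> 'cV[R]_k)
    (F1 : 'cV[R]_N -> 'cV[R]_k1) (F2 : 'cV[R]_N -> 'cV[R]_k2) (C : R) : 0 <= C ->
  loc_lipschitz_on D F1 -> loc_lipschitz_on D F2 ->
  (forall x y, enorm (F x - F y) <= C * (enorm (F1 x - F1 y) + enorm (F2 x - F2 y))) ->
  loc_lipschitz_on D F.
Proof.
move=> C0 h1 h2 h z Dz.
have [r1 r10 [L1 hL1]] := h1 _ Dz; have [r2 r20 [L2 hL2]] := h2 _ Dz.
exists (Num.min r1 r2); first by rewrite lt_min r10.
exists (C * (L1 + L2)) => x y; rewrite !lt_min => /andP[x1 x2] /andP[y1 y2].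
by rewrite (le_trans (h _ _))// -mulrA ler_wpM2l// mulrDl lerD ?hL1 ?hL2.
Qed.

Lemma loc_lipschitz_comp N k l (D : set 'cV[R]_N) (E : set 'cV[R]_k)
    (F : 'cV[R]_N -> 'cV[R]_k) (H : 'cV[R]_k -> 'cV[R]_l) :
  loc_lipschitz_on D F -> loc_lipschitz_on E H -> (forall z, D z -> E (F z)) ->
  loc_lipschitz_on D (H \o F).
Proof.
move=> FD HE DE z Dz.
have [r1 [L1 [r10 L10 h1]]] := loc_lipschitz_ge0 FD Dz.
have [r2 [L2 [r20 L20 h2]]] := loc_lipschitz_ge0 HE (DE _ Dz).
have L11 : 0 < L1 + 1 by rewrite ltr_wpDl.
exists (Num.min r1 (r2 / (L1 + 1))); first by rewrite lt_min r10 divr_gt0.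
have hF x : enorm (x - z) < Num.min r1 (r2 / (L1 + 1)) -> enorm (F x - F z) < r2.
  rewrite lt_min ltr_pdivlMr// => /andP[x1 x2].
  rewrite (le_lt_trans (h1 _ _ x1 _)) ?subrr ?enorm0// (le_lt_trans _ x2)// mulrC.
  by rewrite ler_wpM2l ?enorm_ge0// lerDl.
exists (L2 * L1) => x y xz yz; rewrite (le_trans (h2 _ _ (hF _ xz) (hF _ yz)))//.
rewrite -mulrA ler_wpM2l// h1//.
  by move: xz; rewrite lt_min => /andP[].
by move: yz; rewrite lt_min => /andP[].
Qed.

Lemma loc_lipschitz_cvg N k (D : set 'cV[R]_N) (F : 'cV[R]_N -> 'cV[R]_k)
    (zs : nat -> 'cV[R]_N) (z : 'cV[R]_N) :
  loc_lipschitz_on D F -> D z -> zs @ \oo --> z -> (fun j => F (zs j)) @ \oo --> F z.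
Proof.
move=> FD Dz /cV_cvgP hz; have [r [L [r0 L0 hL]]] := loc_lipschitz_ge0 FD Dz.
apply/cV_cvgP => e e0; have L1 : 0 < L + 1 by rewrite ltr_wpDl.
have m0 : 0 < Num.min r (e / (L + 1)) by rewrite lt_min r0 divr_gt0.
have [n hn] := hz _ m0; exists n => j nj; have := hn j nj.
rewrite lt_min ltr_pdivlMr// => /andP[h1 h2].
rewrite (le_lt_trans (hL _ _ h1 _)) ?subrr ?enorm0// (le_lt_trans _ h2)// mulrC.
by rewrite ler_wpM2l ?enorm_ge0// lerDl.
Qed.

Lemma loc_lipschitz_linear N k (D : set 'cV[R]_N) (F : 'cV[R]_N -> 'cV[R]_k) :
  (forall x y, enorm (F x - F y) <= enorm (x - y)) -> loc_lipschitz_on D F.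
Proof. by move=> h z _; exists 1 => //; exists 1 => x y _ _; rewrite mul1r. Qed.

(** Local boundedness gives a convergent selection, and the closed graph places its limit in the
    Clarke Jacobian at [z]. *)
Lemma clarke_cvg_subsequence N k (D : set 'cV[R]_N) (F : 'cV[R]_N -> 'cV[R]_k)
    (zs : nat -> 'cV[R]_N) (z : 'cV[R]_N) (Ms : nat -> 'M[R]_(k, N)) :
  loc_lipschitz_on D F -> D z -> zs @ \oo --> z -> (forall j, clarke_jac F (zs j) (Ms j)) ->
  exists s : nat -> nat, (forall j, (j <= s j)%N) /\ exists M : 'M[R]_(k, N),
    clarke_jac F z M /\ (Ms \o s) @ \oo --> M.
Proof.
move=> FD Dz hz hM; have [r r0 [C hC]] := clarke_locally_bounded FD Dz.
have /cV_cvgP/(_ _ r0)[n hn] := hz.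
have [j i l|s [sk [M hs]]] := @bolzano_weierstrass_mx _ _ _ (fun j => Ms (n + j)%N) C.
  by apply: hC (hM _) _ _; apply: hn; exact: leq_addr.
exists (fun j => n + s j)%N; split; first by move=> j; rewrite (leq_trans (sk j))// leq_addl.
exists M; split => //; apply: (clarke_closed FD Dz _ hs) => [|j]; last exact: hM.
apply: (@cvg_subseq _ zs (fun j => n + s j)%N) hz => j.
by rewrite (leq_trans (sk j))// leq_addl.
Qed.

(** Lets a field be rewritten by an identity that is available on [D] only. *)
Lemma conservative_on_ext N k (D : set 'cV[R]_N) (F : 'cV[R]_N -> 'cV[R]_k) J J' :
  (forall z, D z -> J z = J' z) -> conservative_on D F J -> conservative_on D F J'.
Proof.
move=> JJ' [h1 [h2 [h3 h4]]]; split; [|split; [|split]].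
- by move=> z Dz; rewrite -JJ'//; exact: h1.
- move=> z Dz; have [r r0 [C hC]] := h2 _ Dz; exists r => //; exists C => z' M Dz' zz'.
  by rewrite -JJ'//; exact: hC.
- move=> zs Ms z M Dzs Dz hz hM hJ; rewrite -JJ'//; apply: (h3 zs Ms) => // j.
  by rewrite JJ'.
- move=> c hc cD; apply: ae_lebesgueS (h4 c hc cD) => t ht t01.
  by have := ht t01; rewrite JJ'//; apply: cD; case/andP: t01 => /ltW-> /ltW->.
Qed.

Lemma derivable_usubmx k l (z : R -> 'cV[R]_(k + l)) t : derivable z t 1 ->
  derivable (fun t => usubmx (z t)) t 1 /\ 'D_1 (fun t => usubmx (z t)) t = usubmx ('D_1 z t).
Proof.
move=> dz; have zE i j : (fun t => usubmx (z t) i j) = (fun t => z t (lshift l i) j).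
  by apply/funext => s; rewrite mxE.
have du : derivable (fun t => usubmx (z t)) t 1.
  by apply/derivable_mxP => i j; rewrite zE; exact: (derivable_mxP _ _ _).1.
by split => //; apply/matrixP => i j; rewrite !derive_mx// !mxE zE.
Qed.

Lemma derivable_dsubmx k l (z : R -> 'cV[R]_(k + l)) t : derivable z t 1 ->
  derivable (fun t => dsubmx (z t)) t 1 /\ 'D_1 (fun t => dsubmx (z t)) t = dsubmx ('D_1 z t).
Proof.
move=> dz; have zE i j : (fun t => dsubmx (z t) i j) = (fun t => z t (rshift k i) j).
  by apply/funext => s; rewrite mxE.
have du : derivable (fun t => dsubmx (z t)) t 1.
  by apply/derivable_mxP => i j; rewrite zE; exact: (derivable_mxP _ _ _).1.
by split => //; apply/matrixP => i j; rewrite !derive_mx// !mxE zE.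
Qed.

Lemma eq_on01_derive k (F H : R -> 'cV[R]_k) t : 0 < t < 1 ->
  (forall s, 0 <= s <= 1 -> F s = H s) -> 'D_1 F t = 'D_1 H t.
Proof.
move=> t01 FH; apply: near_eq_derive => //.
have : \forall s \near t, s \in `]0, 1[ by apply: near_in_itvoo; rewrite in_itv.
by apply: filterS => s; rewrite in_itv/= => /andP[/ltW s0 /ltW s1]; rewrite FH// s0.
Qed.

Lemma derive_subZ k (u v : R -> 'cV[R]_k) (a : R) t : derivable u t 1 -> derivable v t 1 ->
  'D_1 (fun s => u s - a *: v s) t = 'D_1 u t - a *: 'D_1 v t.
Proof.
move=> du dv; have := deriveB du (@derivableZ _ _ _ v a _ _ dv).
by rewrite (deriveZ a dv).
Qed.

End LocLipschitz.

(** * Implicit differentiation of a contractive fixed-point equation *)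

Section ImplicitFixedPoint.
Context {R : realType} {p m : nat}.
Variables (Theta : set 'cV[R]_p) (T G : 'cV[R]_(p + m) -> 'cV[R]_m) (ys : 'cV[R]_p -> 'cV[R]_m).
Variables (gamma c : R).
Let D : set 'cV[R]_(p + m) := [set z | Theta (usubmx z)].
Hypotheses (oTheta : open Theta) (gamma0 : 0 < gamma) (c01 : 0 <= c < 1).
Hypotheses (TD : path_differentiable_on D T) (GD : path_differentiable_on D G).
Hypothesis nonexpansive_T : forall th y y', Theta th ->
  enorm (T (col_mx th y) - T (col_mx th y')) <= enorm (y - y').
Hypothesis contraction_G : forall th y y', Theta th ->
  enorm ((y - gamma *: G (col_mx th y)) - (y' - gamma *: G (col_mx th y'))) <= c * enorm (y - y').
Hypothesis fixed_ys : forall th, Theta th ->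
  ys th = T (col_mx th (ys th - gamma *: G (col_mx th (ys th)))).

Let Gpt th := col_mx th (ys th).
Let Tpt th := col_mx th (ys th - gamma *: G (col_mx th (ys th))).
(** With UV = [U V] and WZ = [W Z], the formal chain rule for T(th, y - gamma G(th, y)) gives V (1 -
    gamma Z) in [y] and U - gamma V W in [th]; [A] and [B] are the two sides of the resulting linear
    system. *)
Let A (UV WZ : 'M[R]_(m, p + m)) : 'M[R]_m := 1%:M - rsubmx UV *m (1%:M - gamma *: rsubmx WZ).
Let B (UV WZ : 'M[R]_(m, p + m)) : 'M[R]_(m, p) :=
  lsubmx UV - gamma *: (rsubmx UV *m lsubmx WZ).

Let c1 : 0 < 1 - c. Proof. by case/andP: c01 => _; rewrite subr_gt0. Qed.

Let oD : open D.
Proof.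
apply: enorm_ball_open => z Dz; have [r r0 hr] := open_enorm_ball oTheta Dz.
exists r => // x xz; apply: hr; rewrite (le_lt_trans _ xz)//.
by rewrite -linearB enorm_usub_le.
Qed.

Let DT th : Theta th -> D (Tpt th). Proof. by rewrite /D/= /Tpt col_mxKu. Qed.
Let DG th : Theta th -> D (Gpt th). Proof. by rewrite /D/= /Gpt col_mxKu. Qed.

Let shift_col (x : 'cV[R]_(p + m)) (u : 'cV[R]_m) s :
  x + s *: col_mx 0 u = col_mx (usubmx x) (dsubmx x + s *: u).
Proof. by rewrite -{1}(vsubmxK x) scale_col_mx scaler0 add_col_mx addr0. Qed.

Let mulmx_col (M : 'M[R]_(m, p + m)) (a : 'cV[R]_p) (b : 'cV[R]_m) :
  M *m col_mx a b = lsubmx M *m a + rsubmx M *m b.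
Proof. by rewrite -{1}(hsubmxK M) mul_row_col. Qed.

(** Nonexpansiveness in [y] bounds the quotients of [T] in the directions (0, u), hence V. *)
Lemma clarke_nonexpansive z UV u : D z -> clarke_jac T z UV -> enorm (rsubmx UV *m u) <= enorm u.
Proof.
move=> Dz hUV; have [r r0 hr] := open_enorm_ball oD Dz.
have -> : rsubmx UV *m u = UV *m col_mx 0 u - 0 by rewrite subr0 mulmx_col mulmx0 add0r.
apply: (clarke_dir_bound r0 _ hUV) => x /hr Dx; exists 1 => // s /andP[s0 _].
rewrite scaler0 subr0 shift_col -{3}(vsubmxK x) (le_trans (nonexpansive_T _ _ Dx))//.
by rewrite addrAC subrr add0r enormZ gtr0_norm.
Qed.

(** The contraction estimate for y - gamma G, divided by gamma, compares the quotients of [G] in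
    direction (0, u) with u / gamma; this is a direction bound for [G] alone. *)
Lemma clarke_contraction z WZ u : D z -> clarke_jac G z WZ ->
  enorm (u - gamma *: (rsubmx WZ *m u)) <= c * enorm u.
Proof.
move=> Dz hWZ; have [r r0 hr] := open_enorm_ball oD Dz.
have -> : u - gamma *: (rsubmx WZ *m u) = - gamma *: (WZ *m col_mx 0 u - gamma^-1 *: u).
  rewrite mulmx_col mulmx0 add0r scalerBr scalerA mulNr mulfV ?gt_eqF// scaleN1r opprK.
  by rewrite addrC scaleNr.
rewrite enormZ normrN (gtr0_norm gamma0) mulrC -ler_pdivlMr// mulrC.
apply: (clarke_dir_bound r0 _ hWZ) => x /hr Dx; exists 1 => // s /andP[s0 _].
rewrite shift_col -{3}(vsubmxK x); set th := usubmx x; set y := dsubmx x.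
have := contraction_G (y + s *: u) y Dx; rewrite (addrAC y _ (- y)) subrr add0r (enormZ s) (gtr0_norm s0).
move: (G _) (G _) => g2 g1 h.
rewrite -(ler_pM2l gamma0) -{1}(gtr0_norm gamma0) -{1}normrN -enormZ.
have -> : - gamma *: (g1 - g2 - s *: (gamma^-1 *: u)) = y + s *: u - gamma *: g1 - (y - gamma *: g2).
  apply/matrixP => i j; rewrite !mxE mulrBr mulrCA !mulNr mulVKf ?gt_eqF//; ring.
by rewrite (le_trans h)// [leRHS]mulrCA mulVKf ?gt_eqF// mulrCA.
Qed.

(** The triangle inequality after V (1 - gamma Z) has been shown to contract by [c]. Besides
    invertibility, it bounds the inverse uniformly, which makes the field locally bounded. *)
Lemma fixed_point_jacobian_lower th UV WZ u : Theta th -> clarke_jac T (Tpt th) UV ->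
  clarke_jac G (Gpt th) WZ -> (1 - c) * enorm u <= enorm (A UV WZ *m u).
Proof.
move=> Tth hUV hWZ.
have h1 := clarke_contraction u (DG Tth) hWZ.
have h2 := clarke_nonexpansive (u - gamma *: (rsubmx WZ *m u)) (DT Tth) hUV.
have -> : A UV WZ *m u = u - rsubmx UV *m (u - gamma *: (rsubmx WZ *m u)).
  by rewrite /A mulmxBl mul1mx -mulmxA mulmxBl mul1mx -scalemxAl.
set w := rsubmx UV *m _ in h2 *.
have : enorm u <= enorm (u - w) + enorm w by rewrite -{1}(subrK w u) enormD.
by move/le_trans: h2 => /(_ _ h1); rewrite mulrBl mul1r; lra.
Qed.

Lemma fixed_point_jacobian_unit th UV WZ : Theta th -> clarke_jac T (Tpt th) UV ->
  clarke_jac G (Gpt th) WZ -> A UV WZ \in unitmx.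
Proof.
move=> Tth hUV hWZ; rewrite -unitmx_tr -row_free_unit; apply: inj_row_free => v hv.
have /(congr1 trmx) := hv; rewrite trmx_mul trmxK trmx0 => Av.
have := fixed_point_jacobian_lower v^T Tth hUV hWZ; rewrite Av enorm0 pmulr_rle0// => v0.
have /enorm_eq0/(congr1 trmx) : enorm v^T = 0 by apply/eqP; rewrite eq_le v0 enorm_ge0.
by rewrite trmxK trmx0.
Qed.

Let P z := col_mx (usubmx z) (dsubmx z - gamma *: G z).

Let loc_lipschitz_P : loc_lipschitz_on D P.
Proof.
have C0 : 0 <= 2 + gamma by rewrite addr_ge0// ltW.
apply: (@loc_lipschitz_le _ _ _ _ _ D P id G (2 + gamma) C0).
- exact: loc_lipschitz_linear.
- exact: GD.1.
move=> x y; rewrite /P opp_col_mx add_col_mx -linearB.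
rewrite (le_trans (enorm_col_mx _ _))//.
have -> : dsubmx x - gamma *: G x - (dsubmx y - gamma *: G y) =
    dsubmx (x - y) - gamma *: (G x - G y).
  move: (G x) (G y) => u v; by apply/matrixP => i j; rewrite !mxE; ring.
have h1 := enormB (dsubmx (x - y)) (gamma *: (G x - G y)).
rewrite enormZ (gtr0_norm gamma0) in h1.
have h2 := enorm_usub_le (x - y); have h3 := enorm_dsub_le (x - y).
have h4 := enorm_ge0 (x - y); have h5 := enorm_ge0 (G x - G y).
have h6 := mulr_ge0 (ltW gamma0) h4; rewrite mulrDl !mulrDr; move: h1 h2 h3 h4 h5 h6 => /=.
move: (enorm (dsubmx _ - _)) (enorm (usubmx _)) (enorm (dsubmx _)) (enorm (x - y)) (enorm (G x - G y)).
by move=> s1 s2 s3 s4 s5; lra.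
Qed.

Let S := T \o P.

Let loc_lipschitz_S : loc_lipschitz_on D S.
Proof.
by apply: (loc_lipschitz_comp loc_lipschitz_P TD.1) => z; rewrite /D/= /P col_mxKu.
Qed.

Let S_fixed th : Theta th -> S (Gpt th) = ys th.
Proof. by move=> Tth; rewrite /S/= /P /Gpt col_mxKu col_mxKd -fixed_ys. Qed.

Let S_contraction th y y' : Theta th -> enorm (S (col_mx th y) - S (col_mx th y')) <= c * enorm (y - y').
Proof.
move=> Tth; rewrite /S/= /P !col_mxKu !col_mxKd.
exact: le_trans (nonexpansive_T _ _ Tth) (contraction_G _ _ Tth).
Qed.

(** The values of [S] at the two fixed points are compared through S(th, ys th'); the contraction
    part moves to the left. *)
Let ys_dist th th' : Theta th -> Theta th' ->
  (1 - c) * enorm (ys th - ys th') <= enorm (S (col_mx th (ys th')) - S (col_mx th' (ys th'))).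
Proof.
move=> Tth Tth'; have := enorm_triangle (S (col_mx th (ys th'))) (S (Gpt th)) (S (Gpt th')).
by have := S_contraction (ys th) (ys th') Tth; rewrite !S_fixed// mulrBl mul1r /Gpt; lra.
Qed.

(** [S] is Lipschitz only near (th0, ys th0), so [ys th] must first be brought close to [ys th0];
    the distance estimate gives this, and then the Lipschitz bound. *)
Lemma loc_lipschitz_fixed_point : loc_lipschitz_on Theta ys.
Proof.
move=> th0 Tth0.
have [r [L [r0 L0 hL]]] := loc_lipschitz_ge0 loc_lipschitz_S (DG Tth0).
have [r' r'0 hr'] := open_enorm_ball oTheta Tth0.
(* If |th - th0| < k, then [S] moves by less than (1 - c) r / 2, and the fixed point by less than r
   / 2. *)
pose k := r / 2 * (1 - c) / (L + 1).
have L1 : 0 < L + 1 by rewrite ltr_wpDl.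
have r20 : 0 < r / 2 by rewrite divr_gt0.
have k0 : 0 < k by rewrite !(divr_gt0, mulr_gt0).
have hd th y : enorm (col_mx th y - Gpt th0) <= enorm (th - th0) + enorm (y - ys th0).
  by rewrite /Gpt opp_col_mx add_col_mx enorm_col_mx.
have hth (th th' : 'cV[R]_p) (y : 'cV[R]_m) : enorm (col_mx th y - col_mx th' y) <= enorm (th - th').
  by rewrite opp_col_mx add_col_mx subrr (le_trans (enorm_col_mx _ _))// enorm0 addr0.
have hnear th : enorm (th - th0) < Num.min r' (Num.min (r / 2) k) ->
    [/\ Theta th, enorm (th - th0) < r / 2 & enorm (ys th - ys th0) < r / 2].
  rewrite !lt_min => /and3P[h1 h2 h3]; have Tth := hr' _ h1; split => //.
  rewrite -(ltr_pM2l c1) (le_lt_trans (ys_dist Tth Tth0))//.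
  have h4 : enorm (col_mx th (ys th0) - Gpt th0) < r.
    rewrite (le_lt_trans (hd _ _))// subrr enorm0 addr0 (lt_trans h2)//.
    by rewrite ltr_pdivrMr// ltr_pMr// ltr1n.
  rewrite (le_lt_trans (hL _ _ h4 _)) ?subrr ?enorm0//.
  have h5 : L * enorm (col_mx th (ys th0) - col_mx th0 (ys th0)) <= (L + 1) * enorm (th - th0).
    by apply: ler_pM => //; [exact: enorm_ge0|rewrite lerDl].
  rewrite (le_lt_trans h5)//; move: h3; rewrite /k ltr_pdivlMr//.
  by rewrite mulrC [X in _ < X -> _]mulrC.
exists (Num.min r' (Num.min (r / 2) k)); first by rewrite !lt_min r'0 r20.
exists (L / (1 - c)) => x y /hnear[Tx xr _] /hnear[Ty yr yry].
rewrite mulrAC ler_pdivlMr// mulrC (le_trans (ys_dist Tx Ty))//.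
apply: le_trans (hL _ _ _ _) _.
- by rewrite (le_lt_trans (hd _ _))// (splitr r) ltrD.
- by rewrite (le_lt_trans (hd _ _))// (splitr r) ltrD.
- by rewrite ler_wpM2l// hth.
Qed.

Let loc_lipschitz_Gpt : loc_lipschitz_on Theta Gpt.
Proof.
apply: (@loc_lipschitz_le _ _ _ _ _ Theta Gpt id ys 1 ler01).
- exact: loc_lipschitz_linear.
- exact: loc_lipschitz_fixed_point.
- by move=> x y; rewrite mul1r /Gpt opp_col_mx add_col_mx enorm_col_mx.
Qed.

Let TptE : Tpt = P \o Gpt.
Proof. by apply/funext => th; rewrite /Tpt/= /P /Gpt col_mxKu col_mxKd. Qed.

Let loc_lipschitz_Tpt : loc_lipschitz_on Theta Tpt.
Proof. by rewrite TptE; exact: (loc_lipschitz_comp loc_lipschitz_Gpt loc_lipschitz_P). Qed.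

(** [dg] and [dw] stand for the velocities of [Gpt] and [Tpt] along a curve; eliminating them leaves
    a linear system for the velocity [y] of the fixed point. *)
Let implicit_derivative UV WZ (dg dw : 'cV[R]_(p + m)) (d : 'cV[R]_p) (y g : 'cV[R]_m) :
  d = usubmx dg -> y = dsubmx dg -> g = WZ *m dg ->
  d = usubmx dw -> y - gamma *: g = dsubmx dw -> y = UV *m dw ->
  A UV WZ *m y = B UV WZ *m d.
Proof.
move=> dE yE; rewrite -(vsubmxK dg) -dE -yE mulmx_col => gE wE wE'.
rewrite -(vsubmxK dw) -wE -wE' mulmx_col gE => yE'.
rewrite /A /B !mulmxBl mul1mx -!mulmxA mulmxBl mul1mx -!scalemxAl {1}yE'.
rewrite -addrA -mulmxBr -!mulmxA; congr (_ + _).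
transitivity (rsubmx UV *m (- (gamma *: (lsubmx WZ *m d)))); last by rewrite mulmxN -scalemxAr.
congr (_ *m _).
move: (lsubmx WZ *m d) (rsubmx WZ *m y) => a b.
by apply/matrixP => i j; rewrite !mxE; ring.
Qed.

Lemma conservative_fixed_point : conservative_on Theta ys (fun th M =>
  exists UV WZ, clarke_jac T (Tpt th) UV /\ clarke_jac G (Gpt th) WZ /\
    M = invmx (A UV WZ) *m B UV WZ).
Proof.
split; [|split; [|split]].
- move=> th Tth; have [UV hUV] := clarke_nonempty oD TD (DT Tth).
  have [WZ hWZ] := clarke_nonempty oD GD (DG Tth).
  by exists (invmx (A UV WZ) *m B UV WZ), UV, WZ.
- move=> th0 Tth0.
  have [r1 r10 [C1 hC1]] := clarke_locally_bounded TD.1 (DT Tth0).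
  have [r2 r20 [C2 hC2]] := clarke_locally_bounded GD.1 (DG Tth0).
  have [s1 [L1 [s10 L10 hL1]]] := loc_lipschitz_ge0 loc_lipschitz_Tpt Tth0.
  have [s2 [L2 [s20 L20 hL2]]] := loc_lipschitz_ge0 loc_lipschitz_Gpt Tth0.
  have L11 : 0 < L1 + 1 by rewrite ltr_wpDl.
  have L21 : 0 < L2 + 1 by rewrite ltr_wpDl.
  exists (Num.min (Num.min s1 (r1 / (L1 + 1))) (Num.min s2 (r2 / (L2 + 1)))).
    by rewrite !lt_min s10 s20 !divr_gt0.
  (* Column j of M satisfies (1 - c)|M e_j| <= |B e_j| <= |U e_j| + gamma |W e_j|, as V does not
     increase norms. *)
  exists ((m%:R * `|C1| + gamma * (m%:R * `|C2|)) / (1 - c)) => th M Tth.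
  rewrite !lt_min !ltr_pdivlMr// => /andP[/andP[h1 h2] /andP[h3 h4]].
  move=> [UV [WZ [hUV [hWZ ->]]]] i j.
  have hT : enorm (Tpt th - Tpt th0) < r1.
    rewrite (le_lt_trans (hL1 _ _ h1 _)) ?subrr ?enorm0// (le_lt_trans _ h2)// mulrC.
    by rewrite ler_wpM2l ?enorm_ge0// lerDl.
  have hG : enorm (Gpt th - Gpt th0) < r2.
    rewrite (le_lt_trans (hL2 _ _ h3 _)) ?subrr ?enorm0// (le_lt_trans _ h4)// mulrC.
    by rewrite ler_wpM2l ?enorm_ge0// lerDl.
  have unitA := fixed_point_jacobian_unit Tth hUV hWZ.
  pose e : 'cV[R]_p := delta_mx j ord0.
  rewrite -(mulmx_delta_entry _ i j) (le_trans (entry_le_enorm _ _ _))// -/e.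
  rewrite ler_pdivlMr// mulrC.
  rewrite (le_trans (fixed_point_jacobian_lower _ Tth hUV hWZ))//.
  rewrite !mulmxA mulmxV// mul1mx /B mulmxBl -scalemxAl -mulmxA.
  rewrite (le_trans (enormB _ _))// lerD//.
    apply: enorm_entry_le => // k; rewrite mulmx_delta_entry mxE.
    by rewrite (le_trans (hC1 _ _ hT hUV _ _))// ler_norm.
  rewrite enormZ (gtr0_norm gamma0) ler_wpM2l ?(ltW gamma0)//.
  rewrite (le_trans (clarke_nonexpansive _ (DT Tth) hUV))//.
  apply: enorm_entry_le => // k; rewrite mulmx_delta_entry mxE.
  by rewrite (le_trans (hC2 _ _ hG hWZ _ _))// ler_norm.
- move=> ths Ms th M Tths Tth hth hM hJ.
  have [f hf] := choice hJ; have [g hg] := choice hf.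
  have hT := loc_lipschitz_cvg loc_lipschitz_Tpt Tth hth.
  have hG := loc_lipschitz_cvg loc_lipschitz_Gpt Tth hth.
  have [s [sk [UV [hUV cUV]]]] := clarke_cvg_subsequence TD.1 (DT Tth) hT (fun j => (hg j).1).
  have hGs : (fun j => Gpt (ths (s j))) @ \oo --> Gpt th by exact: (cvg_subseq sk hG).
  have [t [tk [WZ [hWZ cWZ]]]] :=
    clarke_cvg_subsequence GD.1 (DG Tth) hGs (fun j => (hg (s j)).2.1).
  have {}cUV : (fun j => f (s (t j))) @ \oo --> UV by exact: (cvg_subseq tk cUV).
  have cM : (fun j => Ms (s (t j))) @ \oo --> M.
    apply: (@cvg_subseq _ Ms (fun j => s (t j))) hM => j.
    by rewrite (leq_trans (tk j)).
  have cl (F : nat -> 'M[R]_(m, p + m)) (X : 'M[R]_(m, p + m)) : F @ \oo --> X ->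
      (fun j => lsubmx (F j)) @ \oo --> lsubmx X.
    by move=> /mx_cvgP h; apply/mx_cvgP => i j; rewrite mxE; under eq_fun do rewrite mxE; exact: h.
  have cr (F : nat -> 'M[R]_(m, p + m)) (X : 'M[R]_(m, p + m)) : F @ \oo --> X ->
      (fun j => rsubmx (F j)) @ \oo --> rsubmx X.
    by move=> /mx_cvgP h; apply/mx_cvgP => i j; rewrite mxE; under eq_fun do rewrite mxE; exact: h.
  have cA : (fun j => A (f (s (t j))) (g (s (t j)))) @ \oo --> A UV WZ.
    apply: (@cvgB _ 'M[R]_m); first exact: cvg_cst.
    apply: cvg_mulmx; first exact: cr.
    apply: (@cvgB _ 'M[R]_m); first exact: cvg_cst.
    by apply: (@cvgZ _ 'M[R]_m); [exact: cvg_cst|exact: cr].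
  have cB : (fun j => B (f (s (t j))) (g (s (t j)))) @ \oo --> B UV WZ.
    apply: (@cvgB _ 'M[R]_(m, p)); first exact: cl.
    by apply: (@cvgZ _ 'M[R]_(m, p)); [exact: cvg_cst|apply: cvg_mulmx; [exact: cr|exact: cl]].
  exists UV, WZ; split => //; split => //.
  have unitA := fixed_point_jacobian_unit Tth hUV hWZ.
  (* The limit is taken in the equation A M = B rather than in the inverse; invertibility of the
     limit [A] then recovers M. *)
  have AM : A UV WZ *m M = B UV WZ.
    apply: (cvg_unique (@norm_hausdorff _ 'M[R]_(m, p)) _ cB).
    rewrite (_ : (fun j => B _ _) = (fun j => A (f (s (t j))) (g (s (t j))) *m Ms (s (t j)))).
      exact: cvg_mulmx.
    apply/funext => j; have [hu [hw ->]] := hg (s (t j)).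
    by rewrite mulmxA mulmxV ?mul1mx//; exact: (fixed_point_jacobian_unit (Tths _) hu hw).
  by rewrite -AM mulmxA mulVmx// mul1mx.
- move=> d hd dTheta.
  (* The chain rules for [G] and [T] are used along the lifted curves [Gpt \o d] and [Tpt \o d], at
     almost every t for both; derivability of [d] and [ys \o d] is read off the blocks of the
     first. *)
  have acG : abs_cont01 (Gpt \o d) by exact: (abs_cont_comp loc_lipschitz_Gpt hd dTheta).
  have acT : abs_cont01 (Tpt \o d) by exact: (abs_cont_comp loc_lipschitz_Tpt hd dTheta).
  have [_ [_ [_ hG]]] := clarke_conservative oD GD.
  have [_ [_ [_ hT]]] := clarke_conservative oD TD.
  have {}hG := hG _ acG (fun t h => DG (dTheta t h)).
  have {}hT := hT _ acT (fun t h => DT (dTheta t h)).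
  apply: ae_lebesgueS (ae_lebesgueI hG hT) => t [ht1 ht2] t01.
  have [dG [dGG hWZ]] := ht1 t01; have [dT [dTT hUV]] := ht2 t01.
  have [] := derivable_usubmx dG; have [] := derivable_dsubmx dG.
  rewrite (_ : (fun t => dsubmx _) = ys \o d); last by apply/funext => s; rewrite /= /Gpt col_mxKd.
  rewrite (_ : (fun t => usubmx _) = d); last by apply/funext => s; rewrite /= /Gpt col_mxKu.
  move=> dY YE dd dE; split => //; split => // _ [UV [WZ [cUV [cWZ ->]]]].
  have t01' : 0 <= t <= 1 by case/andP: t01 => /ltW-> /ltW->.
  have Td := dTheta _ t01'.
  have unitA := fixed_point_jacobian_unit Td cUV cWZ.
  (* The fixed-point equation holds along the curve for times in [0, 1] only; t is interior, so the
     derivatives agree. *)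
  have YT : 'D_1 (ys \o d) t = 'D_1 (T \o (Tpt \o d)) t.
    apply: eq_on01_derive t01 _ => s s01 /=.
    exact: fixed_ys (dTheta _ s01).
  have [_ uT] := derivable_usubmx dT; have [_ wT] := derivable_dsubmx dT.
  rewrite (_ : (fun t => usubmx _) = d) in uT; last by apply/funext => s; rewrite /= /Tpt col_mxKu.
  rewrite (_ : (fun t => dsubmx _) =
      (fun s => (ys \o d) s - gamma *: (G \o (Gpt \o d)) s)) in wT; last first.
    by apply/funext => s; rewrite /= /Tpt col_mxKd.
  rewrite (derive_subZ gamma dY dGG) in wT.
  have TE := hUV _ cUV; rewrite -YT in TE.
  have key := implicit_derivative dE YE (hWZ _ cWZ) uT wT TE.
  by rewrite -mulmxA -key mulmxA mulVmx// mul1mx.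
Qed.

End ImplicitFixedPoint.

(** * The dual problem as an instance of the abstract fixed point *)

Unset Implicit Arguments.

Theorem theorem6 (R : realType) (p n m : nat) (Theta : set 'cV[R]_p)
  (alpha beta lam lamb : R)
  (f : 'cV[R]_p -> 'cV[R]_n -> R) (g : 'cV[R]_p -> 'cV[R]_m -> \bar R)
  (K : 'cV[R]_p -> 'M[R]_(m, n)) :
  open Theta -> connected Theta -> Theta !=set0 ->
  0 < alpha -> alpha <= beta -> 0 < lam -> lam <= lamb ->
  (forall th, Theta th ->
     (forall x, differentiable (f th) x) /\ continuous (grad (f th)) /\
     strongly_convex alpha (f th) /\ lipschitz_with beta (grad (f th))) ->
  (forall th, Theta th -> closed_convex_proper (g th)) ->
  (forall th, Theta th ->
     (forall y : 'cV[R]_m, exists x : 'cV[R]_n, K th *m x = y) /\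
     (forall s, singular_value (K th) s -> lam <= s <= lamb)) ->
  let fstar th (z : 'cV[R]_n) : R := fine (fconj (f th) z) in
  let phi th (y : 'cV[R]_m) : R := fine (fconj (f th) (- (K th)^T *m y)) in
  (* (i) *)
  (forall th, Theta th ->
     (forall y, fconj (f th) (- (K th)^T *m y) \is a fin_num) /\
     strongly_convex (lam ^+ 2 / beta) (phi th) /\
     (forall y, differentiable (phi th) y /\
                differentiable (fstar th) (- (K th)^T *m y) /\
                grad (phi th) y = - (K th *m grad (fstar th) (- (K th)^T *m y))) /\
     lipschitz_with (lamb ^+ 2 / alpha) (grad (phi th)))
  /\
  (* (ii) *)
  (forall gamma : R,
     let a := lam ^+ 2 / beta in
     let b := lamb ^+ 2 / alpha in
     0 < gamma < 2 * a / (a + b) ^+ 2 ->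
     let D : set 'cV[R]_(p + m) := [set z | Theta (usubmx z)] in
     let T (z : 'cV[R]_(p + m)) : 'cV[R]_m :=
       prox (fun u => (gamma%:E * econj (g (usubmx z)) u)%E) (dsubmx z) in
     let gphi (z : 'cV[R]_(p + m)) : 'cV[R]_m := grad (phi (usubmx z)) (dsubmx z) in
     path_differentiable_on D T -> path_differentiable_on D gphi ->
     let dual th (y : 'cV[R]_m) : \bar R :=
       (fconj (f th) (- (K th)^T *m y) + econj (g th) y)%E in
     exists ystar : 'cV[R]_p -> 'cV[R]_m,
       (forall th, Theta th -> forall y,
          (forall y', (dual th y <= dual th y')%E) <-> y = ystar th) /\
       let Tpt th := col_mx th (ystar th + gamma *: (K th *m
                        grad (fstar th) (- (K th)^T *m ystar th))) in
       let Gpt th := col_mx th (ystar th) in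
       (forall th UV WZ, Theta th -> clarke_jac T (Tpt th) UV ->
          clarke_jac gphi (Gpt th) WZ ->
          (1%:M - rsubmx UV *m (1%:M - gamma *: rsubmx WZ)) \in unitmx) /\
       loc_lipschitz_on Theta ystar /\
       conservative_on Theta ystar (fun th M =>
         exists UV WZ, clarke_jac T (Tpt th) UV /\ clarke_jac gphi (Gpt th) WZ /\
           M = invmx (1%:M - rsubmx UV *m (1%:M - gamma *: rsubmx WZ))
                 *m (lsubmx UV - gamma *: (rsubmx UV *m lsubmx WZ)))).
Proof.
move=> oTheta _ _ alpha0 alpha_beta lam0 lam_lamb hf hg hK fstar phi.
have part_i th : Theta th ->
    (forall y, fconj (f th) (- (K th)^T *m y) \is a fin_num) /\
    strongly_convex (lam ^+ 2 / beta) (phi th) /\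
    (forall y, differentiable (phi th) y /\
               differentiable (fstar th) (- (K th)^T *m y) /\
               grad (phi th) y = - (K th *m grad (fstar th) (- (K th)^T *m y))) /\
    lipschitz_with (lamb ^+ 2 / alpha) (grad (phi th)).
  move=> Tth; have [df [_ [scf lipf]]] := hf th Tth; have [surjK svK] := hK th Tth.
  split; first by move=> y; rewrite (fconjE alpha0 alpha_beta df scf lipf).
  split; first exact: (dual_strongly_convex alpha0 alpha_beta lam0 df scf lipf surjK svK).
  split; last exact: (dual_gradient_lipschitz alpha0 alpha_beta lam0 lam_lamb df scf lipf surjK svK).
  move=> y; have [d1 d2] := dual_differentiable alpha0 alpha_beta lam0 df scf lipf surjK svK y.
  have [e1 e2] := fconj_differentiable alpha0 alpha_beta df scf lipf (- (K th)^T *m y).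
  by split => //; split => //; rewrite [LHS]d2 [grad (fstar th) _]e2.
split => // gamma a b /andP[gamma0 gammab] D T gphi TD GD dual.
have beta0 : 0 < beta by exact: lt_le_trans alpha_beta.
have lamb0 : 0 < lamb by exact: lt_le_trans lam_lamb.
have a0 : 0 < a by rewrite divr_gt0// exprn_gt0.
have b0 : 0 < b by rewrite divr_gt0// exprn_gt0.
(* The squared contraction factor; the maximum with 0 makes it nonnegative at once, so that squaring
   its root returns it. *)
pose c2 := Num.max 0 (1 - 2 * gamma * a + gamma ^+ 2 * b ^+ 2).
pose c := Num.sqrt c2.
have c20 : 0 <= c2 by rewrite le_max lexx.
have c21 : c2 < 1.
  rewrite gt_max ltr01/=.
  (* Since b <= a + b, the step bound gives gamma b^2 < 2 a, which is exactly what makes the factor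
     smaller than 1. *)
  have h1 : gamma * b ^+ 2 < 2 * a.
    move: gammab; rewrite ltr_pdivlMr ?exprn_gt0 ?addr_gt0// => /(le_lt_trans _); apply.
    by rewrite ler_wpM2l ?(ltW gamma0)// ler_pXn2r ?nnegrE ?(ltW b0) ?addr_ge0 ?(ltW a0) ?(ltW b0)// lerDr ltW.
  have := h1; rewrite -(ltr_pM2l gamma0) mulrA -expr2.
  move: (gamma ^+ 2 * b ^+ 2) => X; clear; lra.
have c01 : 0 <= c < 1 by rewrite sqrtr_ge0/= -[ltRHS](@sqrtr1 R) ltr_sqrt.
have contr th y v : Theta th ->
    enorm ((y - gamma *: grad (phi th) y) - (v - gamma *: grad (phi th) v)) <= c * enorm (y - v).
  move=> Tth; have [df [_ [scf lipf]]] := hf th Tth; have [surjK svK] := hK th Tth.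
  apply: enorm_le_sqr; first by rewrite mulr_ge0 ?enorm_ge0 ?sqrtr_ge0.
  rewrite -sqr_enorm exprMn (sqr_sqrtr c20).
  apply: le_trans (dual_gradient_contraction alpha0 alpha_beta lam0 lam_lamb df scf lipf surjK svK y v gamma0) _.
  by rewrite ler_wpM2r ?sqr_ge0// le_max lexx orbT.
have ccp th : Theta th -> closed_convex_proper (econj (g th)).
  by move=> /hg; exact: closed_convex_proper_econj.
have ccp' th : Theta th -> closed_convex_proper (fun u => gamma%:E * econj (g th) u)%E.
  by move=> /ccp; exact: closed_convex_proper_scale.
have TE th y : T (col_mx th y) = prox (fun u => gamma%:E * econj (g th) u)%E y.
  by rewrite /T col_mxKu col_mxKd.
have GE th y : gphi (col_mx th y) = grad (phi th) y by rewrite /gphi col_mxKu col_mxKd.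
have nonexp th y y' : Theta th -> enorm (T (col_mx th y) - T (col_mx th y')) <= enorm (y - y').
  move=> Tth; rewrite !TE; have h := ccp' _ Tth.
  exact: (is_prox_nonexpansive h (is_prox_prox _ h) (is_prox_prox _ h)).
have contrG th y y' : Theta th -> enorm ((y - gamma *: gphi (col_mx th y)) -
    (y' - gamma *: gphi (col_mx th y'))) <= c * enorm (y - y').
  by move=> Tth; rewrite !GE; exact: contr.
pose S th y := T (col_mx th (y - gamma *: gphi (col_mx th y))).
have S_contr th : Theta th -> lipschitz_with c (S th).
  by move=> Tth x y; exact: le_trans (nonexp _ _ _ Tth) (contrG _ _ _ Tth).
(* On [Theta] a fixed point exists and [xget] returns it; the default 0 can only occur elsewhere. *)
pose ystar th := xget 0 [set y | y = S th y].
have ystarE th : Theta th -> ystar th = S th (ystar th).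
  move=> Tth; have [y hy] := enorm_fixed_point c01 (S_contr _ Tth).
  have h : exists y, [set y | y = S th y] y by exists y.
  exact: (xgetPex 0 h).
have ystar_unique th y : Theta th -> y = S th y -> y = ystar th.
  move=> Tth hy; have := S_contr _ Tth y (ystar th); rewrite -hy -ystarE// => h.
  apply/eqP; rewrite -subr_eq0; apply/eqP/enorm_eq0/eqP; rewrite eq_le enorm_ge0 andbT.
  have [_ c1] := andP c01; move: h; rewrite -subr_ge0 -{2}[enorm _]mul1r -mulrBl.
  by rewrite nmulr_rge0// subr_lt0.
exists ystar; split.
  move=> th Tth y; have [hfin [_ [_ _]]] := part_i th Tth.
  have [df [_ [scf lipf]]] := hf th Tth; have [surjK svK] := hK th Tth.
  have hG v := (dual_differentiable alpha0 alpha_beta lam0 df scf lipf surjK svK v).2.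
  have hlo u v : phi th u + dotv (grad (phi th) u) (v - u) <= phi th v.
    have := dual_lower alpha0 alpha_beta lam0 df scf lipf surjK svK u v.
    rewrite -hG; apply: le_trans; rewrite lerDl mulr_ge0 ?sqr_ge0// divr_ge0//.
    by rewrite divr_ge0 ?sqr_ge0// ltW.
  have hup u v : phi th v <= phi th u + dotv (grad (phi th) u) (v - u) + b / 2 * enorm (v - u) ^+ 2.
    have := dual_upper alpha0 alpha_beta lam0 df scf lipf surjK svK u v.
    by rewrite -hG.
  have dualE v : dual th v = ((phi th v)%:E + econj (g th) v)%E by rewrite /dual /phi fineK.
  have [h1 h2] := forward_backward_fixed_point y gamma0 (ccp _ Tth) hlo hup.
  split=> [hy|->].
    apply: ystar_unique => //; rewrite /S GE TE; apply: h1 => v.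
    by rewrite -!dualE.
  move=> v; rewrite !dualE.
  have [_ h3] := forward_backward_fixed_point (ystar th) gamma0 (ccp _ Tth) hlo hup.
  by apply: h3; rewrite -TE -GE; exact: ystarE.
move=> Tpt Gpt.
(* The gradient formula of part (i) identifies the point of the statement with the forward step, for
   parameters in [Theta] only. *)
have TptE th : Theta th -> Tpt th = col_mx th (ystar th - gamma *: gphi (col_mx th (ystar th))).
  move=> Tth; have [_ [_ [hgrad _]]] := part_i th Tth.
  by rewrite GE (hgrad _).2.2 scalerN opprK.
split; [|split].
- move=> th UV WZ Tth; rewrite TptE//.
  exact: (fixed_point_jacobian_unit oTheta gamma0 c01 nonexp contrG).
- exact: (loc_lipschitz_fixed_point oTheta gamma0 c01 TD GD nonexp contrG ystarE).
- have := conservative_fixed_point oTheta gamma0 c01 TD GD nonexp contrG ystarE.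
  by apply: conservative_on_ext => th Tth; rewrite TptE.
Qed.
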